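(* (i) Let $X\in\mathcal{H}^*$ have expected record sequence $\{\rho_n\}_{n\ge1}$. Then the random variable $T=\varphi(X)\in\mathcal{T}$ satisfies $$\frac{\rho_{n+2}-\rho_{n+1}}{\rho_2-\rho_1}=\frac{\mathbb{E}\,T^n}{(n+1)!},\qquad n=0,1,2,\ldots\qquad( * )$$ (ii) Let $T\in\mathcal{T}$. Then the random variable $X_0=\varphi'(T)\in\mathcal{H}_0$ (where $\varphi'=\varphi^{-1}$) has an expected record sequence $\{\rho_n\}_{n\ge1}$ that satisfies $( * )$ with $\rho_1=0$ and $\rho_2=1$.
   Context: Identically distributed random variables are regarded as equal. Inverse distribution functions are left-continuous: $F^{-1}(u)=\inf\{x:F(x)\ge u\}$, $0<u<1$. Put $L(u)=-\log(1-u)$, $0<u<1$. Records: let $U_1<U_2<\cdots$ be the sequence of (upper) record values of an i.i.d. sequence $V_1,V_2,\ldots$ from the uniform distribution on $(0,1)$: $\tau_1=1$, $U_1=V_1$, $\tau_{n+1}=\inf\{m>\tau_n:V_m>U_n\}$, $U_{n+1}=V_{\tau_{n+1}}$ (so $U_n$ has density $L(u)^{n-1}/(n-1)!$ on $(0,1)$). For $X$ with distribution function $F$, put $R_n=F^{-1}(U_n)$; the expected record sequence of $X$ is $\rho_n=\mathbb{E}R_n$, $n\ge1$ (all expectations being finite). A function $H:(0,\infty)\to\mathbb{R}$ belongs to $\mathcal{H}^*$ if it is non-constant, non-decreasing, left-continuous and $\int_0^\infty y^m e^{-y}|H(y)|\,dy<\infty$ for $m=0,1,2,\ldots$. $\mathcal{H}_0$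 is the set of $H\in\mathcal{H}^*$ with $\int_0^\infty e^{-y}H(y)\,dy=0$ and $\int_0^\infty y e^{-y}H(y)\,dy=1$. A random variable $X$ is said to belong to $\mathcal{H}^*$ (resp. $\mathcal{H}_0$) if its inverse distribution function $G$ can be written as $G(u)=H(-\log(1-u))$, $0<u<1$, with $H\in\mathcal{H}^*$ (resp. $H\in\mathcal{H}_0$). $\mathcal{T}$ is the set of all random variables $T$ with $\Pr(T>0)=1$ and finite moments of every order. Map $\varphi$: for $X\in\mathcal{H}^*$ with distribution function $F$, $\varphi(X):=L(F(V))$, where $V$ is a random variable with Lebesgue density $f_V(x)=(1-F(x))L(F(x))\big/\int_{\mathbb{R}}(1-F(y))L(F(y))\,dy$, $x\in\mathbb{R}$, with the convention $(1-F(x))L(F(x))=0$ if $F(x)\in\{0,1\}$. Map $\varphi'$ (the inverse of $\varphi$ restricted to $\mathcal{H}_0$): for $T\in\mathcal{T}$ with distribution function $F_T$, $\varphi'(T)$ is the random variable whose inverse distribution function $G_0$ is given by $G_0(1-e^{-y})=H_0(y)$, $y>0$, where $$H_0(y)=\frac{e^y}{y}F_T(y-)-\int_1^y\frac{x-1}{x^2}e^xF_T(x)\,dx-c_T,\qquad y>0,$$ $F_T(y-)=\Pr(T<y)$, $\int_1^y=-\int_y^1$ if $0<y<1$, and $c_T$ is the unique constant (depending only on $T$) for which $\int_0^\infty e^{-y}H_0(y)\,dy=0$. *)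

(* Defs.v *)
From HB Require Import structures.
From mathcomp Require Import all_boot all_order all_algebra finmap.
From mathcomp Require Import all_classical all_reals all_analysis.

Set Implicit Arguments.
Unset Strict Implicit.
Unset Printing Implicit Defensive.

Import Order.TTheory GRing.Theory Num.Theory.
Import numFieldNormedType.Exports.

Local Open Scope classical_set_scope.
Local Open Scope ring_scope.

(* Random variables are identified when they are identically distributed:
   a "random variable" is its law, a Borel probability measure on R.  Laws
   are compared on Borel sets only, because the value of a measure on a
   non-measurable set is unconstrained. *)
Definition law (R : realType) : Type := probability (measurableTypeR R) R.

Definition law_eq (R : realType) (X Y : law R) : Prop :=
  forall A : set (measurableTypeR R), measurable A -> X A = Y A.

Definition distr_fun (R : realType) (X : law R) (x : R) : R :=
  fine (X `]-oo, x]%classic).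

(* F(x-) = Pr(X < x) *)
Definition distr_fun_left (R : realType) (X : law R) (x : R) : R :=
  fine (X `]-oo, x[%classic).

(* Only meaningful for 0 < u < 1, where the set is non-empty and bounded
   below. *)
Definition inv_distr_fun (R : realType) (X : law R) (u : R) : R :=
  inf [set x | u <= distr_fun X x].

Definition L (R : realType) (u : R) : R := - ln (1 - u).

(* Sequences start at 0: V k, record_time V _ n and record_value V _ n are
   V_{k+1}, tau_{n+1} (shifted by one) and U_{n+1} in the usual numbering. *)

Definition mutually_independent d (Omega : measurableType d) (R : realType)
    (P : probability Omega R) (V : nat -> {RV P >-> R}) : Prop :=
  forall (J : {fset nat}) (A : nat -> set R),
    (forall j, measurable (A j)) ->
    P (\bigcap_(j in [set` J]) (V j @^-1` A j)) =
    (\prod_(j <- J) P (V j @^-1` A j))%E.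

Definition iid_uniform01 d (Omega : measurableType d) (R : realType)
    (P : probability Omega R) (V : nat -> {RV P >-> R}) : Prop :=
  mutually_independent V /\
  forall (k : nat) (A : set R), measurable A ->
    distribution P (V k) A = uniform_prob (@ltr01 R) A.

(* The infimum of a set of natural numbers; the value 0 for the empty set is
   a dummy, met by record_time below on a null event only. *)
Definition nat_inf (A : set nat) : nat :=
  xget 0%N [set m | A m /\ forall k, A k -> (m <= k)%N].

Fixpoint record_time (R : realType) (v : nat -> R) (n : nat) : nat :=
  if n is n'.+1 then
    nat_inf [set m | (record_time v n' < m)%N /\ v (record_time v n') < v m]
  else 0%N.

Definition record_value (Omega : Type) (R : realType) (V : nat -> Omega -> R)
    (n : nat) (w : Omega) : R :=
  V (record_time (V ^~ w) n) w.

(* R_{n+1} = F^{-1}(U_{n+1}) *)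
Definition record_of (Omega : Type) (R : realType) (V : nat -> Omega -> R)
    (X : law R) (n : nat) (w : Omega) : R :=
  inv_distr_fun X (record_value V n w).

Definition has_expected_records d (Omega : measurableType d) (R : realType)
    (P : probability Omega R) (V : nat -> {RV P >-> R}) (X : law R) : Prop :=
  forall n, P.-integrable [set: Omega] (EFin \o record_of V X n).

(* rho_{n+1} = E R_{n+1} *)
Definition expected_record d (Omega : measurableType d) (R : realType)
    (P : probability Omega R) (V : nat -> {RV P >-> R}) (X : law R)
    (n : nat) : R :=
  fine ('E_P[record_of V X n])%E.

(* Functions on (0, +oo) are functions on R of which only the values at
   positive arguments matter. *)
Definition Hstar_fun (R : realType) (H : R -> R) : Prop :=
  [/\ exists x y, [/\ 0 < x, 0 < y & H x != H y],
      forall x y, 0 < x -> x <= y -> H x <= H y,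
      forall y, 0 < y -> H x @[x --> y^'-] --> H y
    & forall m : nat,
        (\int[@lebesgue_measure R]_(y in `]0%R, +oo[)
           (y ^+ m * expR (- y) * `|H y|)%:E < +oo)%E].

Definition H0_fun (R : realType) (H : R -> R) : Prop :=
  [/\ Hstar_fun H,
      (\int[@lebesgue_measure R]_(y in `]0%R, +oo[)
         (expR (- y) * H y)%:E = 0)%E
    & (\int[@lebesgue_measure R]_(y in `]0%R, +oo[)
         (y * expR (- y) * H y)%:E = 1)%E].

Definition Hstar (R : realType) (X : law R) : Prop :=
  exists2 H : R -> R, Hstar_fun H &
    forall u, 0 < u < 1 -> inv_distr_fun X u = H (- ln (1 - u)).

Definition H0 (R : realType) (X : law R) : Prop :=
  exists2 H : R -> R, H0_fun H &
    forall u, 0 < u < 1 -> inv_distr_fun X u = H (- ln (1 - u)).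

Definition calT (R : realType) (T : law R) : Prop :=
  T `]0%R, +oo[%classic = 1%E /\
  forall n : nat,
    T.-integrable [set: measurableTypeR R] (fun x : R => (x ^+ n)%:E).

Definition moment (R : realType) (T : law R) (n : nat) : R :=
  fine (\int[T]_x (x ^+ n)%:E)%E.

(* The unnormalised density (1 - F) L(F) of V.  It is 0 where F is 0 or 1, as
   required: L 0 = 0, and the first factor vanishes when F = 1. *)
Definition phi_weight (R : realType) (X : law R) (x : R) : R :=
  (1 - distr_fun X x) * L (distr_fun X x).

Definition phi_density (R : realType) (X : law R) (x : R) : R :=
  phi_weight X x / \int[@lebesgue_measure R]_y phi_weight X y.

(* T = phi(X): T is the law of L(F(V)) with V of density phi_density X.  No T
   qualifies when phi_weight X has integral 0 or +oo, since phi_density X is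
   then identically 0. *)
Definition is_phi (R : realType) (X T : law R) : Prop :=
  exists V : law R,
    (forall A : set (measurableTypeR R), measurable A ->
       V A = (\int[@lebesgue_measure R]_(x in A) (phi_density X x)%:E)%E) /\
    (forall A : set (measurableTypeR R), measurable A ->
       T A = V ((fun x => L (distr_fun X x)) @^-1` A)).

Definition oriented_integral (R : realType) (a b : R) (f : R -> R) : R :=
  if a <= b then \int[@lebesgue_measure R]_(x in `[a, b]) f x
  else - \int[@lebesgue_measure R]_(x in `[b, a]) f x.

Definition phi_inv_fun (R : realType) (T : law R) (c y : R) : R :=
  expR y / y * distr_fun_left T y
  - oriented_integral 1 y
      (fun x => (x - 1) / x ^+ 2 * expR x * distr_fun T x)
  - c.

(* X = phi'(T); the constant c is c_T. *)
Definition is_phi_inv (R : realType) (T X : law R) : Prop :=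
  exists c : R,
    (\int[@lebesgue_measure R]_(y in `]0%R, +oo[)
       (expR (- y) * phi_inv_fun T c y)%:E = 0)%E /\
    forall y, 0 < y ->
      inv_distr_fun X (1 - expR (- y)) = phi_inv_fun T c y.

(* The identity linking an expected record sequence rho (rho n being
   rho_{n+1}) to the moments of T. *)
Definition records_moments (R : realType) (rho : nat -> R) (T : law R) : Prop :=
  forall n : nat,
    (rho n.+1 - rho n) / (rho 1%N - rho 0%N) = moment T n / (n.+1)`!%:R.

(* Main.v *)
Require Import Defs.
From HB Require Import structures.
From mathcomp Require Import all_boot all_order all_algebra finmap.
From mathcomp Require Import all_classical all_reals all_analysis.
From mathcomp Require Import measurable_realfun.
From mathcomp Require Import ring lra.
Import Order.TTheory GRing.Theory Num.Theory.
Import numFieldNormedType.Exports.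
Local Open Scope classical_set_scope.
Local Open Scope ring_scope.

Set Implicit Arguments.
Unset Strict Implicit.
Unset Printing Implicit Defensive.

(** Let [erlang n y = y^n e^(-y) / n!].  The proof has three ingredients.

    _The law of a record value._  All indices start at 0, so that [U 0] is the
    first record.  Follow the sequence through the pair formed
    by the number of records after the first one and the running maximum.  By
    independence, on the event that [n] later records occurred up to time [k],
    the running maximum has a density [c(k,n) u^k]: the next value [V (k+1)]
    stays below a maximum [u] with probability [u], and exceeds all previous
    values at height [v] with probability density [int_0^v c(k,n) u^k du]
    ([chain_law]).  A record number [n+1] at time [k+1] is a step of the second
    kind, so the density of [U (n+1)] is the sum over [k] of
    [c(k,n) v^(k+1) / (k+1)].  The recurrence for [c] turns into one for these
    sums, which yields [L(v)^(n+1) / (n+1)!] ([record_series]).  In the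
    variable [y = L(v)] this density is [erlang (n+1) y].  Hence, for [X] given
    by [H], the expected records are the numbers
    [rho H n = int erlang n y H(y) dy].

    _From X to T._  The set of the [x] with [z <= L(F(x)) < y] is the interval
    from [H z] to [H y], so Lebesgue measure pushed forward by [L o F] is [dH]
    on the positive half-line.  The tail of [erlang n] exceeds that of
    [erlang (n-1)] by [erlang n] itself, so Tonelli gives
    [rho H (n+1) - rho H n = int erlang (n+1) dH] ([increments_moments]).  By
    definition [T = phi(X)] has law [erlang 1 dH / c] with
    [c = int erlang 1 dH = rho H 1 - rho H 0], and
    [t^n erlang 1 t = (n+1)! erlang (n+1) t], which is the identity between
    records and moments.

    _From T to X._  The relation above inverts to [dH = c (e^t / t) dT].  The
    function defining [phi'(T)] is [int (e^t / t) dT], with [c = 1], after an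
    integration by parts ([phi_inv_increments]).  The Tonelli argument applies
    to it as well: the moments of [T] make [erlang n H] integrable, and the
    normalisations follow.  That [phi] leads back to [T] holds because a law on
    the positive half-line is determined by the integrals of [e^t / t] over
    intervals ([law_eq_of_increments]).  Two elements of [H0] with the same
    image under [phi] come from functions with equal increments, and the
    condition [rho H 0 = 0] fixes the additive constant. *)

(** * Densities and laws *)

Section density.
Context d (T : measurableType d) (R : realType).
Variables (mu nu : {measure set T -> \bar R}) (w : T -> R).
Hypotheses (mw : measurable_fun [set: T] w) (w0 : forall x, 0 <= w x).
Hypothesis nuE : forall A, measurable A ->
  nu A = (\int[mu]_(x in A) (w x)%:E)%E.

Import HBNNSimple.

Let nnsfun_density (f : {nnsfun T >-> R}) :
  (\int[nu]_x (f x)%:E = \int[mu]_x ((f x)%:E * (w x)%:E))%E.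
Proof.
under [LHS]eq_integral do rewrite fimfunE -fsumEFin//.
under [RHS]eq_integral.
  move=> x _; rewrite fimfunE -fsumEFin// ge0_mule_fsuml; last first.
    by move=> r; rewrite EFinM nnfun_muleindic_ge0.
  over.
rewrite ge0_integral_fsum//; last 2 first.
- by move=> r; exact/measurable_EFinP/measurableT_comp.
- by move=> n x _; rewrite EFinM nnfun_muleindic_ge0.
rewrite ge0_integral_fsum//; last 2 first.
- move=> r; apply: emeasurable_funM; last exact/measurable_EFinP.
  exact/measurable_EFinP/measurableT_comp.
- by move=> n x _; rewrite mule_ge0 ?lee_fin// -lee_fin EFinM nnfun_muleindic_ge0.
apply: eq_fsbigr => r rf.
have mr : measurable (f @^-1` [set r]) by [].
rewrite integralZl_indic_nnsfun// integral_indic// setIT nuE//.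
under [RHS]eq_integral do rewrite EFinM -muleA.
rewrite ge0_integralZl//.
- congr (_ * _)%E.
  rewrite integral_mkcond; apply: eq_integral => x _.
  by rewrite patchE indicE; case: ifP => _; rewrite ?mul1e ?mul0e.
- apply: emeasurable_funM; last exact/measurable_EFinP.
  exact/measurable_EFinP/measurable_indic.
- by move=> x _; rewrite mule_ge0// lee_fin.
- by move: rf; rewrite inE => -[t _ <-]; rewrite lee_fin.
Qed.

(** Standard approximation by simple functions. It is stated for a measure
    given by its values, since the measures met below are pushforwards,
    restrictions to events and laws supplied by a hypothesis, none of which
    is an integral by construction. *)
Lemma ge0_integral_density (f : T -> \bar R) :
  measurable_fun [set: T] f -> (forall x, 0 <= f x)%E ->
  (\int[nu]_x f x = \int[mu]_x (f x * (w x)%:E))%E.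
Proof.
move=> mf f0; pose h := nnsfun_approx measurableT mf.
transitivity (limn (fun n => \int[nu]_x (h n x)%:E))%E.
  rewrite -monotone_convergence//.
  - by apply: eq_integral => x _; apply/esym/cvg_lim => //; exact: cvg_nnsfun_approx.
  - by move=> n; exact/measurable_EFinP.
  - by move=> n x _; rewrite lee_fin.
  - by move=> x _ a b ab; rewrite lee_fin; exact/lefP/nd_nnsfun_approx.
rewrite (_ : (fun n => _) = (fun n => \int[mu]_x ((h n x)%:E * (w x)%:E))%E); last first.
  by apply/funext => n; exact: nnsfun_density.
rewrite -monotone_convergence//.
- apply: eq_integral => x _; apply/cvg_lim => //; apply: cvgeZr => //.
  exact: cvg_nnsfun_approx.
- move=> n; apply: emeasurable_funM; exact/measurable_EFinP.
- by move=> n x _; rewrite mule_ge0// lee_fin.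
- by move=> x _ a b ab; rewrite lee_wpmul2r ?lee_fin//; exact/lefP/nd_nnsfun_approx.
Qed.

End density.

Section density_law.
Context d (T : measurableType d) (R : realType).
Variables (mu : {measure set T -> \bar R}) (w : T -> R).
Hypotheses (mw : measurable_fun [set: T] w) (w0 : forall x, 0 <= w x).
Hypothesis w1 : (\int[mu]_x (w x)%:E = 1)%E.

(** The proofs are arguments so that the measure and probability structures
    can be attached to the term itself. *)
Definition density_law (_ : measurable_fun [set: T] w)
    (_ : forall x, 0 <= w x) (_ : (\int[mu]_x (w x)%:E = 1)%E)
    (A : set T) : \bar R :=
  (\int[mu]_(x in A) (w x)%:E)%E.

Local Notation P := (density_law mw w0 w1).

Let P0 : P set0 = 0%E.
Proof. by rewrite /density_law integral_set0. Qed.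

Let P_ge0 A : (0 <= P A)%E.
Proof. by apply: integral_ge0 => x _; rewrite lee_fin. Qed.

Let P_sigma_additive : semi_sigma_additive P.
Proof.
move=> /= F mF tF mUF; rewrite /density_law; apply: cvg_toP.
  apply: ereal_nondecreasing_is_cvgn => m n mn.
  apply: lee_sum_nneg_natr => // k _ _.
  by apply: integral_ge0 => x _; rewrite lee_fin.
rewrite ge0_integral_bigcup//=.
- exact/measurable_funTS/measurable_EFinP.
- by move=> x _; rewrite lee_fin.
Qed.

HB.instance Definition _ := isMeasure.Build _ _ _ P P0 P_ge0 P_sigma_additive.

HB.instance Definition _ := @Measure_isProbability.Build _ _ R P w1.

End density_law.

(** The preimage of a ray under a monotone function is an interval. *)
Lemma measurable_of_itv_homo (R : realType) (I : interval R) (f : R -> R) :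
  (forall x y, x \in I -> y \in I -> x <= y -> f x <= f y) ->
  measurable_fun [set` I] f.
Proof.
move=> f_nd; apply: (measurability (@RGenCInfty.G R)) => [|/= _ [_] [r] -> <-].
  exact: RGenCInfty.measurableE.
apply: is_interval_measurable => s t /= [Is +] [It _] u /andP[su ut].
rewrite !in_itv/= !andbT => fs.
have Iu : u \in I.
  by have := (@interval_is_interval R I) s t Is It u; rewrite su ut; exact.
split; last exact: (le_trans fs (f_nd _ _ Is Iu su)).
by move: Iu; rewrite in_itv.
Qed.

Lemma law_unique (R : realType) (X Y : law R) :
  (forall x, X `]-oo, x]%classic = Y `]-oo, x]%classic) -> law_eq X Y.
Proof.
move=> XY A mA.
apply: (@measure_unique _ R (measurableTypeR R) (@ocitv R)
  (fun n => `]- n%:R, n%:R]%classic)) => //.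
- exact: ocitvI.
- by move=> n; exact: is_ocitv.
- exact: bigcup_itvT.
- move=> _ [[a b] /= _ <-].
  have [ab | ba] := leP a b; last first.
    by rewrite set_itv_ge ?measure0// bnd_simp -leNgt ltW.
  have -> : `]a, b]%classic = `]-oo, b] `\` `]-oo, a].
    by rewrite -[RHS]setCK setCD setCitvl setUC -[LHS]setCK setCitv.
  have sub : `]-oo, a]%classic `<=` `]-oo, b]%classic by exact: subset_itvl.
  have fin (Z : law R) B : measurable B -> (Z B < +oo)%E.
    by move=> mB; rewrite -ge0_fin_numE// fin_num_measure.
  by rewrite !measureD ?(setIidr sub) ?fin//; congr (_ - _)%E; exact: XY.
- by move=> k; rewrite -ge0_fin_numE// fin_num_measure.
Qed.

(** * The substitution u = 1 - exp(-y) *)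

Lemma uniform_itvNyc (R : realType) (x : R) : 0 <= x <= 1 ->
  uniform_prob (@ltr01 R) `]-oo, x]%classic = x%:E.
Proof.
move=> /andP[x0 x1]; rewrite /= /uniform_prob integral_uniform_pdf.
rewrite (_ : _ `&` _ = `[0, x]%classic); last first.
  apply/seteqP; split => y /=; rewrite !in_itv/=.
    by case=> -> /andP[-> _].
  by move=> /andP[-> yx]; rewrite yx (le_trans yx).
rewrite (eq_integral (cst 1%E)); last first.
  move=> y; rewrite inE/= in_itv/= => /andP[y0 yx].
  by rewrite /uniform_pdf y0 (le_trans yx)// subr0 invr1.
rewrite integral_cst// mul1e; apply: (eq_trans (lebesgue_measure_itv _)).
by rewrite /= lte_fin; case: ltgtP x0 => // [_|<-] _; rewrite ?sube0.
Qed.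

Section uniform_exponential.
Context (R : realType).
Local Notation mu := (@lebesgue_measure R).

Definition Linv (y : R) : R := 1 - expR (- y).

Lemma measurable_Linv : measurable_fun [set: R] Linv.
Proof. by apply: measurable_funB => //; exact: measurableT_comp. Qed.

Lemma Linv_itv (y : R) : 0 < y -> 0 < Linv y < 1.
Proof.
by move=> y0; rewrite subr_gt0 expR_lt1 oppr_lt0 y0/= gtrBl expR_gt0.
Qed.

Lemma LK (u : R) : u < 1 -> Linv (L u) = u.
Proof. by move=> u1; rewrite /Linv /L opprK lnK ?posrE ?subr_gt0// subKr. Qed.

Lemma LinvK (y : R) : L (Linv y) = y.
Proof. by rewrite /Linv /L subKr expRK opprK. Qed.

Lemma L_gt0 (u : R) : 0 < u < 1 -> 0 < L u.
Proof.
by move=> /andP[u0 u1]; rewrite oppr_gt0 ln_lt0// subr_gt0 u1/= gtrBl.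
Qed.

Lemma Linv_le (y z : R) : (Linv y <= Linv z) = (y <= z).
Proof. by rewrite lerD2l lerN2 ler_expR lerN2. Qed.

Lemma Linv_lt (y z : R) : (Linv y < Linv z) = (y < z).
Proof. by rewrite !ltNge Linv_le. Qed.

Let e1 : R := 1.

Let expw_ge0 x : 0 <= exponential_pdf e1 x.
Proof. exact: exponential_pdf_ge0. Qed.

Let expw1 : (\int[mu]_x (exponential_pdf e1 x)%:E = 1)%E.
Proof. exact: integral_exponential_pdf. Qed.

Let expl : law R :=
  @density_law _ (measurableTypeR R) R mu (exponential_pdf e1)
    (measurable_exponential_pdf e1) expw_ge0 expw1.

Let mL : measurable_fun [set: measurableTypeR R] (Linv : _ -> measurableTypeR R).
Proof. exact: measurable_Linv. Qed.

HB.instance Definition _ :=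
  @isMeasurableFun.Build _ _ _ _ (Linv : measurableTypeR R -> measurableTypeR R) mL.

Let u01 : law R := uniform_prob (@ltr01 R).
Let expL : law R := distribution expl (Linv : measurableTypeR R -> measurableTypeR R).

Let u01_cdf (x : R) : 0 <= x <= 1 -> u01 `]-oo, x]%classic = x%:E.
Proof. exact: uniform_itvNyc. Qed.

Let expl_out (A : set R) : A `<=` `]-oo, 0[%classic -> expl A = 0%E.
Proof.
move=> A0; apply: integral0_eq => y /A0/=; rewrite in_itv/= => y0.
by rewrite lt0_exponential_pdf.
Qed.

Let expl0 : expl `]-oo, 0]%classic = 0%E.
Proof.
rewrite (_ : `]-oo, 0]%classic = `]-oo, 0[ `|` [set 0]); last first.
  apply/seteqP; split => y/=; rewrite !in_itv/= le_eqVlt.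
    by case/orP => [/eqP ->|->]; [right|left].
  by case=> [->|->]; rewrite ?eqxx// orbT.
rewrite measureU0//; first exact: expl_out.
exact: integral_set1.
Qed.

Let uniform_exponential : law_eq u01 expL.
Proof.
apply: law_unique => x.
have -> : expL `]-oo, x]%classic = expl [set y | Linv y <= x].
  by rewrite /expL /distribution /pushforward; congr (expl _);
    apply/seteqP; split => y /=; rewrite in_itv.
have [x1|x1] := leP 1 x.
  rewrite (_ : [set y | Linv y <= x] = setT); last first.
    apply/seteqP; split => // y _ /=.
    have y1 : Linv y <= 1 by rewrite gerBl expR_ge0.
    exact: le_trans y1 x1.
  rewrite probability_setT; apply/eqP; rewrite eq_le probability_le1//=.
  rewrite -[leLHS](u01_cdf (x := 1)) ?lexx ?ler01//.
  by apply: le_measure; rewrite ?inE//; exact: subset_itvl.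
rewrite (_ : [set y | Linv y <= x] = `]-oo, L x]%classic); last first.
  by apply/seteqP; split => y /=; rewrite in_itv/= -[y <= L x]Linv_le LK.
have [x0|x0] := ltP 0 x.
  have Lx0 : 0 < L x by rewrite L_gt0// x0.
  rewrite u01_cdf ?(ltW x0) ?ltW//.
  rewrite (_ : `]-oo, L x]%classic = `[0, L x] `|` `]-oo, 0[); last first.
    apply/seteqP; split => y/=; rewrite !in_itv/=.
      by case: (ltP y 0) => y0 yx; [right|left].
    by case=> [/andP[]//|/ltW y0]; rewrite (le_trans y0)// ltW.
  rewrite measureU0//; last exact: expl_out.
  apply/esym; apply: (eq_trans (exponential_prob_itv0c _ Lx0)).
  by rewrite mulN1r -EFinB -/(Linv (L x)) LK.
have Lx0 : L x <= 0 by rewrite oppr_le0 ln_ge0// lerBrDl gerDr.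
transitivity (0%E : \bar R).
  apply/eqP; rewrite eq_le measure_ge0 andbT.
  rewrite -[leRHS](u01_cdf (x := 0)) ?lexx ?ler01//.
  by apply: le_measure; rewrite ?inE//; exact: subset_itvl.
apply/esym/eqP; rewrite eq_le measure_ge0 andbT -[leRHS]expl0.
by apply: le_measure; rewrite ?inE//; exact: subset_itvl.
Qed.

(** The change of variables [y = L(u)], read off from the fact that [L] maps
    the uniform law to the exponential law: comparing distribution functions
    is enough. *)
Lemma integral_uniform_exponential (f : R -> \bar R) :
  measurable_fun (`]0, 1[%classic : set R) f -> (forall x, 0 <= f x)%E ->
  (\int[mu]_(u in `]0%R, 1%R[) f u =
   \int[mu]_(y in `]0%R, +oo[) (f (Linv y) * (expR (- y))%:E))%E.
Proof.
move=> mf f0; pose g := f \_ `]0, 1[.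
have g0 x : (0 <= g x)%E by rewrite /g patchE; case: ifP.
have mg : measurable_fun [set: measurableTypeR R] g by apply/measurable_restrict; rewrite ?setTI.
transitivity (\int[u01]_x g x)%E.
  rewrite integral_uniform// subr0 invr1 mul1e /g -integral_mkcondr.
  congr (integral _ _ _); apply/seteqP; split=> y/=; rewrite !in_itv/=; last by case.
  by move=> /andP[y0 y1]; rewrite y0 y1 !ltW.
rewrite (eq_measure_integral expL); last by move=> A mA _; exact: uniform_exponential.
rewrite ge0_integral_pushforward//= (ge0_integral_density (w := exponential_pdf e1) (mu := mu))//=; first last.
- exact: measurableT_comp.
- exact: measurable_exponential_pdf.
rewrite [RHS]integral_mkcond; apply: eq_integral => y _.
rewrite patchE mem_setE in_itv/= andbT /g patchE mem_setE in_itv/=.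
case: (ltP 0 y) => y0; first by rewrite Linv_itv// exponential_pdfE ?ltW// mul1r mulN1r.
by rewrite ltNge subr_le0 -expR0 ler_expR oppr_ge0 y0/= mul0e.
Qed.

End uniform_exponential.

(** * Record times and the running maximum *)

Lemma measurable_lt_set d (T : measurableType d) (R : realType) (f g : T -> R) :
  measurable_fun [set: T] f -> measurable_fun [set: T] g ->
  measurable [set w | f w < g w].
Proof.
move=> mf mg; have := measurable_fun_ltr mf mg => /(_ measurableT [set true]).
by rewrite setTI; apply.
Qed.

Section record_chain.
Context (R : realType).
Implicit Type v : nat -> R.

(** Together with [later_records], the state of the Markov chain that is
    used to compute the law of the records: the records are the values at
    which the running maximum jumps. *)
Fixpoint running_max v (k : nat) : R :=
  if k is k'.+1 then Num.max (running_max v k') (v k) else v 0%N.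

Fixpoint later_records v (k : nat) : nat :=
  if k is k'.+1 then (later_records v k' + (running_max v k' < v k)%R)%N else 0%N.

Lemma nat_infE (A : set nat) (m : nat) :
  A m -> (forall k, A k -> (m <= k)%N) -> nat_inf A = m.
Proof.
move=> Am mA; apply: xget_subset1 => //= a b [Aa aA] [Ab bA].
by apply/eqP; rewrite eqn_leq aA// bA.
Qed.

Lemma record_time_step v r k :
  (r <= k)%N -> (forall j, (r < j <= k)%N -> v j <= v r) -> v r < v k.+1 ->
  nat_inf [set m | (r < m)%N /\ v r < v m] = k.+1.
Proof.
move=> rk vr vk; apply: nat_infE => [|j /= [rj vrj]]; first by split.
rewrite ltnNge; apply/negP => jk; move: vrj.
by rewrite ltNge vr// rj.
Qed.

(** Up to time [k], the latest record is the maximum, reached for the first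
    time at the record time indexed by the number of records after the
    first. *)
Lemma record_time_later_records v k (r := record_time v (later_records v k)) :
  [/\ (r <= k)%N, v r = running_max v k
    & forall j, (r < j <= k)%N -> v j <= v r].
Proof.
rewrite {}/r; elim: k => [|k [rk vr rj]] /=.
  by split => // j; case: j.
have [vk|vk] := ltP (running_max v k) (v k.+1).
  rewrite addn1 /= (record_time_step rk rj) ?vr//; split => // j.
  by move=> /andP[+ jk]; rewrite ltnNge jk.
rewrite addn0; split => //; first exact: leqW.
move=> j /andP[rltj]; rewrite leq_eqVlt => /orP[/eqP ->|jk].
  by rewrite vr.
by apply: rj; rewrite rltj.
Qed.

Lemma record_time_new v k : running_max v k < v k.+1 ->
  record_time v (later_records v k).+1 = k.+1.
Proof.
have [rk vr rj] := record_time_later_records v k.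
by rewrite -vr => ?; apply: record_time_step.
Qed.

End record_chain.

Section record_measurability.
Context d (Omega : measurableType d) (R : realType) (V : nat -> Omega -> R).
Hypothesis mV : forall k, measurable_fun [set: Omega] (V k).

Lemma measurable_running_max k :
  measurable_fun [set: Omega] (fun w => running_max (V ^~ w) k).
Proof. by elim: k => [|k IH] //=; apply: measurable_maxr. Qed.

Lemma measurable_later_records k n :
  measurable [set w | later_records (V ^~ w) k = n].
Proof.
elim: k n => [|k IH] n /=.
  have [->|n0] := eqVneq n 0%N.
    by rewrite (_ : [set _ | _] = setT)//; apply/seteqP; split.
  rewrite (_ : [set _ | _] = set0)//; apply/seteqP; split => // w /= n0'.
  by move: n0; rewrite -n0' eqxx.
have mlt : measurable [set w | running_max (V ^~ w) k < V k.+1 w].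
  apply: measurable_lt_set => //.
  exact: measurable_running_max.
rewrite (_ : [set _ | _] =
  ([set w | running_max (V ^~ w) k < V k.+1 w] `&`
     \bigcup_(m in [set m | m.+1 = n]) [set w | later_records (V ^~ w) k = m]) `|`
  (~` [set w | running_max (V ^~ w) k < V k.+1 w] `&`
     [set w | later_records (V ^~ w) k = n])); last first.
  apply/seteqP; split => w /=.
    case: ltP => vk; first by rewrite addn1 => <-; left; split => //; eexists.
    by rewrite addn0 => <-; right; split => //; apply/negP; rewrite -leNgt.
  case=> [[-> [m <- ->]]|[/negP/negbTE -> ->]]; first by rewrite addn1.
  by rewrite addn0.
apply: measurableU; apply: measurableI => //; last exact: measurableC.
by apply: bigcup_measurable => m _.
Qed.

(** The event that no later value exceeds the current record carries the
    dummy time 0, so it is treated as a separate countable combination of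
    events. *)
Lemma measurable_record_time n m :
  measurable [set w | record_time (V ^~ w) n = m].
Proof.
elim: n m => [|n IH] m /=.
  have [->|m0] := eqVneq m 0%N.
    by rewrite (_ : [set _ | _] = setT)//; apply/seteqP; split.
  rewrite (_ : [set _ | _] = set0)//; apply/seteqP; split => // w /= m0'.
  by move: m0; rewrite -m0' eqxx.
pose A j := [set w | (record_time (V ^~ w) n < j)%N /\
  V (record_time (V ^~ w) n) w < V j w].
have mA j : measurable (A j).
  rewrite (_ : A j = \bigcup_(i < j) ([set w | record_time (V ^~ w) n = i] `&`
      [set w | V i w < V j w])); last first.
    apply/seteqP; split => w /=; first by case=> rj vj; eexists; first exact: rj.
    by case=> i /= ij [ri vij]; rewrite /A/= ri.
  apply: bigcup_measurable => i _; apply: measurableI => //.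
  exact: measurable_lt_set.
have nat_infA w : (exists j, A j w) ->
    A (nat_inf [set j | A j w]) w /\
    forall j, A j w -> (nat_inf [set j | A j w] <= j)%N.
  move=> [j Aj]; have ex : exists j, `[< A j w >] by exists j; apply/asboolP.
  have -> : nat_inf [set j | A j w] = ex_minn ex.
    case: ex_minnP => i /asboolP Ai mi.
    by apply: nat_infE => // l Al; apply: mi; apply/asboolP.
  by case: ex_minnP => i /asboolP Ai mi; split => // l Al; apply: mi; apply/asboolP.
rewrite (_ : [set _ | _] =
  (A m `&` \bigcap_(j < m) ~` A j) `|`
  ((~` \bigcup_j A j) `&` [set w | m = 0%N])); last first.
  apply/seteqP; split => w /=.
    have [/nat_infA[+ minA]|noA] := pselect (exists j, A j w).
      rewrite -[nat_inf _]/(nat_inf [set j | A j w]) => Aw <-; left; split => //.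
      by move=> j /= jm Aj; move: (minA _ Aj); rewrite leqNgt jm.
    have -> : nat_inf [set m0 | (record_time (V^~ w) n < m0)%N /\
        V (record_time (V^~ w) n) w < V m0 w] = 0%N.
      by apply: xgetPN => j /= [Aj _]; apply: noA; exists j.
    by move=> <-; right; split => // -[j _ Aj]; apply: noA; exists j.
  case=> [[Am mA']|[noA ->]].
    apply: nat_infE => // j Aj; rewrite leqNgt; apply/negP => jm.
    exact: mA' Aj.
  by apply: xgetPN => j /= [Aj _]; apply: noA; exists j.
apply: measurableU.
  apply: measurableI => //.
  by apply: bigcap_measurableType => j _; exact: measurableC.
apply: measurableI; first by apply: measurableC; exact: bigcup_measurable.
have [->|m0] := eqVneq m 0%N.
  by rewrite (_ : [set _ | _] = setT)//; apply/seteqP; split.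
rewrite (_ : [set _ | _] = set0)//; apply/seteqP; split => // w /= m0'.
by move: m0; rewrite m0' eqxx.
Qed.

Lemma measurable_record_value n : measurable_fun [set: Omega] (record_value V n).
Proof.
move=> _ A mA; rewrite setTI.
rewrite (_ : _ @^-1` _ = \bigcup_k ([set w | record_time (V ^~ w) n = k] `&`
    (V k @^-1` A))); last first.
  apply/seteqP; split => w /=; first by move=> Aw; eexists.
  by case=> k _ /= [<-].
apply: bigcup_measurable => k _; apply: measurableI; first exact: measurable_record_time.
by rewrite -[X in measurable X]setTI; exact: mV.
Qed.

End record_measurability.

(** * Independence of the past from the future *)

Section law_on_event.
Context d (Omega : measurableType d) (R : realType) (P : probability Omega R).
Context d' (T : measurableType d') (D : set Omega) (X : Omega -> T).
Hypotheses (mD : measurable D) (mX : measurable_fun [set: Omega] X).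

(** The (unnormalised) law of [X] restricted to the event [D]. *)
Definition law_on_event (_ : measurable D) (_ : measurable_fun [set: Omega] X)
    (A : set T) : \bar R :=
  P (D `&` X @^-1` A).

Local Notation m := (law_on_event mD mX).

Let mDX (A : set T) : measurable A -> measurable (D `&` X @^-1` A).
Proof.
by move=> mA; apply: measurableI => //; rewrite -[X in measurable X]setTI; exact: mX.
Qed.

Let m0 : m set0 = 0%E.
Proof. by rewrite /law_on_event preimage_set0 setI0 measure0. Qed.

Let m_ge0 A : (0 <= m A)%E.
Proof. by []. Qed.

Let m_sigma_additive : semi_sigma_additive m.
Proof.
move=> F mF tF mUF; rewrite /law_on_event preimage_bigcup setI_bigcupr.
apply: measure_semi_sigma_additive.
- by move=> n; exact: mDX.
- apply/trivIsetP => /= i j _ _ ij.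
  rewrite setIACA setIid -preimage_setI.
  by move/trivIsetP : tF => /(_ _ _ _ _ ij) ->//; rewrite preimage_set0 setI0.
- by rewrite -setI_bigcupr -preimage_bigcup; exact: mDX.
Qed.

HB.instance Definition _ := isMeasure.Build _ _ _ m m0 m_ge0 m_sigma_additive.

Let m_fin : fin_num_fun m.
Proof. by move=> A mA; rewrite fin_num_measure//; exact: mDX. Qed.

HB.instance Definition _ := @Measure_isFinite.Build _ _ _ m m_fin.

End law_on_event.

Section joint_law.
Context d (Omega : measurableType d) (R : realType) (P : probability Omega R).
Context d1 d2 (T1 : measurableType d1) (T2 : measurableType d2).
Variables (D : set Omega) (X : Omega -> T1) (Y : Omega -> T2).
Variable m2 : probability T2 R.
Hypotheses (mD : measurable D) (mX : measurable_fun [set: Omega] X)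
  (mY : measurable_fun [set: Omega] Y).
Hypothesis XY : forall A B, measurable A -> measurable B ->
  P (D `&` (X @^-1` A `&` Y @^-1` B)) = (P (D `&` X @^-1` A) * m2 B)%E.

Local Notation m1 := (law_on_event P mD mX).

(** If [Y] is independent of [X] and [D], the law of the pair on [D] is a
    product measure, by uniqueness of the latter. *)
Lemma joint_law1 (C : set (T1 * T2)) : measurable C ->
  P (D `&` [set w | C (X w, Y w)]) = (\int[m1]_x m2 (xsection C x))%E.
Proof.
move=> mC; have mXY : measurable_fun [set: Omega] (fun w => (X w, Y w)).
  exact: measurable_fun_pair.
by rewrite -[LHS]/(law_on_event P mD mXY C) -(@product_measure_unique _ _ _ _ _ m1 m2).
Qed.

Lemma joint_law2 (C : set (T1 * T2)) : measurable C ->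
  P (D `&` [set w | C (X w, Y w)]) =
  (\int[m2]_y P (D `&` X @^-1` (ysection C y)))%E.
Proof.
move=> mC; rewrite joint_law1//.
rewrite -[LHS]/((m1 \x m2)%E C) -[RHS]/((m1 \x^ m2)%E C).
by apply: product_measure_unique => // A B mA mB/=; rewrite product_measure2E.
Qed.

End joint_law.

Section future.
Context d (Omega : measurableType d) (R : realType) (P : probability Omega R).
Variable V : nat -> {RV P >-> R}.
Hypothesis iidV : iid_uniform01 V.

Local Notation unif := (uniform_prob (@ltr01 R)).

(** Cylinders over the coordinates from [k] on. Carrying such a factor
    through the induction over [k] replaces independence of sigma-algebras:
    each step moves one coordinate from the future into the past. *)
Definition future_event (k : nat) (F : set Omega) := exists J : {fset nat},
  exists B : nat -> set R, [/\ forall j, j \in J -> (k <= j)%N,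
    forall j, measurable (B j) & F = \bigcap_(j in [set` J]) (V j @^-1` B j)].

Lemma measurable_future_event k F : future_event k F -> measurable F.
Proof.
move=> [J [B [_ mB ->]]]; apply: bigcap_measurableType => j _.
by rewrite -[X in measurable X]setTI; exact: measurable_funP.
Qed.

Lemma future_eventT k : future_event k setT.
Proof.
exists fset0, (fun=> setT); split => //.
by apply/seteqP; split => // w _ j /=; rewrite inE.
Qed.

Lemma future_event_cons k F B : measurable B -> future_event k.+1 F ->
  future_event k (V k @^-1` B `&` F) /\
  P (V k @^-1` B `&` F) = (unif B * P F)%E.
Proof.
move=> mB [J [C [kJ mC ->]]].
pose C' j := if j == k then B else C j.
have mC' j : measurable (C' j) by rewrite /C'; case: ifP.
have kNJ : k \notin J by apply/negP => /kJ; rewrite ltnn.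
have C'E j : j \in J -> C' j = C j.
  by move=> jJ; rewrite /C'; case: eqP => // jk; move: kNJ; rewrite -jk jJ.
have E : V k @^-1` B `&` \bigcap_(j in [set` J]) (V j @^-1` C j) =
    \bigcap_(j in [set` (k |` J)%fset]) (V j @^-1` C' j).
  apply/seteqP; split => w /=.
    move=> [Bw Cw] j /=; rewrite !inE => /orP[/eqP ->|jJ].
      by rewrite /C' eqxx.
    by rewrite C'E//; exact: Cw.
  move=> Cw; split.
    by have := Cw k; rewrite /= !inE eqxx => /(_ isT); rewrite /C' eqxx.
  move=> j jJ; rewrite -C'E//; apply: Cw => /=.
  by rewrite !inE (_ : j \in J) ?orbT.
split.
  exists (k |` J)%fset, C'; split => // j.
  by rewrite !inE => /orP[/eqP ->//|/kJ]; exact: ltnW.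
have [indV unifV] := iidV.
rewrite E !indV// big_fsetU1//=; congr (_ * _)%E.
  by rewrite /C' eqxx; exact: unifV.
by apply: eq_big_seq => j jJ; rewrite C'E.
Qed.

End future.

(** * Elementary integrals *)

Lemma integral_is_derive (R : realType) (f F : R -> R) (a b : R) : a <= b ->
  (forall x, a <= x <= b -> is_derive x 1 F (f x)) ->
  (forall x, a <= x <= b -> {for x, continuous f}) ->
  (\int[@lebesgue_measure R]_(x in `[a, b]) (f x)%:E = (F b - F a)%:E)%E.
Proof.
rewrite le_eqVlt => /orP[/eqP <-|ab] dF cf.
  by rewrite set_itv1 integral_set1 subrr.
have cF x : a <= x <= b -> {for x, continuous F}.
  move=> /dF dFx; apply: differentiable_continuous; apply/derivable1_diffP.
  exact: ex_derive.
rewrite (@continuous_FTC2 _ _ F)//.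
- apply: continuous_in_subspaceT => x; rewrite inE/= in_itv/=; exact: cf.
- split.
  + by move=> x; rewrite in_itv/= => /andP[ax xb]; have := dF x; rewrite !ltW// => /(_ isT) ?; exact: ex_derive.
  + by apply: cvg_at_right_filter; apply: cF; rewrite lexx ltW.
  + by apply: cvg_at_left_filter; apply: cF; rewrite lexx ltW.
- move=> x; rewrite in_itv/= => /andP[ax xb]; have := dF x; rewrite !ltW// => /(_ isT) ?.
  by rewrite derive1E; exact: derive_val.
Qed.

Section uniform_integrals.
Context (R : realType).
Local Notation unif := (uniform_prob (@ltr01 R)).
Local Notation mu := (@lebesgue_measure R).

Lemma eq_integral_uniform (f g : R -> \bar R) :
  measurable_fun [set: R] f -> measurable_fun [set: R] g ->
  (forall x, 0 <= f x)%E -> (forall x, 0 <= g x)%E ->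
  (forall x, 0 <= x <= 1 -> f x = g x) ->
  (\int[unif]_x f x = \int[unif]_x g x)%E.
Proof.
move=> mf mg f0 g0 fg; rewrite !integral_uniform//; congr (_ * _)%E.
by apply: eq_integral => x; rewrite inE/= in_itv/=; exact: fg.
Qed.

Lemma integral_uniform_pow (k : nat) (v : R) : 0 <= v <= 1 ->
  (\int[unif]_(u in `]-oo, v[) (`|u| ^+ k)%:E = (v ^+ k.+1 / k.+1%:R)%:E)%E.
Proof.
move=> /andP[v0 v1].
have mk : measurable_fun [set: R] (fun u : R => (`|u| ^+ k)%:E).
  by apply/measurable_EFinP; apply: measurable_funX.
rewrite integral_mkcond integral_uniform//; last 2 first.
- by apply/measurable_restrict => //; rewrite setTI; apply: measurable_funTS.
- by move=> x; apply: erestrict_ge0 => y _; rewrite lee_fin.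
rewrite subr0 invr1 mul1e -integral_mkcondr.
rewrite (_ : _ `&` _ = `[0, v[%classic); last first.
  apply/seteqP; split => y /=; rewrite !in_itv/=.
    by case=> /andP[-> _] ->.
  by move=> /andP[-> yv]; rewrite yv (le_trans (ltW yv)).
rewrite integral_itv_bndo_bndc; last exact: measurable_funTS.
transitivity (\int[mu]_(u in `[0%R, v]) (u ^+ k)%:E)%E.
  apply: eq_integral; by move=> u; rewrite inE/= in_itv/= => /andP[u0 _]; rewrite ger0_norm.
have dF (x : R) : is_derive x 1 (fun u : R => u ^+ k.+1 / k.+1%:R) (x ^+ k).
  have -> : x ^+ k = k.+1%:R^-1 *: (k.+1%:R * x ^+ k).
    by rewrite /GRing.scale/= mulrA mulVf ?mul1r ?pnatr_eq0.
  rewrite (_ : (fun u => _) = k.+1%:R^-1 \*: (fun u : R => u ^+ k.+1)); last first.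
    by apply/funext => u; rewrite /GRing.scale/= mulrC.
  apply: is_deriveZ; apply: DeriveDef; first exact: exprn_derivable.
  by rewrite exp_derive /GRing.scale/= mulr1.
rewrite (integral_is_derive (F := fun u => u ^+ k.+1 / k.+1%:R))//.
  by rewrite expr0n mul0r subr0.
by move=> x _; exact: exprn_continuous.
Qed.

End uniform_integrals.

(** * Joint law of the number of records and the running maximum *)

Section chain_law.
Context d (Omega : measurableType d) (R : realType) (P : probability Omega R).
Variable V : nat -> {RV P >-> R}.
Hypothesis iidV : iid_uniform01 V.

Local Notation unif := (uniform_prob (@ltr01 R)).
Local Notation "'M' k" := (fun w => running_max (V ^~ w) k) (at level 10).
Local Notation Z k n := [set w | later_records (V ^~ w) k = n].

(** The coefficient [c(k,n)] of [u^k] in the density of the running maximum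
    on the event of [n] later records up to time [k]. *)
Fixpoint chain_coef (k n : nat) : R :=
  if k is k'.+1 then
    chain_coef k' n + (if n is n'.+1 then chain_coef k' n' / k'.+1%:R else 0)
  else (n == 0%N)%:R.

Lemma chain_coef_ge0 k n : 0 <= chain_coef k n.
Proof.
elim: k n => [|k IH] n //=; rewrite addr_ge0//.
by case: n => // n; rewrite divr_ge0.
Qed.

Let w k n (u : R) : R := chain_coef k n * `|u| ^+ k.

Let mw k n : measurable_fun [set: R] (w k n).
Proof. by apply: measurable_funM => //; exact: measurable_funX. Qed.

Let w_ge0 k n u : 0 <= w k n u.
Proof. by rewrite mulr_ge0 ?chain_coef_ge0// exprn_ge0. Qed.

Let mV k : measurable_fun [set: Omega] (V k).
Proof. exact: measurable_funP. Qed.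

Let mM k : measurable_fun [set: Omega] (M k).
Proof. exact: measurable_running_max. Qed.

(** The absolute value keeps the density nonnegative off the unit interval,
    where the uniform law has no mass. *)
Definition chain_law_at k n := forall A F, measurable A -> future_event V k.+1 F ->
  P ((Z k n `&` F) `&` (M k) @^-1` A) =
  ((\int[unif]_(u in A) (chain_coef k n * `|u| ^+ k)%:E) * P F)%E.

Let mZF k j n F : future_event V j F -> measurable (Z k n `&` F).
Proof.
move=> /measurable_future_event mF; apply: measurableI => //.
exact: measurable_later_records.
Qed.

Section step.
Variables (k n : nat) (F : set Omega).
Hypotheses (lkn : chain_law_at k n) (FF : future_event V k.+2 F).

Let D := Z k n `&` F.
Let mD : measurable D. Proof. exact: mZF FF. Qed.

Let F1 : future_event V k.+1 F.
Proof.
by have [J [C [kJ mC ->]]] := FF; exists J, C; split => // j /kJ; exact: ltnW.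
Qed.

Let XY A B : measurable A -> measurable B ->
  P (D `&` ((M k) @^-1` A `&` V k.+1 @^-1` B)) =
  (P (D `&` (M k) @^-1` A) * unif B)%E.
Proof.
move=> mA mB; have [FB PFB] := future_event_cons iidV mB FF.
rewrite (_ : D `&` _ = (Z k n `&` (V k.+1 @^-1` B `&` F)) `&` (M k) @^-1` A).
  by rewrite lkn// PFB /D lkn// -!muleA (muleC (P F)).
by rewrite /D; apply/seteqP; split=> x /=; tauto.
Qed.

Let mF : measurable F. Proof. exact: measurable_future_event FF. Qed.
Let q : R := fine (P F).
Let qE : P F = q%:E. Proof. by rewrite fineK// fin_num_measure. Qed.
Let q0 : 0 <= q. Proof. by rewrite fine_ge0. Qed.

Let integral_indic_pow (A : set R) (c : R) j : measurable A -> 0 <= c ->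
  ((\int[unif]_(v in A) (c * `|v| ^+ j)%:E) * P F =
   \int[unif]_v (\1_A v * (c * `|v| ^+ j * q))%:E)%E.
Proof.
move=> mA c0; rewrite qE -ge0_integralZr//; first last.
- by move=> v _; rewrite lee_fin mulr_ge0// exprn_ge0.
- apply/measurable_EFinP; apply: measurable_funM => //; apply: measurable_funTS.
  exact: measurable_funX.
rewrite integral_mkcond; apply: eq_integral => v _.
by rewrite patchE indicE; case: ifP; rewrite ?mul1r// mul0r.
Qed.

Let measurable_indic_pow (A : set R) (c : R) j : measurable A ->
  measurable_fun [set: R] (fun v => (\1_A v * (c * `|v| ^+ j * q))%:E).
Proof.
move=> mA; apply/measurable_EFinP; apply: measurable_funM => //.
apply: measurable_funM => //; apply: measurable_funM => //.
exact: measurable_funX.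
Qed.

(** Integrating [1] against the density [c u^k] below the new value [v]
    gives [c v^(k+1) / (k+1)]. *)
Lemma chain_step_record A : measurable A ->
  P ((Z k n `&` F) `&` [set w | A (V k.+1 w) /\ M k w < V k.+1 w]) =
  ((\int[unif]_(v in A) (chain_coef k n / k.+1%:R * `|v| ^+ k.+1)%:E) * P F)%E.
Proof.
move=> mA; pose C : set (R * R) := [set x | A x.2 /\ x.1 < x.2].
have mC : measurable C.
  apply: measurableI; last exact: measurable_lt_set.
  by rewrite -[X in measurable X]setTI; exact: measurable_snd.
rewrite -[LHS]/(P (D `&` [set w | C (M k w, V k.+1 w)])).
rewrite (joint_law2 (m2 := unif) mD (@mM k) (@mV k.+1) XY mC).
rewrite integral_indic_pow ?divr_ge0 ?chain_coef_ge0//.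
have mCy := @measurable_fun_ysection _ _ _ _ _ (law_on_event P mD (@mM k)) C mC.
apply: eq_integral_uniform => //.
- exact: measurable_indic_pow.
- by move=> v; rewrite lee_fin mulr_ge0// mulr_ge0// mulr_ge0 ?exprn_ge0// divr_ge0 ?chain_coef_ge0.
move=> v v01; have v0 : 0 <= v by case/andP: v01.
have [Av|nAv] := pselect (A v); last first.
  rewrite indicE memNset// mul0r (_ : _ `&` _ = set0) ?measure0//.
  by apply/seteqP; split=> x //= [_]; rewrite /ysection/= inE => -[].
rewrite indicE mem_set// mul1r.
rewrite (_ : M k @^-1` _ = M k @^-1` `]-oo, v[%classic); last first.
  apply/seteqP; split=> x /=; rewrite /ysection/= in_itv/= inE.
    by case.
  by split.
rewrite lkn//.
under eq_integral do rewrite EFinM.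
rewrite ge0_integralZl//; first last.
- by rewrite lee_fin chain_coef_ge0.
- apply/measurable_EFinP; apply: measurable_funTS; exact: measurable_funX.
rewrite integral_uniform_pow// qE -!EFinM ger0_norm//.
by congr EFin; ring.
Qed.

(** The new value falls below the maximum [u] with probability [u], which
    raises the exponent by one. *)
Lemma chain_step_stay A : measurable A ->
  P ((Z k n `&` F) `&` [set w | A (M k w) /\ V k.+1 w <= M k w]) =
  ((\int[unif]_(u in A) (chain_coef k n * `|u| ^+ k.+1)%:E) * P F)%E.
Proof.
move=> mA; pose C : set (measurableTypeR R * measurableTypeR R) := [set x | A x.1 /\ x.2 <= x.1].
have mC : measurable C.
  apply: measurableI.
    by rewrite -[X in measurable X]setTI; exact: measurable_fst.
  rewrite [X in measurable X](_ : _ = ~` [set x : measurableTypeR R * measurableTypeR R | x.1 < x.2]).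
    by apply: measurableC; exact: measurable_lt_set.
  by apply/seteqP; split=> x /=; [rewrite leNgt => /negP|move/negP; rewrite -leNgt].
rewrite -[LHS]/(P (D `&` [set w | C (M k w, V k.+1 w)])).
rewrite (joint_law1 (m2 := unif) (T1 := measurableTypeR R) mD (@mM k) (@mV k.+1) XY mC).
have mwq : measurable_fun [set: R] (fun u => w k n u * q).
  by apply: measurable_funM.
have dens (f : R -> \bar R) : measurable_fun [set: R] f -> (forall x, 0 <= f x)%E ->
    (\int[@law_on_event _ _ _ P _ (measurableTypeR R) _ _ mD (@mM k)]_x f x = \int[unif]_x (f x * (w k n x * q)%:E))%E.
  move=> mf f0; apply: ge0_integral_density => //.
  - by move=> u; rewrite mulr_ge0.
  - move=> B mB; rewrite [LHS]lkn// qE -ge0_integralZr//.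
    + by apply: measurable_funTS; apply/measurable_EFinP; exact: mw.
    + by move=> u _; rewrite lee_fin; exact: w_ge0.
have mCx : measurable_fun [set: R] (fun x => unif (xsection C x)).
  exact: (@measurable_fun_xsection _ _ (measurableTypeR R) (measurableTypeR R) _ unif C mC).
rewrite (dens _ mCx)//.
rewrite integral_indic_pow ?chain_coef_ge0//.
apply: eq_integral_uniform => //.
- apply: emeasurable_funM; first exact: mCx.
  exact/measurable_EFinP.
- exact: measurable_indic_pow.
- by move=> v; rewrite mule_ge0// lee_fin mulr_ge0.
- by move=> v; rewrite lee_fin mulr_ge0// mulr_ge0// mulr_ge0 ?exprn_ge0// chain_coef_ge0.
move=> v v01; have v0 : 0 <= v by case/andP: v01.
have [Av|nAv] := pselect (A v); last first.
  rewrite indicE memNset// mul0r (_ : xsection _ _ = set0) ?measure0 ?mul0e//.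
  by apply/seteqP; split=> x //=; rewrite /xsection/= inE => -[].
rewrite indicE mem_set// mul1r.
rewrite (_ : xsection _ _ = `]-oo, v]%classic); last first.
  apply/seteqP; split=> x /=; rewrite /xsection/= in_itv/= inE.
    by case.
  by split.
rewrite uniform_itvNyc// -EFinM /w ger0_norm//.
by congr EFin; rewrite exprS; ring.
Qed.

End step.

(** The event of [n+1] later records up to time [k+1] splits according to
    whether [k+1] is a record time; with no later record only one case
    remains. *)
Lemma chain_law k n : chain_law_at k n.
Proof.
elim: k n => [|k IH] n A F mA FF.
  have [->|n0] := eqVneq n 0%N.
    rewrite (_ : _ `&` _ = V 0%N @^-1` A `&` F); last first.
      by apply/seteqP; split=> x /=; tauto.
    rewrite (future_event_cons iidV mA FF).2; congr (_ * _)%E.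
    rewrite (eq_integral (cst 1%E)); first by rewrite integral_cst// mul1e.
    by move=> u _; rewrite /w/= expr0 mulr1.
  rewrite (_ : _ `&` _ = set0); last first.
    by apply/seteqP; split=> x //= [[/esym n0']]; move: n0; rewrite n0' eqxx.
  rewrite measure0 (eq_integral (cst 0%E)) ?integral_cst// ?mul0e//.
  by move=> u _; rewrite /w/= (negbTE n0) mul0r.
have F1 : measurable F by exact: measurable_future_event FF.
have mstay : measurable [set x | V k.+1 x <= M k x].
  rewrite (_ : [set x | _] = ~` [set x | M k x < V k.+1 x]).
    by apply: measurableC; exact: measurable_lt_set.
  by apply/seteqP; split=> x /=; [rewrite leNgt => /negP|move/negP; rewrite -leNgt].
have stay m := chain_step_stay (IH m) FF mA.
have record m := chain_step_record (IH m) FF mA.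
have mpre (X : Omega -> R) : measurable_fun setT X -> measurable (X @^-1` A).
  by move=> mX; rewrite -[Y in measurable Y]setTI; exact: mX.
case: n => [|n].
  rewrite (_ : _ `&` _ = (Z k 0 `&` F) `&` [set x | A (M k x) /\ V k.+1 x <= M k x]).
    by rewrite stay; congr (_ * _)%E; apply: eq_integral => u _; rewrite /w/= addr0.
  apply/seteqP; split=> x /=.
    move=> [[+ Fx]]; case: ltP => [_|VM]; rewrite ?addn1// addn0 => -> AM.
    by split => //; split => //; rewrite max_l in AM.
  by move=> [[Zx Fx] [AM VM]]; rewrite max_l// Zx ltNge VM.
rewrite (_ : _ `&` _ = ((Z k n.+1 `&` F) `&` [set x | A (M k x) /\ V k.+1 x <= M k x]) `|`
   ((Z k n `&` F) `&` [set x | A (V k.+1 x) /\ M k x < V k.+1 x])); last first.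
  apply/seteqP; split=> x /=.
    move=> [[+ Fx]]; case: (ltP (running_max _ _)) => VM.
      by rewrite addn1 => -[Zn] AM; right.
    by rewrite addn0 => -> AM; left.
  by case=> -[[-> Fx] [AM]]; [case: (ltP (running_max _ _))|case: (ltP (running_max _ _))] => // *; rewrite ?addn0 ?addn1.
rewrite measureU//; first last.
- apply/seteqP; split=> x //= [[_ [_ VM]] [_ [_]]]; rewrite ltNge VM //.
- apply: measurableI; first exact: mZF FF.
  by apply: measurableI; [exact: mpre|exact: measurable_lt_set].
- apply: measurableI; first exact: mZF FF.
  by apply: measurableI => //; exact: mpre.
transitivity ((\int[unif]_(u in A) (chain_coef k n.+1 * `|u| ^+ k.+1)%:E) * P F +
    (\int[unif]_(u in A) (chain_coef k n / k.+1%:R * `|u| ^+ k.+1)%:E) * P F)%E.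
  by congr (_ + _)%E; [exact: stay|exact: record].
rewrite -ge0_muleDl ?integral_ge0//; last 2 first.
- by move=> u _; rewrite lee_fin mulr_ge0 ?chain_coef_ge0// exprn_ge0.
- by move=> u _; rewrite lee_fin mulr_ge0 ?divr_ge0 ?chain_coef_ge0// exprn_ge0.
congr (_ * _)%E; rewrite -ge0_integralD//.
- by apply: eq_integral => u _; rewrite -EFinD /w/= mulrDl.
- by move=> u _; rewrite lee_fin mulr_ge0 ?chain_coef_ge0// exprn_ge0.
- by apply/measurable_EFinP; apply: measurable_funM => //; apply: measurable_funTS; exact: measurable_funX.
- by move=> u _; rewrite lee_fin mulr_ge0 ?divr_ge0 ?chain_coef_ge0// exprn_ge0.
- by apply/measurable_EFinP; apply: measurable_funM => //; apply: measurable_funTS; exact: measurable_funX.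
Qed.

End chain_law.

(** * Erlang densities *)

Section erlang.
Context (R : realType).
Local Notation mu := (@lebesgue_measure R).

Definition erlang (n : nat) (y : R) : R := y ^+ n / n`!%:R * expR (- y).

(** The mass of [erlang n] beyond [x], written as the probability that a
    Poisson variable with parameter [x] is at most [n]. *)
Definition erlang_tail (n : nat) (x : R) : R := \sum_(k < n.+1) erlang k x.

Lemma erlang_0E y : erlang 0 y = expR (- y).
Proof. by rewrite /erlang expr0 fact0 divr1 mul1r. Qed.

Lemma erlang_1E y : erlang 1 y = y * expR (- y).
Proof. by rewrite /erlang expr1 factS fact0 divr1. Qed.

Lemma erlang_ge0 n y : 0 <= y -> 0 <= erlang n y.
Proof. by move=> y0; rewrite mulr_ge0 ?expR_ge0// divr_ge0// exprn_ge0. Qed.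

Lemma erlang_tail_ge0 n y : 0 <= y -> 0 <= erlang_tail n y.
Proof. by move=> y0; apply: sumr_ge0 => k _; exact: erlang_ge0. Qed.

Lemma erlang_tailS n x : erlang_tail n.+1 x = erlang_tail n x + erlang n.+1 x.
Proof. by rewrite /erlang_tail big_ord_recr. Qed.

Lemma erlang_tail0 n : erlang_tail n 0 = 1.
Proof.
elim: n => [|n IH]; last first.
  by rewrite erlang_tailS IH /erlang expr0n/= !mul0r addr0.
by rewrite /erlang_tail big_ord1 /erlang expr0 oppr0 expR0 fact0 invr1 !mulr1.
Qed.

Lemma is_derive_exprn n (x : R) : is_derive x 1 (fun u : R => u ^+ n) (n%:R * x ^+ n.-1).
Proof.
by apply: DeriveDef; [exact: exprn_derivable|rewrite exp_derive /GRing.scale/= mulr1].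
Qed.

Lemma is_derive_erlang n (x : R) :
  is_derive x 1 (erlang n) ((if n is n'.+1 then erlang n' x else 0) - erlang n x).
Proof.
have dpow : is_derive x 1 (fun u : R => u ^+ n / n`!%:R) (n%:R * x ^+ n.-1 / n`!%:R).
  rewrite (_ : (fun u => _) = n`!%:R^-1 \*: (fun u : R => u ^+ n)); last first.
    by apply/funext => u; rewrite /GRing.scale/= mulrC.
  rewrite [X in is_derive _ _ _ X]mulrC; apply: is_deriveZ; exact: is_derive_exprn.
have dexp : is_derive x 1 (fun u : R => expR (- u)) (- expR (- x)).
  rewrite -[X in is_derive _ _ _ X]mulN1r [X in is_derive _ _ _ X]mulrC.
  apply: (@is_derive1_comp _ expR -%R).
rewrite (_ : erlang n = (fun u : R => u ^+ n / n`!%:R) * (fun u : R => expR (- u))); last first.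
  exact/funext.
apply: is_derive_eq; rewrite /erlang /GRing.scale/= mulrN addrC; congr (_ - _).
case: n {dpow} => [|n]; first by rewrite !mul0r mulr0.
rewrite factS natrM/=; field.
by rewrite -[1 + _](natrD R 1 n) !pnatr_eq0 -lt0n fact_gt0.
Qed.

Lemma is_derive_erlang_tail n (x : R) :
  is_derive x 1 (erlang_tail n) (- erlang n x).
Proof.
elim: n => [|n IH].
  rewrite (_ : erlang_tail 0 = erlang 0); last first.
    by apply/funext => y; rewrite /erlang_tail big_ord1.
  by rewrite -[- _]add0r; exact: (is_derive_erlang 0).
rewrite (_ : erlang_tail n.+1 = erlang_tail n + erlang n.+1); last first.
  by apply/funext => y; rewrite erlang_tailS.
have H := is_derive_erlang n.+1 x.
by apply: is_derive_eq; rewrite addrA addrC; ring.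
Qed.

Lemma continuous_erlang n : continuous (erlang n).
Proof.
move=> x; apply: differentiable_continuous; apply/derivable1_diffP.
have H := is_derive_erlang n x; exact: ex_derive.
Qed.

Lemma continuous_erlang_tail n : continuous (erlang_tail n).
Proof.
move=> x; apply: differentiable_continuous; apply/derivable1_diffP.
have H := is_derive_erlang_tail n x; exact: ex_derive.
Qed.

Lemma measurable_erlang n : measurable_fun [set: R] (erlang n).
Proof. by apply: continuous_measurable_fun; exact: continuous_erlang. Qed.

Lemma measurable_erlang_tail n : measurable_fun [set: R] (erlang_tail n).
Proof. by apply: continuous_measurable_fun; exact: continuous_erlang_tail. Qed.

(** The exponential dominates the next term [y^(n+1) / (n+1)!] of its
    series. *)
Lemma cvg_erlang n : erlang n x @[x --> +oo] --> 0.
Proof.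
apply/cvgrPdist_le => e e0; near=> y.
have y0 : 0 < y by near: y; exact: nbhs_pinfty_gt.
rewrite sub0r normrN ger0_norm ?erlang_ge0 ?(ltW y0)//.
have ey := expR_ge1Dxn n (ltW y0).
have H : y ^+ n.+1 / n.+1`!%:R <= expR y by apply: le_trans ey; rewrite lerDr.
have ny : n.+1%:R / y <= e.
  by rewrite ler_pdivrMr// -ler_pdivrMl//; near: y; apply: nbhs_pinfty_ge.
apply: le_trans ny.
rewrite /erlang expRN ler_pdivrMr ?expR_gt0// mulrAC ler_pdivlMr//.
rewrite -ler_pdivrMl//; apply: le_trans H.
rewrite exprSr factS natrM invfM.
by rewrite le_eqVlt; apply/orP; left; apply/eqP; ring.
Unshelve. all: by end_near. Qed.

Lemma cvg_erlang_tail n : erlang_tail n x @[x --> +oo] --> 0.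
Proof.
elim: n => [|n IH].
  rewrite (_ : erlang_tail 0 = erlang 0); first exact: cvg_erlang.
  by apply/funext => y; rewrite /erlang_tail big_ord1.
rewrite (_ : erlang_tail n.+1 = erlang_tail n + erlang n.+1); last first.
  by apply/funext => y; rewrite erlang_tailS.
by rewrite -[X in _ --> X]addr0; apply: cvgD => //; exact: cvg_erlang.
Qed.

Lemma integral_erlang_itvcy n x : 0 <= x ->
  (\int[mu]_(y in `[x, +oo[) (erlang n y)%:E = (erlang_tail n x)%:E)%E.
Proof.
move=> x0; rewrite (@ge0_continuous_FTC2y _ _ (- erlang_tail n) _ 0).
- by rewrite sub0e -EFinN opprK.
- by move=> y xy; rewrite erlang_ge0// (le_trans x0).
- by apply: continuous_subspaceT; exact: continuous_erlang.
- by rewrite -oppr0; apply: cvgN; exact: cvg_erlang_tail.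
- move=> y _; have H := is_derive_erlang_tail n y; exact: ex_derive.
- by apply: cvg_at_right_filter; apply: cvgN; exact: continuous_erlang_tail.
- move=> y _; rewrite derive1E; have H := is_derive_erlang_tail n y.
  by rewrite derive_val opprK.
Qed.

Lemma integral_erlang_itvoc n x : 0 <= x ->
  (\int[mu]_(y in `]0%R, x]) (erlang n y)%:E = (1 - erlang_tail n x)%:E)%E.
Proof.
move=> x0; rewrite integral_itv_obnd_cbnd; last first.
  by apply: measurable_funTS; apply/measurable_EFinP; exact: measurable_erlang.
have dF y : 0 <= y <= x -> is_derive y 1 (- erlang_tail n) (erlang n y).
  move=> _; have H := is_derive_erlang_tail n y.
  by apply: is_derive_eq; rewrite opprK.
rewrite (integral_is_derive x0 dF); last by move=> y _; exact: continuous_erlang.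
by congr EFin; rewrite /= !fctE erlang_tail0; ring.
Qed.

Lemma integral_erlang n :
  (\int[mu]_(y in `]0%R, +oo[) (erlang n y)%:E = 1)%E.
Proof.
rewrite integral_itv_obnd_cbnd; last first.
  by apply: measurable_funTS; apply/measurable_EFinP; exact: measurable_erlang.
by rewrite integral_erlang_itvcy// erlang_tail0.
Qed.

Lemma integrable_erlang n : mu.-integrable (`]0, +oo[%classic : set R) (EFin \o erlang n).
Proof.
apply/integrableP; split.
  by apply/measurable_EFinP; apply: measurable_funTS; exact: measurable_erlang.
rewrite (_ : (\int[_]_(_ in _) _)%E = \int[mu]_(y in `]0%R, +oo[) (erlang n y)%:E)%E.
  by rewrite integral_erlang ltry.
apply: eq_integral => y; rewrite inE/= in_itv/= andbT => y0.
by rewrite ger0_norm// erlang_ge0// ltW.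
Qed.

Lemma erlang_tail_le1 n x : 0 <= x -> erlang_tail n x <= 1.
Proof.
move=> x0; rewrite -subr_ge0 -lee_fin -integral_erlang_itvoc//.
apply: integral_ge0 => y; rewrite /= in_itv/= => /andP[y0 _].
by rewrite lee_fin erlang_ge0// ltW.
Qed.

End erlang.

(** * Summation over the record times *)

Lemma nneseries_EFinP (R : realType) (a : nat -> R) (l : R) :
  (forall k, 0 <= a k) ->
  (\sum_(k <oo) (a k)%:E = l%:E)%E <-> (series a @ \oo --> l).
Proof.
move=> a0.
have aE : (fun n => \sum_(0 <= k < n) (a k)%:E)%E = EFin \o series a.
  by apply/funext => n; rewrite /= /series/= sumEFin.
split=> [al|al].
  have : (\sum_(0 <= k < n) (a k)%:E)%E @[n --> \oo] --> l%:E.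
    rewrite -al; apply: is_cvg_nneseries => n _ _; rewrite lee_fin; exact: a0.
  by rewrite aE => /fine_cvgP[].
apply/cvg_lim => //; rewrite aE.
by apply/fine_cvgP; split => //; near=> n.
Unshelve. all: by end_near. Qed.

(** Summing the recurrence gives [A = B + u A] for the sums [A] and [B],
    once the partial sums of [a] are known to be bounded. *)
Lemma renewal_series (R : realType) (a b : nat -> R) (u l : R) :
  0 <= u < 1 -> (forall k, 0 <= a k) -> (forall k, 0 <= b k) ->
  a 0%N = b 0%N -> (forall k, a k.+1 = u * a k + b k.+1) ->
  series b @ \oo --> l -> series a @ \oo --> l / (1 - u).
Proof.
move=> /andP[u0 u1] a0 b0 ab0 abS bl.
have u1' : 0 < 1 - u by rewrite subr_gt0.
have sS (f : nat -> R) n : series f n.+1 = series f n + f n.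
  by rewrite /series/= big_nat_recr.
have s0 (f : nat -> R) : series f 0%N = 0 by rewrite /series/= big_geq.
have aS n : series a n.+1 = series b n.+1 + u * series a n.
  elim: n => [|n IH]; first by rewrite !sS !s0 ab0 mulr0 addr0.
  by rewrite [LHS]sS abS {1}IH [series b n.+2]sS [series a n.+1]sS; ring.
have nd (f : nat -> R) : (forall k, 0 <= f k) -> nondecreasing_seq (series f).
  by move=> f0; apply/nondecreasing_seqP => n; rewrite sS lerDl.
have b_le n : series b n <= l.
  rewrite -(cvg_lim _ bl)//; apply: nondecreasing_cvgn_le; first exact: nd.
  by apply/cvg_ex; exists l.
have l0 : 0 <= l by rewrite -(s0 b).
have a_le n : series a n <= l / (1 - u).
  elim: n => [|n IH]; first by rewrite s0 divr_ge0// ltW.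
  rewrite aS; apply: (@le_trans _ _ (l + u * (l / (1 - u)))).
    by rewrite lerD// ler_wpM2l.
  by rewrite le_eqVlt; apply/orP; left; apply/eqP; field; rewrite gt_eqF.
have : cvgn (series a).
  apply: nondecreasing_is_cvgn; first exact: nd.
  by exists (l / (1 - u)) => _ [n _ <-]; exact: a_le.
move=> /cvg_ex[/= m am].
suff mE : m = l + u * m.
  rewrite (_ : l = m * (1 - u)) ?mulfK ?gt_eqF//.
  by rewrite mulrBr mulr1 {1}mE [m * u]mulrC addrK.
have am1 : series a n.+1 @[n --> \oo] --> m by move: am; rewrite -cvg_shiftS.
have am2 : series b n.+1 + u * series a n @[n --> \oo] --> l + u * m.
  apply: cvgD; first by move: bl; rewrite -cvg_shiftS.
  by apply: cvgM => //; exact: cvg_cst.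
transitivity (limn (fun n => series a n.+1)); first exact/esym/cvg_lim.
rewrite (_ : (fun n => _) = (fun n => series b n.+1 + u * series a n)).
  exact: cvg_lim.
by apply/funext => n; exact: aS.
Qed.

Section record_series.
Context (R : realType).
Local Notation mu := (@lebesgue_measure R).

Let a n (u : R) k := chain_coef R k n * u ^+ k.
Let b n (v : R) k := chain_coef R k n / k.+1%:R * v ^+ k.+1.

Let a_ge0 n u k : 0 <= u -> 0 <= a n u k.
Proof. by move=> u0; rewrite mulr_ge0 ?exprn_ge0 ?chain_coef_ge0. Qed.

Let b_ge0 n u k : 0 <= u -> 0 <= b n u k.
Proof. by move=> u0; rewrite mulr_ge0 ?exprn_ge0 ?divr_ge0 ?chain_coef_ge0. Qed.

Lemma is_derive_L (u : R) : u < 1 -> is_derive u 1 (@L R) (1 - u)^-1.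
Proof.
move=> u1; have u1' : 0 < 1 - u by rewrite subr_gt0.
have dln : is_derive (1 - u) 1 (@ln R) (1 - u)^-1 by exact: is_derive1_ln.
have d1 : is_derive u 1 (fun u : R => 1 - u) (-1).
  rewrite (_ : (fun u : R => _) = cst 1 - id); last exact/funext.
  by apply: is_derive_eq; rewrite sub0r.
have := is_derive1_comp (f := @ln R) (g := fun u : R => 1 - u) (x := u) dln d1.
move=> H; rewrite (_ : @L R = - (@ln R \o (fun u : R => 1 - u))); last exact/funext.
by apply: is_derive_eq; rewrite mulrN mulr1 opprK.
Qed.

Let is_derive_LX n (u : R) : u < 1 ->
  is_derive u 1 (fun u => L u ^+ n.+1 / n.+1`!%:R) (L u ^+ n / n`!%:R / (1 - u)).
Proof.
move=> u1; have dL := is_derive_L u1.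
have dX : is_derive (L u) 1 (fun y : R => y ^+ n.+1) (n.+1%:R * L u ^+ n).
  exact: is_derive_exprn.
have := is_derive1_comp (x := u) dX dL => H.
rewrite (_ : (fun u => _) = n.+1`!%:R^-1 \*: ((fun y : R => y ^+ n.+1) \o @L R)); last first.
  by apply/funext => x; rewrite /GRing.scale/= mulrC.
apply: is_derive_eq; rewrite /GRing.scale/= factS natrM.
field.
by rewrite gt_eqF ?subr_gt0//= -[1 + _](natrD R 1 n) !pnatr_eq0 -lt0n fact_gt0.
Qed.

Let series_b n :
  (forall u, 0 <= u < 1 -> series (a n u) @ \oo --> L u ^+ n / n`!%:R / (1 - u)) ->
  forall v, 0 <= v < 1 -> series (b n v) @ \oo --> L v ^+ n.+1 / n.+1`!%:R.
Proof.
move=> ha v /andP[v0 v1]; apply/nneseries_EFinP; first by move=> k; exact: b_ge0.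
have -> : (\sum_(k <oo) (b n v k)%:E = \int[mu]_(u in `[0%R, v]) \sum_(k <oo) (a n u k)%:E)%E.
  rewrite integral_nneseries//; last 2 first.
  - move=> k; apply: measurable_funTS; apply/measurable_EFinP.
    by apply: measurable_funM => //; exact: measurable_funX.
  - by move=> k u; rewrite /= in_itv/= => /andP[u0 _]; rewrite lee_fin a_ge0.
  apply: eq_eseriesr => k _.
  have dF u : 0 <= u <= v ->
      is_derive u 1 (fun v => chain_coef R k n / k.+1%:R * v ^+ k.+1) (a n u k).
    move=> _; have H := is_derive_exprn k.+1 u.
    rewrite (_ : (fun v : R => _) = (chain_coef R k n / k.+1%:R) \*: (fun u : R => u ^+ k.+1)); last first.
      exact/funext.
    by apply: is_derive_eq; rewrite /GRing.scale/= /a; field; rewrite -[1 + _](natrD R 1 k) pnatr_eq0.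
  rewrite (integral_is_derive v0 dF).
    by rewrite expr0n mulr0 subr0.
  move=> u _; apply: cvgM; [exact: cvg_cst|exact: exprn_continuous].
transitivity (\int[mu]_(u in `[0%R, v]) (L u ^+ n / n`!%:R / (1 - u))%:E)%E.
  apply: eq_integral => u; rewrite inE/= in_itv/= => /andP[u0 uv].
  apply/nneseries_EFinP; first by move=> k; exact: a_ge0.
  by apply: ha; rewrite u0 (le_lt_trans uv).
have dF u : 0 <= u <= v -> is_derive u 1 (fun u => L u ^+ n.+1 / n.+1`!%:R) (L u ^+ n / n`!%:R / (1 - u)).
  by move=> /andP[u0 uv]; apply: is_derive_LX; rewrite (le_lt_trans uv).
rewrite (integral_is_derive v0 dF).
  by rewrite /L subr0 ln1 oppr0 expr0n/= mul0r subr0.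
move=> u /andP[u0 uv]; have u1 : u < 1 by rewrite (le_lt_trans uv).
have cL : {for u, continuous (@L R)}.
  apply: differentiable_continuous; apply/derivable1_diffP.
  have H := is_derive_L u1; exact: ex_derive.
apply: cvgM.
  apply: cvgM; last exact: cvg_cst.
  by apply: (@continuous_comp _ _ _ (@L R) (fun y => y ^+ n)) => //; exact: exprn_continuous.
apply: cvgV; first by rewrite gt_eqF ?subr_gt0.
by apply: cvgB; [exact: cvg_cst|exact: cvg_id].
Qed.

Let series_a n u : 0 <= u < 1 ->
  series (a n u) @ \oo --> L u ^+ n / n`!%:R / (1 - u).
Proof.
elim: n u => [|n IH] u u01; have u0 : 0 <= u by case/andP: u01.
  pose b' k : R := (k == 0%N)%:R.
  apply: (@renewal_series _ _ b') => //.
  - by move=> k; exact: a_ge0.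
  - by rewrite /a /b'/= mulr1.
  - by move=> k; rewrite /a /b'/= !addr0 exprS mulrCA.
  - rewrite expr0 fact0 divr1.
    apply: (@cvg_near_cst) => //; exists 1%N => // -[//|m] _ /=.
    rewrite /series/= big_nat_recl// big1 ?addr0//.
pose b' k : R := if k is k'.+1 then b n u k' else 0.
apply: (@renewal_series _ _ b') => //.
- by move=> k; exact: a_ge0.
- by case=> // k; exact: b_ge0.
- by rewrite /a /b'/= mul0r.
- by move=> k; rewrite /a /b /b'/= mulrDl; congr (_ + _); rewrite exprS mulrCA.
rewrite -cvg_shiftS.
rewrite (_ : [sequence _]_k = series (b n u)).
  exact: series_b.
apply/funext => k; rewrite /series/= big_nat_recl//= add0r.
exact: eq_bigr.
Qed.

(** Induction on [n], alternating between two generating series. If the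
    densities [c(k,n) u^k] sum to [L(u)^n / (n! (1-u))], integration gives
    the present claim, since [L] has derivative [1 / (1-u)]; the recurrence
    for [c] then gives the former series for [n+1] by [renewal_series]. *)
Lemma record_series n v : 0 <= v < 1 ->
  (\sum_(k <oo) (chain_coef R k n / k.+1%:R * v ^+ k.+1)%:E =
   (L v ^+ n.+1 / n.+1`!%:R)%:E)%E.
Proof.
move=> v01; have v0 : 0 <= v by case/andP: v01.
apply/(nneseries_EFinP (a := b n v)); first by move=> k; exact: b_ge0.
by apply: series_b => // u u01; exact: series_a.
Qed.

End record_series.

(** * Law of the record values *)

Lemma ge0_integral_uniform01 (R : realType) (A : set R) (f : R -> \bar R) :
  measurable A -> measurable_fun [set: R] f -> (forall x, 0 <= f x)%E ->
  (\int[uniform_prob (@ltr01 R)]_(v in A) f v =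
   \int[@lebesgue_measure R]_(v in A `&` `]0%R, 1%R[) f v)%E.
Proof.
move=> mA mf f0.
have mfA : measurable_fun [set: R] (f \_ A).
  by apply/measurable_restrict => //; rewrite setTI; exact: measurable_funTS.
rewrite integral_mkcond integral_uniform//; last first.
  by move=> x; apply: erestrict_ge0 => y _; exact: f0.
rewrite subr0 invr1 mul1e -integral_itv_obnd_cbnd; last first.
  exact: measurable_funTS.
rewrite -integral_itv_bndo_bndc; last exact: measurable_funTS.
by rewrite -integral_mkcondr setIC.
Qed.

Section record_law.
Context d (Omega : measurableType d) (R : realType) (P : probability Omega R).
Variable V : nat -> {RV P >-> R}.
Hypothesis iidV : iid_uniform01 V.
Local Notation mu := (@lebesgue_measure R).
Local Notation unif := (uniform_prob (@ltr01 R)).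

(** A formula on all sets rather than a measure, as only its total mass and
    its additivity on a set and its complement matter. *)
Definition record_law (n : nat) (A : set R) : \bar R :=
  (\int[mu]_(u in A `&` `]0%R, 1%R[) (L u ^+ n / n`!%:R)%:E)%E.

Let mV k : measurable_fun [set: Omega] (V k).
Proof. exact: measurable_funP. Qed.

Lemma measurable_L : measurable_fun [set: R] (@L R).
Proof.
apply: measurableT_comp => //; apply: (measurableT_comp (@measurable_ln R)).
exact: measurable_funB.
Qed.

Let mLX n : measurable_fun [set: R] (fun u : R => (L u ^+ n / n`!%:R)%:E).
Proof.
apply/measurable_EFinP; apply: measurable_funM => //.
by apply: measurable_funX; exact: measurable_L.
Qed.

Let LX_ge0 n (u : R) : 0 < u < 1 -> (0 <= (L u ^+ n / n`!%:R)%:E)%E.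
Proof. by move=> /L_gt0 Lu; rewrite lee_fin divr_ge0// exprn_ge0// ltW. Qed.

Lemma record_lawT n : record_law n setT = 1%E.
Proof.
rewrite /record_law setTI.
transitivity (\int[mu]_(u in `]0%R, 1%R[) (`|L u| ^+ n / n`!%:R)%:E)%E.
  by apply: eq_integral => u; rewrite inE/= in_itv/= => /L_gt0 Lu; rewrite gtr0_norm.
have mf : measurable_fun (`]0, 1[%classic : set R) (fun u => (`|L u| ^+ n / n`!%:R)%:E).
  apply: measurable_funTS; apply/measurable_EFinP; apply: measurable_funM => //.
  apply: measurable_funX; apply: measurableT_comp => //; exact: measurable_L.
have f0 (u : R) : (0 <= (`|L u| ^+ n / n`!%:R)%:E)%E by rewrite lee_fin divr_ge0.
rewrite (integral_uniform_exponential mf f0).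
rewrite -(integral_erlang R n); apply: eq_integral => y.
rewrite inE/= in_itv/= andbT => y0.
by rewrite LinvK gtr0_norm// -EFinM.
Qed.

Let record_event (A : set R) n k : set Omega :=
  ([set w | later_records (V ^~ w) k = n] `&` setT) `&`
  [set w | A (V k.+1 w) /\ running_max (V ^~ w) k < V k.+1 w].

Let record_eventP A n k : measurable A -> P (record_event A n k) =
  (\int[unif]_(v in A) (chain_coef R k n / k.+1%:R * `|v| ^+ k.+1)%:E)%E.
Proof.
move=> mA; have lkn := @chain_law _ _ _ _ _ iidV k n.
rewrite [LHS](chain_step_record iidV lkn (future_eventT V k.+2) mA).
by rewrite probability_setT mule1.
Qed.

Let measurable_record_event A n k : measurable A -> measurable (record_event A n k).
Proof.
move=> mA; apply: measurableI.
  by rewrite setIT; exact: measurable_later_records.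
apply: measurableI; last by apply: measurable_lt_set => //; exact: measurable_running_max.
by rewrite -[X in measurable X]setTI; exact: mV.
Qed.

Let record_law_le n A : measurable A ->
  (record_law n.+1 A <= P (record_value V n.+1 @^-1` A))%E.
Proof.
move=> mA; have mE k := measurable_record_event n k mA.
have tE : trivIset setT (record_event A n).
  apply/trivIsetP => i j _ _ ij; apply/seteqP; split=> w //= -[[[Zi _] [_ Vi]] [[Zj _] [_ Vj]]].
  have := record_time_new Vi; have := record_time_new Vj; rewrite Zi Zj => -> [ji].
  by move: ij; rewrite ji eqxx.
have -> : record_law n.+1 A = P (\bigcup_k record_event A n k).
  rewrite measure_semi_bigcup//; last exact: bigcup_measurable.
  transitivity (\sum_(k <oo) \int[unif]_(v in A)
      (chain_coef R k n / k.+1%:R * `|v| ^+ k.+1)%:E)%E; last first.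
    by apply: eq_eseriesr => k _; apply/esym; exact: record_eventP.
  rewrite -integral_nneseries//; last 2 first.
  - move=> k; apply: measurable_funTS; apply/measurable_EFinP; apply: measurable_funM => //.
    exact: measurable_funX.
  - by move=> k v _; rewrite lee_fin mulr_ge0 ?exprn_ge0 ?divr_ge0 ?chain_coef_ge0.
  rewrite ge0_integral_uniform01//.
  - apply: eq_integral => v; rewrite inE/= in_itv/= => -[_ /andP[v0 v1]].
    by rewrite ger0_norm ?ltW// record_series// v1 ltW.
  - apply: ge0_emeasurable_sum => //.
    + by move=> k v _ _; rewrite lee_fin mulr_ge0 ?exprn_ge0 ?divr_ge0 ?chain_coef_ge0.
    + move=> k _; apply/measurable_EFinP; apply: measurable_funM => //.
      exact: measurable_funX.
  - move=> v; apply: nneseries_ge0 => k _ _.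
    by rewrite lee_fin mulr_ge0 ?exprn_ge0 ?divr_ge0 ?chain_coef_ge0.
apply: le_measure; rewrite ?inE//; first exact: bigcup_measurable.
  by rewrite -[X in measurable X]setTI; apply: measurable_record_value.
move=> w [k _ [[Zk _] [AV VM]]] /=.
by rewrite /record_value -Zk (record_time_new VM).
Qed.

(** The records at known times only give a lower bound on the probability of
    each event. As the candidate law has total mass 1, the bounds for an
    event and its complement force equality; in particular the almost sure
    finiteness of the record times comes for free. *)
Lemma record_value_law n A : measurable A ->
  P (record_value V n @^-1` A) = record_law n A.
Proof.
move=> mA; case: n => [|n].
  have [_ unifV] := iidV.
  rewrite [LHS](unifV 0%N A mA) /record_law.
  rewrite -[LHS]mul1e -integral_cst// ge0_integral_uniform01//.
  by apply: eq_integral => u _; rewrite expr0 fact0 divr1.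
have mVn : measurable_fun [set: Omega] (record_value V n.+1).
  exact: measurable_record_value.
have mVA (B : set R) : measurable B -> measurable (record_value V n.+1 @^-1` B).
  by move=> mB; rewrite -[X in measurable X]setTI; exact: mVn.
have PC : (P (record_value V n.+1 @^-1` A) + P (record_value V n.+1 @^-1` (~` A)) = 1)%E.
  rewrite preimage_setC probability_setC//; last exact: mVA.
  by rewrite addeC subeK// fin_num_measure//; exact: mVA.
have mI01 (B : set R) : measurable B -> measurable (B `&` `]0, 1[).
  by move=> mB; apply: measurableI.
have LC : (record_law n.+1 A + record_law n.+1 (~` A) = 1)%E.
  rewrite -(record_lawT n.+1) /record_law setTI -ge0_integral_setU//.
  - by rewrite -setIUl setUv setTI.
  - exact: mI01.
  - by apply: mI01; exact: measurableC.
  - apply: measurable_funTS; exact: mLX.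
  - by move=> u [] [_ /=]; rewrite in_itv/=; exact: LX_ge0.
  - by apply/disj_setPS => u [[Au _] []].
have leA := record_law_le n mA; have leC := record_law_le n (measurableC mA).
apply/eqP; rewrite eq_le leA andbT.
have finP : P (record_value V n.+1 @^-1` (~` A)) \is a fin_num.
  by rewrite fin_num_measure//; apply: mVA; exact: measurableC.
rewrite -(@leeD2rE _ (P (record_value V n.+1 @^-1` (~` A))))// PC -LC.
by rewrite leeD2l.
Qed.

End record_law.

(** * Distribution functions and their inverses *)

Section inverse_distribution.
Context (R : realType) (X : law R).
Local Notation F := (distr_fun X).
Local Notation G := (inv_distr_fun X).

Let idX : measurableTypeR R -> R := idfun.

HB.instance Definition _ :=
  @isMeasurableFun.Build _ _ _ _ idX (@measurable_id _ _ setT).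

Let FE x : F x = fine (cdf (idX : {RV X >-> R}) x).
Proof. by rewrite /cdf /distribution /pushforward preimage_id. Qed.

Lemma distr_funE x : X `]-oo, x]%classic = (F x)%:E.
Proof. by rewrite fineK// fin_num_measure. Qed.

Lemma distr_fun_leftE x : X `]-oo, x[%classic = (distr_fun_left X x)%:E.
Proof. by rewrite fineK// fin_num_measure. Qed.

Lemma distr_fun_ge0 x : 0 <= F x.
Proof. by rewrite fine_ge0. Qed.

Lemma distr_fun_le1 x : F x <= 1.
Proof. by rewrite -lee_fin -distr_funE probability_le1. Qed.

Lemma distr_fun_nd x y : x <= y -> F x <= F y.
Proof.
move=> xy; rewrite -lee_fin -!distr_funE; apply: le_measure; rewrite ?inE//.
exact: subset_itvl.
Qed.

Lemma measurable_distr_fun : measurable_fun [set: R] F.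
Proof. by apply: nondecreasing_measurable => // x y; exact: distr_fun_nd. Qed.

Let cvg_y : F @ +oo%R --> (1 : R).
Proof.
rewrite (_ : F = fun x => fine (cdf (idX : {RV X >-> R}) x)); last exact/funext.
by apply: fine_cvg; exact: cvg_cdfy1.
Qed.

Let cvg_Ny : F @ -oo%R --> (0 : R).
Proof.
rewrite (_ : F = fun x => fine (cdf (idX : {RV X >-> R}) x)); last exact/funext.
by apply: fine_cvg; exact: cvg_cdfNy0.
Qed.

Let cvg_right (a : R) : F @ a^'+ --> F a.
Proof.
rewrite (_ : F = fun x => fine (cdf (idX : {RV X >-> R}) x)); last exact/funext.
apply: fine_cvg; rewrite fineK ?fin_num_measure//; exact: cdf_right_continuous.
Qed.

(** The Galois connection between [F] and its inverse, from right continuity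
    of [F]. *)
Lemma inv_distr_fun_le u x : 0 < u < 1 -> (G u <= x) = (u <= F x).
Proof.
move=> /andP[u0 u1]; set A := [set x | u <= F x].
have A0 : A !=set0.
  have : \forall x \near +oo%R, u < F x by move: cvg_y => /cvgr_gt; apply.
  by move=> [M [_ /(_ (M + 1))]]; rewrite ltrDl ltr01 => /(_ isT)/ltW ?; exists (M + 1).
have Alb : has_lbound A.
  have : \forall x \near -oo%R, F x < u by move: cvg_Ny => /cvgr_lt; apply.
  move=> [M [_ /(_ (M - 1))]]; rewrite gtrBl ltr01 => /(_ isT) FM.
  exists (M - 1) => y /= uy; rewrite leNgt; apply/negP => yM.
  by move: (le_lt_trans uy (le_lt_trans (distr_fun_nd (ltW yM)) FM)); rewrite ltxx.
have infA : has_inf A by [].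
apply/idP/idP => [Gx|ux]; last exact: ge_inf.
rewrite leNgt; apply/negP => Fxu.
have : \forall y \near x^'+, F y < u by move: (cvg_right (a := x)) => /cvgr_lt; apply.
move=> [e /= e0 He].
have [y Ay yGe] := inf_adherent e0 infA.
have xy : x < y.
  rewrite ltNge; apply/negP => yx; move: (le_lt_trans Ay (le_lt_trans (distr_fun_nd yx) Fxu)).
  by rewrite ltxx.
have : F y < u.
  apply: He => //=; rewrite distrC ger0_norm ?subr_ge0 ?ltW//.
  by rewrite ltrBlDl (lt_le_trans yGe)// lerD2r.
by rewrite ltNge (Ay : u <= F y).
Qed.

Lemma inv_distr_fun_nd u v : 0 < u < 1 -> 0 < v < 1 -> u <= v -> G u <= G v.
Proof.
move=> u01 v01 uv; rewrite inv_distr_fun_le//; apply: (le_trans uv).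
by rewrite -inv_distr_fun_le.
Qed.

(** Outside the open unit interval the infimum is taken over a set that is
    unbounded below or empty, and has the dummy value 0, except possibly at
    1. *)
Lemma measurable_inv_distr_fun : measurable_fun [set: R] G.
Proof.
pose G' := G \_ `]0, 1[.
have mG' : measurable_fun [set: R] G'.
  apply/measurable_restrict => //; rewrite setTI.
  apply: measurable_of_itv_homo => u v; rewrite !in_itv/=; exact: inv_distr_fun_nd.
rewrite (_ : G = fun u => if u == 1 then G 1 else G' u).
  by apply: measurable_fun_ifT => //; apply: measurable_fun_eqr.
apply/funext => u; have [->//|u1] := eqVneq u 1.
rewrite /G' patchE mem_setE in_itv/=; case: ifPn => // u01.
have [u0|u0] := leP u 0.
  rewrite /inv_distr_fun inf_out// => -[_ [M lbM]].
  have := lbM (M - 1); rewrite /= (le_trans u0 (distr_fun_ge0 _)) => /(_ isT).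
  by rewrite leNgt gtrBl ltr01.
have {}u1 : 1 < u by move: u01; rewrite u0/= -leNgt le_eqVlt eq_sym (negbTE u1).
rewrite /inv_distr_fun (_ : [set _ | _] = set0) ?inf0//.
apply/seteqP; split=> // x /= /le_trans/(_ (distr_fun_le1 x)).
by rewrite leNgt u1.
Qed.

End inverse_distribution.

Lemma law_eq_inv_distr_fun (R : realType) (X Y : law R) :
  (forall u, 0 < u < 1 -> inv_distr_fun X u = inv_distr_fun Y u) -> law_eq X Y.
Proof.
move=> XY; apply: law_unique => x; rewrite !distr_funE; congr EFin.
wlog suff H : X Y XY / distr_fun X x <= distr_fun Y x.
  by apply/eqP; rewrite eq_le !H// => u /XY.
rewrite leNgt; apply/negP => YX.
pose u := (distr_fun Y x + distr_fun X x) / 2.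
have Yu : distr_fun Y x < u by rewrite midf_lt.
have uX : u < distr_fun X x by rewrite midf_lt.
have u01 : 0 < u < 1.
  by rewrite (le_lt_trans (distr_fun_ge0 Y x))// (lt_le_trans uX)// distr_fun_le1.
by move: Yu; rewrite ltNge -inv_distr_fun_le// -XY// inv_distr_fun_le// ltW.
Qed.

(** * Expectations of functions of a record *)

Section record_expectation.
Context d (Omega : measurableType d) (R : realType) (P : probability Omega R).
Variable V : nat -> {RV P >-> R}.
Hypothesis iidV : iid_uniform01 V.
Local Notation mu := (@lebesgue_measure R).

Let mU n : measurable_fun [set: Omega] (record_value V n).
Proof. by apply: measurable_record_value => k; exact: measurable_funP. Qed.

Lemma ge0_integral_record_value n (f : R -> \bar R) :
  measurable_fun [set: R] f -> (forall x, 0 <= f x)%E ->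
  (\int[P]_w f (record_value V n w) =
   \int[mu]_(y in `]0%R, +oo[) (f (Linv y) * (erlang n y)%:E))%E.
Proof.
move=> mf f0; pose w := (fun u : R => L u ^+ n / n`!%:R) \_ `]0, 1[.
have mLX : measurable_fun [set: R] (fun u : R => L u ^+ n / n`!%:R).
  apply: measurable_funM => //; apply: measurable_funX; exact: measurable_L.
have mw : measurable_fun [set: R] w.
  by apply/measurable_restrict => //; rewrite setTI; exact: measurable_funTS.
have w0 u : 0 <= w u.
  apply: restrict_ge0 => {}u /=; rewrite in_itv/= => /L_gt0 Lu.
  by rewrite divr_ge0// exprn_ge0// ltW.
have mUn : measurable_fun [set: Omega] (record_value V n : Omega -> measurableTypeR R).
  exact: mU.
pose U : {mfun Omega >-> measurableTypeR R} :=
  HB.pack (record_value V n : Omega -> measurableTypeR R)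
    (isMeasurableFun.Build _ _ _ _ _ mUn).
transitivity (\int[distribution P U]_x f x)%E.
  by rewrite ge0_integral_distribution.
rewrite (@ge0_integral_density _ _ _ mu (distribution P U) w)//; last first.
  move=> A mA; rewrite [LHS](record_value_law iidV n mA) /record_law.
  rewrite integral_mkcondr; apply: eq_integral => u _.
  by rewrite /w !patchE; case: ifP.
(* The absolute value makes the integrand nonnegative on the whole line. *)
transitivity (\int[mu]_(u in `]0%R, 1%R[) (f u * `|L u ^+ n / n`!%:R|%:E))%E.
  rewrite [RHS]integral_mkcond; apply: eq_integral => u _.
  rewrite /w !patchE mem_setE in_itv/=; case: ifPn => [/L_gt0 Lu|]; last by rewrite mule0.
  by rewrite ger0_norm// divr_ge0// exprn_ge0// ltW.
have mg : measurable_fun (`]0, 1[%classic : set R) (fun u => f u * `|L u ^+ n / n`!%:R|%:E)%E.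
  apply: measurable_funTS; apply: emeasurable_funM => //.
  by apply/measurable_EFinP; exact: measurableT_comp.
rewrite (integral_uniform_exponential mg); last by move=> u; rewrite mule_ge0.
apply: eq_integral => y; rewrite inE/= in_itv/= andbT => y0.
by rewrite LinvK -muleA -EFinM /erlang ger0_norm// divr_ge0// exprn_ge0// ltW.
Qed.

Lemma integral_record_value n (h : R -> R) : measurable_fun [set: R] h ->
  (\int[P]_w (h (record_value V n w))%:E =
   \int[mu]_(y in `]0%R, +oo[) (h (Linv y) * erlang n y)%:E)%E.
Proof.
move=> mh; rewrite integralE [in RHS]integralE.
have mE : measurable_fun [set: R] (EFin \o h) by exact/measurable_EFinP.
congr (_ - _)%E.
- under eq_integral do rewrite funeposE /=.
  rewrite (ge0_integral_record_value n (f := fun u => maxe (h u)%:E 0%E)).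
  + apply: eq_integral => y; rewrite inE/= in_itv/= andbT => y0.
    by rewrite funeposE /= -!EFin_max -EFinM maxr_pMl ?mul0r// erlang_ge0// ltW.
  + by apply: measurable_maxe.
  + by move=> x; rewrite le_max lexx orbT.
- under eq_integral do rewrite funenegE /=.
  rewrite (ge0_integral_record_value n (f := fun u => maxe (- (h u)%:E)%E 0%E)).
  + apply: eq_integral => y; rewrite inE/= in_itv/= andbT => y0.
    rewrite funenegE /= -?EFinN -!EFin_max -EFinM maxr_pMl ?mul0r ?mulNr//.
    by rewrite erlang_ge0// ltW.
  + by apply: measurable_maxe => //; exact: measurableT_comp.
  + by move=> x; rewrite le_max lexx orbT.
Qed.

Section records_of_a_law.
Variables (X : law R) (H : R -> R).
Hypothesis XH : forall u, 0 < u < 1 -> inv_distr_fun X u = H (L u).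

Lemma integral_record_of n :
  (\int[P]_w (record_of V X n w)%:E =
   \int[mu]_(y in `]0%R, +oo[) (erlang n y * H y)%:E)%E.
Proof.
rewrite (integral_record_value n (measurable_inv_distr_fun X)).
apply: eq_integral => y; rewrite inE/= in_itv/= andbT => y0.
by rewrite XH ?Linv_itv// LinvK mulrC.
Qed.

Lemma record_of_integrable n :
  (\int[mu]_(y in `]0%R, +oo[) (erlang n y * `|H y|)%:E < +oo)%E ->
  P.-integrable [set: Omega] (EFin \o record_of V X n).
Proof.
move=> Hoo; apply/integrableP; split.
  apply/measurable_EFinP.
  exact: (measurableT_comp (measurable_inv_distr_fun X) (mU n)).
apply: le_lt_trans Hoo.
have mG : measurable_fun [set: R] (fun u => `|inv_distr_fun X u|).
  by apply: measurableT_comp => //; exact: measurable_inv_distr_fun.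
rewrite [leLHS](integral_record_value n mG).
rewrite (_ : (\int[_]_(_ in _) _)%E = \int[mu]_(y in `]0%R, +oo[) (erlang n y * `|H y|)%:E)%E//.
apply: eq_integral => y; rewrite inE/= in_itv/= andbT => y0.
by rewrite XH ?Linv_itv// LinvK mulrC.
Qed.

End records_of_a_law.

End record_expectation.

(** * Functions given by their increments *)

Section tonelli.
Context dS (S : measurableType dS) (R : realType).
Variables (m : {sigma_finite_measure set S -> \bar R}) (g : S -> R).
Hypotheses (mg : measurable_fun [set: S] g) (g0 : forall s, 0 <= g s).
Local Notation mu := (@lebesgue_measure R).

(** Tonelli for a product density cut by a region [E] of the plane, in a
    form where both inner integrals range over sections of [E]. *)
Lemma tonelli_section (E : set (S * measurableTypeR R)) (q : R -> R) : measurable E ->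
  measurable_fun [set: R] q -> (forall y, 0 <= q y) ->
  (\int[mu]_y ((q y)%:E * \int[m]_(s in [set s | E (s, y)]) (g s)%:E) =
   \int[m]_s ((g s)%:E * \int[mu]_(y in [set y | E (s, y)]) (q y)%:E))%E.
Proof.
move=> mE mq q0.
pose f (x : S * measurableTypeR R) : \bar R := ((g x.1)%:E * (q x.2)%:E * (\1_E x)%:E)%E.
have mf : measurable_fun setT f.
  apply: emeasurable_funM; last exact/measurable_EFinP/measurable_indic.
  apply: emeasurable_funM; apply/measurable_EFinP.
    exact: (measurableT_comp mg measurable_fst).
  exact: (measurableT_comp mq measurable_snd).
have f0 x : (0 <= f x)%E by rewrite /f !mule_ge0// lee_fin.
have mEs s : measurable [set y : measurableTypeR R | E (s, y)].
  have := measurable_xsection s mE; rewrite /xsection.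
  by under eq_set do rewrite inE.
have mEy y : measurable [set s : S | E (s, y)].
  have := measurable_ysection y mE; rewrite /ysection.
  by under eq_set do rewrite inE.
transitivity (\int[mu]_y \int[m]_s f (s, y))%E.
  apply: eq_integral => y _; rewrite integral_mkcond -ge0_integralZl//.
  - apply: eq_integral => s _; rewrite /f/= patchE indicE.
    rewrite (_ : ((s, y) \in E) = (s \in [set s | E (s, y)])); last first.
      by apply/idP/idP; rewrite !inE.
    by case: ifP => _; rewrite ?mule1 ?mule0// muleC.
  - apply/measurable_restrict => //; rewrite setTI; apply: measurable_funTS.
    exact/measurable_EFinP.
  - by move=> s _; apply: erestrict_ge0 => t _; rewrite lee_fin.
  - by rewrite lee_fin.
rewrite -(fubini_tonelli f mf f0).
apply: eq_integral => s _; rewrite [in RHS]integral_mkcond -ge0_integralZl//.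
- apply: eq_integral => y _; rewrite /f/= patchE indicE.
  rewrite (_ : ((s, y) \in E) = (y \in [set y | E (s, y)])); last first.
    by apply/idP/idP; rewrite !inE.
  by case: ifP => _; rewrite ?mule1 ?mule0.
- apply/measurable_restrict => //; rewrite setTI; apply: measurable_funTS.
  exact/measurable_EFinP.
- by move=> y _; apply: erestrict_ge0 => t _; rewrite lee_fin.
- by rewrite lee_fin.
Qed.

End tonelli.

(** For [X] given by [H], this is the expected record with index [n]
    (indices start at 0). *)
Definition rho (R : realType) (H : R -> R) n :=
  fine (\int[@lebesgue_measure R]_(y in `]0%R, +oo[) (erlang n y * H y)%:E)%E.

Section increments.
Context dS (S : measurableType dS) (R : realType).
Variables (m : {sigma_finite_measure set S -> \bar R}) (g tau : S -> R).
Hypotheses (mg : measurable_fun [set: S] g) (g0 : forall s, 0 <= g s).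
Hypothesis mtau : measurable_fun [set: S] tau.
Variable H : R -> R.
Hypothesis HE : forall z y : R, 0 < z -> z <= y ->
  (\int[m]_(s in [set s | (z <= tau s < y)%R]) (g s)%:E = (H y - H z)%:E)%E.
Local Notation mu := (@lebesgue_measure R).

Let D1 := [set s | 1 <= tau s].
Let D0 := [set s | 0 < tau s < 1].

Lemma increments_nd z y : 0 < z -> z <= y -> H z <= H y.
Proof.
move=> z0 zy; rewrite -subr_ge0 -lee_fin -HE//; apply: integral_ge0 => s _.
by rewrite lee_fin.
Qed.

Lemma measurable_increments : measurable_fun (`]0, +oo[%classic : set R) H.
Proof.
apply: measurable_of_itv_homo => x y; rewrite !in_itv/= !andbT => x0 _.
exact: increments_nd.
Qed.

Let measurable_le_set d (T : measurableType d) (f h : T -> R) :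
  measurable_fun [set: T] f -> measurable_fun [set: T] h ->
  measurable [set t | f t <= h t].
Proof.
move=> mf mh; have := measurable_fun_ler mf mh => /(_ measurableT [set true]).
by rewrite setTI; apply.
Qed.

Let mD1 : measurable D1. Proof. exact: measurable_le_set. Qed.
Let mD0 : measurable D0.
Proof.
rewrite (_ : D0 = [set s | 0 < tau s] `&` [set s | tau s < 1]); last first.
  by apply/seteqP; split=> s /=; [move=> /andP[]|rewrite /D0/= => -[-> ->]].
by apply: measurableI; exact: measurable_lt_set.
Qed.

Let q n : R -> R := erlang n \_ `]0, +oo[.
Let mq n : measurable_fun [set: R] (q n).
Proof.
by apply/measurable_restrict => //; rewrite setTI; apply: measurable_funTS; exact: measurable_erlang.
Qed.
Let q0 n y : 0 <= q n y.
Proof.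
apply: restrict_ge0 => {}y /=; rewrite in_itv/= andbT => y0.
by rewrite erlang_ge0// ltW.
Qed.
Let qE n y : 0 < y -> q n y = erlang n y.
Proof. by move=> y0; rewrite /q patchE mem_setE in_itv/= y0. Qed.

(** Tonelli over the region [1 <= tau s < y]: the increment [H y - H 1] is
    an integral of [g] and the inner integral of [erlang n] is its tail at
    [tau s]. The half-line is cut at 1 because [H] may be unbounded near 0
    and near infinity. *)
Lemma integral_increments_above n :
  (\int[mu]_(y in `[1%R, +oo[) (erlang n y * (H y - H 1))%:E =
   \int[m]_(s in D1) (g s * erlang_tail n (tau s))%:E)%E.
Proof.
pose E := [set x : S * measurableTypeR R | 1 <= tau x.1 < x.2].
have mE : measurable E.
  rewrite (_ : E = [set x | 1 <= tau x.1] `&` [set x | tau x.1 < x.2]); last first.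
    by apply/seteqP; split=> s /=; [move=> /andP[]|move=> [] ; rewrite /E/= => -> ->].
  have mt1 : measurable_fun [set: S * measurableTypeR R] (fun x => tau x.1).
    exact: (measurableT_comp mtau measurable_fst).
  by apply: measurableI; [exact: measurable_le_set|exact: measurable_lt_set].
transitivity (\int[mu]_y ((q n y)%:E * \int[m]_(s in [set s | E (s, y)]) (g s)%:E))%E.
  rewrite integral_mkcond; apply: eq_integral => y _; rewrite patchE mem_setE in_itv/= andbT.
  case: leP => y1.
    by rewrite -[[set s | _]]/([set s | 1 <= tau s < y]) HE// qE ?(lt_le_trans _ y1)// EFinM.
  rewrite (_ : [set s | E (s, y)] = set0) ?integral_set0 ?mule0//.
  by apply/seteqP; split=> s //= /andP[t1 ty]; move: (lt_trans (le_lt_trans t1 ty) y1); rewrite ltxx.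
rewrite tonelli_section// [RHS]integral_mkcond; apply: eq_integral => s _.
rewrite patchE; case: ifPn => [|/negP nD].
  rewrite inE/= => ts; have t0 : 0 < tau s by rewrite (lt_le_trans _ ts).
  rewrite EFinM; congr (_ * _)%E.
  rewrite -integral_erlang_itvcy ?(ltW t0)// -integral_itv_obnd_cbnd; last first.
    by apply: measurable_funTS; apply/measurable_EFinP; exact: measurable_erlang.
  rewrite (_ : [set y | E (s, y)] = `]tau s, +oo[%classic); last first.
    by apply/seteqP; split => y /=; rewrite in_itv/= /E/= ts andbT.
  apply: eq_integral => y; rewrite inE/= in_itv/= andbT => ty.
  by rewrite qE// (lt_trans t0).
rewrite (_ : [set y | E (s, y)] = set0) ?integral_set0 ?mule0//.
by apply/seteqP; split=> y //= /andP[t1 ty]; apply: nD; rewrite inE.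
Qed.

Lemma integral_increments_below n :
  (\int[mu]_(y in `]0%R, 1%R[) (erlang n y * (H 1 - H y))%:E =
   \int[m]_(s in D0) (g s * (1 - erlang_tail n (tau s)))%:E)%E.
Proof.
pose E := [set x : S * measurableTypeR R | [/\ 0 < x.2, x.2 <= tau x.1 & tau x.1 < 1]].
have mE : measurable E.
  rewrite (_ : E = [set x | 0 < x.2] `&` ([set x | x.2 <= tau x.1] `&` [set x | tau x.1 < 1])); last first.
    by apply/seteqP; split=> s /=; [move=> []|move=> [? []]].
  have mt1 : measurable_fun [set: S * measurableTypeR R] (fun x => tau x.1).
    exact: (measurableT_comp mtau measurable_fst).
  apply: measurableI; first exact: measurable_lt_set.
  by apply: measurableI; [exact: measurable_le_set|exact: measurable_lt_set].
transitivity (\int[mu]_y ((q n y)%:E * \int[m]_(s in [set s | E (s, y)]) (g s)%:E))%E.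
  rewrite integral_mkcond; apply: eq_integral => y _; rewrite patchE mem_setE in_itv/=.
  case: ifPn => [/andP[y0 y1]|y01].
    rewrite (_ : [set s | E (s, y)] = [set s | y <= tau s < 1]); last first.
      by apply/seteqP; split=> s /=; [move=> [/= _ -> ->]|move=> /andP[]].
    by rewrite HE ?(ltW y1)// qE// EFinM.
  rewrite (_ : [set s | E (s, y)] = set0) ?integral_set0 ?mule0//.
  by apply/seteqP; split=> s //= [/= y0 yt t1]; move: y01; rewrite y0 (le_lt_trans yt).
rewrite tonelli_section// [RHS]integral_mkcond; apply: eq_integral => s _.
rewrite patchE; case: ifPn => [|/negP nD].
  rewrite inE/= => /andP[t0 t1].
  rewrite EFinM; congr (_ * _)%E.
  rewrite -integral_erlang_itvoc ?(ltW t0)//.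
  rewrite (_ : [set y | E (s, y)] = `]0, tau s]%classic); last first.
    apply/seteqP; split => y /=; rewrite in_itv/= /E/=; first by move=> [-> ->].
    by move=> /andP[].
  apply: eq_integral => y; rewrite inE/= in_itv/= => /andP[y0 _].
  by rewrite qE.
rewrite (_ : [set y | E (s, y)] = set0) ?integral_set0 ?mule0//.
apply/seteqP; split=> y //= [/= y0 yt t1]; apply: nD; rewrite inE /D0/= t1 andbT.
exact: lt_le_trans yt.
Qed.

Let Hdiff n := (\int[mu]_(y in `]0%R, +oo[) (erlang n y * `|H y - H 1|)%:E)%E.
Let A n := (\int[m]_(s in D1) (g s * erlang_tail n (tau s))%:E)%E.
Let B n := (\int[m]_(s in D0) (g s * (1 - erlang_tail n (tau s)))%:E)%E.
Let C1 n := (\int[m]_(s in D1) (g s * erlang n (tau s))%:E)%E.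
Let C0 n := (\int[m]_(s in D0) (g s * erlang n (tau s))%:E)%E.
Let C n := (\int[m]_(s in [set s | (0 < tau s)%R]) (g s * erlang n (tau s))%:E)%E.

Let mtail n : measurable_fun [set: S] (fun s => erlang_tail n (tau s)).
Proof. exact: (measurableT_comp (@measurable_erlang_tail R n) mtau). Qed.
Let merl n : measurable_fun [set: S] (fun s => erlang n (tau s)).
Proof. exact: (measurableT_comp (@measurable_erlang R n) mtau). Qed.
Let mgtail n : measurable_fun [set: S] (fun s => (g s * erlang_tail n (tau s))%:E).
Proof. by apply/measurable_EFinP; exact: measurable_funM. Qed.
Let mgtailC n : measurable_fun [set: S] (fun s => (g s * (1 - erlang_tail n (tau s)))%:E).
Proof. by apply/measurable_EFinP; apply: measurable_funM => //; exact: measurable_funB. Qed.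
Let mgerl n : measurable_fun [set: S] (fun s => (g s * erlang n (tau s))%:E).
Proof. by apply/measurable_EFinP; exact: measurable_funM. Qed.

Let D1_gt0 s : D1 s -> 0 < tau s. Proof. exact: lt_le_trans. Qed.
Let D0_gt0 s : D0 s -> 0 < tau s. Proof. by case/andP. Qed.

Let gtail_ge0 n s : 0 < tau s -> (0 <= (g s * erlang_tail n (tau s))%:E)%E.
Proof. by move=> /ltW t0; rewrite lee_fin mulr_ge0// erlang_tail_ge0. Qed.
Let gtailC_ge0 n s : 0 < tau s -> (0 <= (g s * (1 - erlang_tail n (tau s)))%:E)%E.
Proof. by move=> /ltW t0; rewrite lee_fin mulr_ge0// subr_ge0 erlang_tail_le1. Qed.
Let gerl_ge0 n s : 0 < tau s -> (0 <= (g s * erlang n (tau s))%:E)%E.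
Proof. by move=> /ltW t0; rewrite lee_fin mulr_ge0// erlang_ge0. Qed.

Let AS n : A n.+1 = (A n + C1 n.+1)%E.
Proof.
rewrite /A /C1 -ge0_integralD//.
- by apply: eq_integral => s _; rewrite -EFinD erlang_tailS mulrDr.
- by move=> s /D1_gt0; exact: gtail_ge0.
- exact: measurable_funTS.
- by move=> s /D1_gt0; exact: gerl_ge0.
- exact: measurable_funTS.
Qed.

Let BS n : B n = (B n.+1 + C0 n.+1)%E.
Proof.
rewrite /B /C0 -ge0_integralD//.
- by apply: eq_integral => s _; rewrite -EFinD erlang_tailS; congr EFin; ring.
- by move=> s /D0_gt0; exact: gtailC_ge0.
- exact: measurable_funTS.
- by move=> s /D0_gt0; exact: gerl_ge0.
- exact: measurable_funTS.
Qed.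

Let CE n : C n = (C0 n + C1 n)%E.
Proof.
rewrite /C /C0 /C1 -ge0_integral_setU//.
- congr (integral _ _ _); apply/seteqP; split=> s /=.
    by move=> s0; rewrite /D0 /D1/= s0/=; case: (leP 1 (tau s)); [right|left].
  by case => [/D0_gt0|/D1_gt0].
- exact: measurable_funTS.
- by move=> s [/D0_gt0|/D1_gt0]; exact: gerl_ge0.
- by apply/disj_setPS => s [/= /andP[_ s1] s1']; move: (lt_le_trans s1 s1'); rewrite ltxx.
Qed.

Let split01 : `]0%R, +oo[%classic = `]0%R, 1%R[%classic `|` `[1%R, +oo[%classic :> set R.
Proof.
apply/seteqP; split=> y /=; rewrite !in_itv/= !andbT.
  by move=> ->; case: (ltP y 1) => ?; [left|right].
by case=> [/andP[]//|]; apply: lt_le_trans.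
Qed.

Let disj01 : [disjoint `]0%R, 1%R[%classic & (`[1%R, +oo[%classic : set R)].
Proof.
apply/disj_setPS => y /= [] /=; rewrite !in_itv/= andbT => /andP[_ s1] s1'.
by move: (lt_le_trans s1 s1'); rewrite ltxx.
Qed.

Let mHdiff n : measurable_fun (`]0, +oo[%classic : set R) (fun y => erlang n y * (H y - H 1)).
Proof.
apply: measurable_funM; first by apply: measurable_funTS; exact: measurable_erlang.
by apply: measurable_funB => //; exact: measurable_increments.
Qed.

Let HdiffE n : Hdiff n = (B n + A n)%E.
Proof.
rewrite /Hdiff split01 ge0_integral_setU//.
- congr (_ + _)%E; rewrite /A /B -?integral_increments_below -?integral_increments_above.
    apply: eq_integral => y; rewrite inE/= in_itv/= => /andP[y0 y1].
    by rewrite distrC ger0_norm// subr_ge0 increments_nd// ltW.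
  apply: eq_integral => y; rewrite inE/= in_itv/= andbT => y1.
  by rewrite ger0_norm// subr_ge0 increments_nd.
- rewrite -split01; apply/measurable_EFinP; apply: measurable_funM.
    by apply: measurable_funTS; exact: measurable_erlang.
  apply: measurableT_comp => //; apply: measurable_funB => //; exact: measurable_increments.
- rewrite -split01 => y /=; rewrite in_itv/= andbT => y0.
  by rewrite lee_fin mulr_ge0// erlang_ge0// ltW.
Qed.

(** The tail and its complement are compared with finitely many of the
    integrals assumed finite: beyond 1, [erlang 0 <= erlang 1]; below 1, the
    complement of the tail of [erlang 0] is at most [t <= e * erlang 1 t];
    the remaining indices follow from the recurrence of the tails. *)
Lemma increments_integrable :
  (forall n, \int[m]_(s in [set s | (0 < tau s)%R]) (g s * erlang n.+1 (tau s))%:E < +oo)%E ->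
  forall n, (\int[mu]_(y in `]0%R, +oo[) (erlang n y * `|H y|)%:E < +oo)%E.
Proof.
move=> Coo n.
have C1_ge0 k : (0 <= C1 k)%E by apply: integral_ge0 => s /D1_gt0; exact: gerl_ge0.
have C0_ge0 k : (0 <= C0 k)%E by apply: integral_ge0 => s /D0_gt0; exact: gerl_ge0.
have C1oo k : (C1 k.+1 < +oo)%E.
  by apply: le_lt_trans (Coo k); rewrite -/(C k.+1) CE leeDr.
have C0oo k : (C0 k.+1 < +oo)%E.
  by apply: le_lt_trans (Coo k); rewrite -/(C k.+1) CE leeDl.
have Aoo : (A n < +oo)%E.
  elim: n => [|k IH]; last by rewrite AS lte_add_pinfty.
  apply: le_lt_trans (C1oo 0%N); apply: ge0_le_integral => //.
  - by move=> s /D1_gt0; exact: gtail_ge0.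
  - exact: measurable_funTS.
  - exact: measurable_funTS.
  - move=> s D1s; rewrite lee_fin ler_wpM2l// /erlang_tail big_ord1 /erlang expr0 expr1 !fact0 !factS fact0.
    by rewrite !divr1 ler_wpM2r ?expR_ge0.
have Boo : (B n < +oo)%E.
  have : (B 0 < +oo)%E.
    have : ((expR 1)%:E * C0 1%N < +oo)%E by rewrite lte_mul_pinfty// ?lee_fin ?expR_ge0.
    apply: le_lt_trans; rewrite /C0 -ge0_integralZl//; first last.
    - by move=> s /D0_gt0; exact: gerl_ge0.
    - exact: measurable_funTS.
    apply: ge0_le_integral => //.
    - by move=> s /D0_gt0; exact: gtailC_ge0.
    - exact: measurable_funTS.
    - by apply: measurable_funeM; exact: measurable_funTS.
    - move=> s /= /andP[t0 t1]; rewrite -EFinM lee_fin mulrCA ler_wpM2l//.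
      rewrite /erlang_tail big_ord1 /erlang expr0 expr1 fact0 factS fact0 !divr1 mul1r.
      rewrite mulrCA -expRD; apply: (@le_trans _ _ (tau s)).
        by rewrite lerBlDr -lerBlDl; exact: expR_ge1Dx.
      rewrite ler_peMr ?(ltW t0)//; apply: le_trans (expR_ge1Dx _).
      by rewrite lerDl subr_ge0 ltW.
  elim: n {Aoo} => // k IH /IH; rewrite BS; apply: le_lt_trans.
  by rewrite leeDl.
have mabs (h : R -> R) : measurable_fun (`]0, +oo[%classic : set R) h ->
    measurable_fun (`]0, +oo[%classic : set R) (fun y => (erlang n y * `|h y|)%:E).
  move=> mh; apply/measurable_EFinP; apply: measurable_funM.
    by apply: measurable_funTS; exact: measurable_erlang.
  exact: measurableT_comp.
have e0 y (r : R) : (`]0, +oo[%classic : set R) y -> (0 <= (erlang n y * `|r|)%:E)%E.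
  by rewrite /= in_itv/= andbT => y0; rewrite lee_fin mulr_ge0// erlang_ge0// ltW.
apply: (@le_lt_trans _ _ (Hdiff n + \int[mu]_(y in `]0%R, +oo[) (erlang n y * `|H 1|)%:E)%E).
  rewrite /Hdiff -ge0_integralD//; last 4 first.
  - by move=> y; exact: e0.
  - by apply: (mabs (fun y => H y - H 1)); apply: measurable_funB => //; exact: measurable_increments.
  - by move=> y; exact: e0.
  - exact: (mabs (fun=> H 1)).
  apply: ge0_le_integral => //.
  - by move=> y; exact: e0.
  - exact: (mabs _ measurable_increments).
  - apply: emeasurable_funD.
    + by apply: (mabs (fun y => H y - H 1)); apply: measurable_funB => //; exact: measurable_increments.
    + exact: (mabs (fun=> H 1)).
  - move=> y; rewrite /= in_itv/= andbT => y0; rewrite -EFinD lee_fin -mulrDr.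
    rewrite ler_wpM2l ?erlang_ge0 ?(ltW y0)//.
    by rewrite -{1}(subrK (H 1) (H y)) ler_normD.
rewrite lte_add_pinfty//; first by rewrite HdiffE lte_add_pinfty.
under eq_integral do rewrite EFinM.
rewrite ge0_integralZr//.
- by rewrite integral_erlang mul1e ltry.
- by apply: measurable_funTS; apply/measurable_EFinP; exact: measurable_erlang.
- by move=> y; rewrite /= in_itv/= andbT => y0; rewrite lee_fin erlang_ge0// ltW.
Qed.

(** With the half-line cut at 1, [rho H n - H 1] is the integral of the tail
    above 1 minus the integral of its complement below 1. Passing from [n]
    to [n+1] adds [erlang (n+1)] to the tail and removes it from the
    complement. *)
Lemma increments_moments :
  (forall n, (\int[mu]_(y in `]0%R, +oo[) (erlang n y * `|H y|)%:E < +oo)%E) ->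
  forall n, (\int[m]_(s in [set s | (0 < tau s)%R]) (g s * erlang n.+1 (tau s))%:E =
    (rho H n.+1 - rho H n)%:E)%E.
Proof.
move=> Hoo.
have me n : measurable_fun (`]0, +oo[%classic : set R) (erlang n).
  by apply: measurable_funTS; exact: measurable_erlang.
have iH n : mu.-integrable (`]0, +oo[%classic : set R) (EFin \o (fun y => erlang n y * H y)).
  apply/integrableP; split.
    by apply/measurable_EFinP; apply: measurable_funM; [exact: me|exact: measurable_increments].
  rewrite (_ : (\int[_]_(_ in _) _)%E = \int[mu]_(y in `]0%R, +oo[) (erlang n y * `|H y|)%:E)%E//.
  apply: eq_integral => y; rewrite inE/= in_itv/= andbT => y0.
  by rewrite normrM (ger0_norm (erlang_ge0 n (ltW y0))).
have i1 n : mu.-integrable (`]0, +oo[%classic : set R) (EFin \o (fun y => erlang n y * H 1)).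
  by apply: eq_integrable (integrableZr _ (H 1) (integrable_erlang R n)) => // y _; rewrite /= EFinM.
have rhoE n : (\int[mu]_(y in `]0%R, +oo[) (erlang n y * (H y - H 1))%:E = (rho H n - H 1)%:E)%E.
  under eq_integral do rewrite mulrBr EFinB.
  rewrite (integralB_EFin _ (iH n) (i1 n))//.
  rewrite -[in LHS](fineK (integrable_fin_num _ (iH n)))// EFinB; congr (_ - _)%E.
  under eq_integral do rewrite EFinM.
  by rewrite (integralZr _ (integrable_erlang R n))// integral_erlang mul1e.
have Hdoo n : (Hdiff n < +oo)%E.
  have /integrableP[_] : mu.-integrable (`]0, +oo[%classic : set R) (EFin \o (fun y => erlang n y * (H y - H 1))).
    by apply: eq_integrable (integrableB _ (iH n) (i1 n)) => // y _; rewrite /= -EFinB mulrBr.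
  rewrite (_ : (\int[_]_(_ in _) _)%E = Hdiff n)//.
  apply: eq_integral => y; rewrite inE/= in_itv/= andbT => y0.
  by rewrite normrM (ger0_norm (erlang_ge0 n (ltW y0))).
have A_ge0 k : (0 <= A k)%E by apply: integral_ge0 => s /D1_gt0; exact: gtail_ge0.
have B_ge0 k : (0 <= B k)%E by apply: integral_ge0 => s /D0_gt0; exact: gtailC_ge0.
have Afin k : A k \is a fin_num.
  by rewrite ge0_fin_numE//; apply: le_lt_trans (Hdoo k); rewrite HdiffE leeDr.
have Bfin k : B k \is a fin_num.
  by rewrite ge0_fin_numE//; apply: le_lt_trans (Hdoo k); rewrite HdiffE leeDl.
have rhoAB n : ((rho H n - H 1)%:E = A n - B n)%E.
  rewrite -rhoE split01 integral_setU//; last by rewrite -split01; apply/measurable_EFinP; exact: mHdiff.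
  rewrite integral_increments_above addeC; congr (_ + _)%E.
  rewrite /B -integral_increments_below -integral_ge0N//.
    by apply: eq_integral => y _; rewrite -EFinN; congr EFin; ring.
  move=> y; rewrite /= in_itv/= => /andP[y0 y1].
  rewrite lee_fin; apply: mulr_ge0; first by rewrite erlang_ge0 ?ltW.
  by rewrite subr_ge0 increments_nd ?ltW.
move=> n.
rewrite -[LHS]/(C n.+1); have := rhoAB n; have := rhoAB n.+1; rewrite CE.
have C1fin : C1 n.+1 \is a fin_num by move: (Afin n.+1); rewrite AS fin_numD => /andP[].
have C0fin : C0 n.+1 \is a fin_num by move: (Bfin n); rewrite BS fin_numD => /andP[].
rewrite (BS n) (AS n).
rewrite -(fineK (Afin n)) -(fineK (Bfin n.+1)) -(fineK C1fin) -(fineK C0fin).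
rewrite -?EFinD -?EFinN -?EFinD => -[e1] [e2]; congr EFin.
rewrite (_ : rho H n.+1 = rho H n.+1 - H 1 + H 1); last by rewrite subrK.
rewrite e1 (_ : rho H n = rho H n - H 1 + H 1); last by rewrite subrK.
by rewrite e2; ring.
Qed.

End increments.

(** * Expected record sequences and the map phi *)

Section inv_erlang1.
Context (R : realType).

(** The function [e^t / t] for positive [t], written so that it is
    nonnegative and measurable on the whole line. *)
Definition inv_erlang1 (t : R) : R := expR (t - ln t).

Lemma inv_erlang1E t : 0 < t -> inv_erlang1 t = expR t / t.
Proof. by move=> t0; rewrite /inv_erlang1 expRB lnK. Qed.

Lemma inv_erlang1_ge0 t : 0 <= inv_erlang1 t.
Proof. exact: expR_ge0. Qed.

Lemma inv_erlang1_erlang n t : 0 < t ->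
  inv_erlang1 t * erlang n.+1 t = t ^+ n / (n.+1)`!%:R.
Proof.
move=> t0; rewrite inv_erlang1E// /erlang exprSr.
have n0 : (n.+1)`!%:R != 0 :> R by rewrite pnatr_eq0 -lt0n fact_gt0.
rewrite (_ : _ * _ = (expR t * expR (- t)) * (t / t) * (t ^+ n / (n.+1)`!%:R)).
  by rewrite expRxMexpNx_1 divff ?gt_eqF// !mul1r.
by field; rewrite n0 gt_eqF.
Qed.

Lemma measurable_inv_erlang1 : measurable_fun [set: R] inv_erlang1.
Proof. by apply: measurableT_comp => //; exact: measurable_funB. Qed.

End inv_erlang1.

Section record_sequence.
Context (R : realType) (H : R -> R).
Local Notation mu := (@lebesgue_measure R).

Local Notation rho := (rho H).

Lemma rho_H0_fun : H0_fun H -> rho 0 = 0 /\ rho 1 = 1.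
Proof.
move=> [_ H_0 H_1]; rewrite /rho; split.
  rewrite (_ : (\int[_]_(_ in _) _)%E = 0%E)//; rewrite -H_0.
  by apply: eq_integral => y _; rewrite erlang_0E.
rewrite (_ : (\int[_]_(_ in _) _)%E = 1%E)//; rewrite -H_1.
by apply: eq_integral => y _; rewrite erlang_1E.
Qed.

Hypothesis HH : Hstar_fun H.

Let mH : measurable_fun (`]0, +oo[%classic : set R) H.
Proof.
have [_ Hnd _ _] := HH.
by apply: measurable_of_itv_homo => x y; rewrite !in_itv/= !andbT => x0 _; exact: Hnd.
Qed.

Let merlang n : measurable_fun (`]0, +oo[%classic : set R) (@erlang R n).
Proof. by apply: measurable_funTS; exact: measurable_erlang. Qed.

Lemma Hstar_erlang n : (\int[mu]_(y in `]0%R, +oo[) (erlang n y * `|H y|)%:E < +oo)%E.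
Proof.
have [_ _ _ /(_ n)] := HH; apply: le_lt_trans.
have me : measurable_fun (`]0, +oo[%classic : set R) (fun y : R => y ^+ n * expR (- y)).
  apply: measurable_funTS; apply: measurable_funM; first exact: measurable_funX.
  by apply: measurableT_comp => //; exact: measurableT_comp.
apply: ge0_le_integral => //.
- move=> y; rewrite /= in_itv/= andbT => y0.
  by rewrite lee_fin mulr_ge0// erlang_ge0// ltW.
- by apply/measurable_EFinP; apply: measurable_funM; [exact: merlang|]; exact: measurableT_comp.
- by apply/measurable_EFinP; apply: measurable_funM => //; exact: measurableT_comp.
- move=> y; rewrite /= in_itv/= andbT => y0; rewrite lee_fin ler_wpM2r//.
  rewrite /erlang ler_wpM2r ?expR_ge0// ler_pdivrMr ?ltr0n ?fact_gt0//.
  by apply: ler_peMr; [rewrite exprn_ge0// ltW|rewrite ler1n fact_gt0].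
Qed.

Lemma Hstar_integrable n :
  mu.-integrable `]0, +oo[ (EFin \o (fun y => erlang n y * H y)).
Proof.
apply/integrableP; split; first by apply/measurable_EFinP; apply: measurable_funM => //; exact: merlang.
rewrite (_ : (\int[_]_(_ in _) _)%E = \int[mu]_(y in `]0%R, +oo[) (erlang n y * `|H y|)%:E)%E.
  exact: Hstar_erlang.
apply: eq_integral => y; rewrite inE/= in_itv/= andbT => y0.
by rewrite normrM (ger0_norm (erlang_ge0 n (ltW y0))).
Qed.

Lemma integral_rho n :
  (\int[mu]_(y in `]0%R, +oo[) (erlang n y * H y)%:E = (rho n)%:E)%E.
Proof. by rewrite fineK//; exact: integrable_fin_num (Hstar_integrable n). Qed.

Lemma integral_expR_Hstar :
  (\int[mu]_(y in `]0%R, +oo[) (expR (- y) * H y)%:E = (rho 0)%:E)%E.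
Proof. by rewrite -integral_rho; apply: eq_integral => y _; rewrite erlang_0E. Qed.

Lemma H0_fun_rho : rho 0 = 0 -> rho 1 = 1 -> H0_fun H.
Proof.
move=> r0 r1; split => //; first by rewrite integral_expR_Hstar r0.
transitivity (\int[mu]_(y in `]0%R, +oo[) (erlang 1 y * H y)%:E)%E.
  by apply: eq_integral => y _; rewrite erlang_1E.
by rewrite integral_rho r1.
Qed.

End record_sequence.

(** Each [erlang n] has total mass 1. *)
Lemma rho_shift (R : realType) (H K : R -> R) k n : Hstar_fun H ->
  (forall y, 0 < y -> K y = H y + k) -> rho K n = rho H n + k.
Proof.
move=> HH KE.
have ik : (@lebesgue_measure R).-integrable `]0, +oo[ (EFin \o (fun y => erlang n y * k)).
  by apply: eq_integrable (integrableZr _ k (integrable_erlang R n)) => // y _; rewrite /= EFinM.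
have kE : (\int[@lebesgue_measure R]_(y in `]0%R, +oo[) (erlang n y * k)%:E = k%:E)%E.
  under eq_integral do rewrite EFinM.
  by rewrite (integralZr _ (integrable_erlang R n))// integral_erlang mul1e.
apply: EFin_inj; rewrite EFinD -(integral_rho HH n) -[in RHS]kE.
rewrite -(integralD_EFin _ (Hstar_integrable HH n) ik)//.
rewrite /rho (_ : (\int[_]_(_ in _) (erlang n _ * K _)%:E)%E =
    (\int[@lebesgue_measure R]_(y in `]0%R, +oo[)
       ((erlang n y * H y)%:E + (erlang n y * k)%:E))%E); last first.
  apply: eq_integral => y; rewrite inE/= in_itv/= andbT => y0.
  by rewrite KE// mulrDr.
rewrite fineK//; apply: integrable_fin_num => //.
exact: integrableD (Hstar_integrable HH n) ik.
Qed.

Section phi.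
Context (R : realType) (X : law R) (H : R -> R).
Hypothesis XH : forall u, 0 < u < 1 -> inv_distr_fun X u = H (L u).
Local Notation mu := (@lebesgue_measure R).
Local Notation F := (distr_fun X).

Definition log_survival (x : R) : R := L (F x).
Local Notation tau := log_survival.

Lemma measurable_log_survival : measurable_fun [set: R] tau.
Proof.
have mL : measurable_fun [set: R] (@L R) by exact: measurable_L.
have mF : measurable_fun [set: R] F by exact: measurable_distr_fun.
exact: measurableT_comp mL mF.
Qed.

Lemma log_survival_ge0 x : 0 <= tau x.
Proof. by rewrite oppr_ge0 ln_le0// gerBl distr_fun_ge0. Qed.

Lemma phi_weightE x : phi_weight X x = erlang 1 (tau x).
Proof.
rewrite /phi_weight /erlang expr1 factS fact0 divr1 mulrC.
have [F1|F1] := ltP (F x) 1.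
  by rewrite /tau /L opprK lnK// posrE subr_gt0.
have FE : F x = 1 by apply/eqP; rewrite eq_le distr_fun_le1.
by rewrite /tau /L FE subrr ln0// oppr0 !mul0r.
Qed.

Lemma inv_distr_fun_Linv y : 0 < y -> inv_distr_fun X (Linv y) = H y.
Proof. by move=> y0; rewrite XH ?Linv_itv// LinvK. Qed.

(** By the Galois connection, [L(F x) >= y] means [x >= H y]. *)
Lemma log_survival_itv z y : 0 < z -> z <= y ->
  [set x | z <= tau x < y] = `[H z, H y[%classic.
Proof.
move=> z0 zy; have y0 : 0 < y by exact: lt_le_trans zy.
have e1 x : (H z <= x) = (Linv z <= F x).
  by rewrite -inv_distr_fun_Linv// inv_distr_fun_le// Linv_itv.
have e2 x : (x < H y) = (F x < Linv y).
  by rewrite !ltNge -inv_distr_fun_Linv// inv_distr_fun_le// Linv_itv.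
apply/seteqP; split => x; rewrite /= in_itv/= e1 e2 => /andP[zt ty].
  have F1 : F x < 1.
    rewrite lt_neqAle distr_fun_le1 andbT; apply/eqP => F1.
    by move: (lt_le_trans z0 zt); rewrite /tau /L F1 subrr ln0// oppr0 ltxx.
  by rewrite -[F x](LK F1) Linv_le Linv_lt zt.
have F1 : F x < 1 by rewrite (lt_trans ty)//; case/andP: (Linv_itv y0).
by rewrite -Linv_le -Linv_lt /tau LK// zt.
Qed.

Lemma log_survival_increments z y : 0 < z -> z <= y ->
  (\int[mu]_(x in [set x | (z <= tau x < y)%R]) (1%R)%:E = (H y - H z)%:E)%E.
Proof.
move=> z0 zy; rewrite log_survival_itv// integral_cst//= mul1e.
have Hzy : H z <= H y.
  rewrite -!inv_distr_fun_Linv//; last exact: lt_le_trans zy.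
  by apply: inv_distr_fun_nd; rewrite ?Linv_itv ?Linv_le// (lt_le_trans z0).
rewrite lebesgue_measure_itv/= lte_fin EFinB.
by move: Hzy; rewrite le_eqVlt => /orP[/eqP ->|->//]; rewrite ltxx -EFinB subrr.
Qed.

Let m1 : measurable_fun [set: measurableTypeR R] (fun=> 1 : R). Proof. by []. Qed.
Let g1 (x : measurableTypeR R) : 0 <= (1 : R). Proof. by []. Qed.
Let mtau : measurable_fun [set: measurableTypeR R] tau.
Proof. exact: measurable_log_survival. Qed.

Lemma measurable_phi_weight : measurable_fun [set: R] (phi_weight X).
Proof.
rewrite (_ : phi_weight X = erlang 1 \o tau); last by apply/funext => x; exact: phi_weightE.
have me : measurable_fun [set: R] (@erlang R 1) by exact: measurable_erlang.
exact: measurableT_comp me measurable_log_survival.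
Qed.

Lemma phi_weight_ge0 x : 0 <= phi_weight X x.
Proof. by rewrite phi_weightE erlang_ge0// log_survival_ge0. Qed.

Hypothesis HH : Hstar_fun H.

(** Lebesgue measure has increments [H y - H z] along [L o F], so this is
    [increments_moments] for the constant density 1. *)
Lemma integral_log_survival n :
  (\int[mu]_x (erlang n.+1 (tau x))%:E = (rho H n.+1 - rho H n)%:E)%E.
Proof.
rewrite -(increments_moments m1 g1 mtau log_survival_increments (Hstar_erlang HH)).
rewrite [RHS]integral_mkcond; apply: eq_integral => x _.
rewrite patchE mul1r; case: ifPn => // /negP t0.
have -> : tau x = 0.
  apply/eqP; rewrite eq_le log_survival_ge0 andbT leNgt; apply/negP => t1.
  by apply: t0; rewrite inE.
by rewrite /erlang expr0n !mul0r.
Qed.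

Local Notation c := (rho H 1 - rho H 0).

Lemma integral_phi_weight : (\int[mu]_x (phi_weight X x)%:E = c%:E)%E.
Proof.
rewrite -(integral_log_survival 0).
by apply: eq_integral => x _; rewrite phi_weightE.
Qed.

Lemma Rintegral_phi_weight : \int[mu]_x phi_weight X x = c.
Proof. by rewrite /Rintegral integral_phi_weight. Qed.

(** The function [H] increases between two positive points, and there
    [erlang 1] is bounded away from 0. *)
Lemma rho_gap_gt0 : 0 < c.
Proof.
have [[x [y [x0 y0 xy]]] Hnd _ _] := HH.
wlog lexy : x y x0 y0 xy / x <= y.
  by move=> W; have [/W|/ltW/W] := leP x y; apply; rewrite // eq_sym.
have Hxy : H x < H y by rewrite lt_neqAle xy Hnd.
have : ((x * expR (- y))%:E * (H y - H x)%:E <= c%:E)%E.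
  rewrite -integral_phi_weight -log_survival_increments// -ge0_integralZl//; last first.
  - by rewrite lee_fin mulr_ge0 ?expR_ge0// ltW.
  - by rewrite log_survival_itv.
  apply: (@le_trans _ _ (\int[mu]_(t in [set t | (x <= tau t < y)%R]) (phi_weight X t)%:E)%E).
    apply: ge0_le_integral => //.
    - by rewrite log_survival_itv.
    - by move=> t _; rewrite mule1 lee_fin mulr_ge0 ?expR_ge0// ltW.
    - by apply: measurable_funTS; apply/measurable_EFinP; exact: measurable_phi_weight.
    - move=> t /= /andP[xt ty]; rewrite mule1 lee_fin phi_weightE /erlang expr1 factS fact0 divr1.
      by rewrite ler_pM ?(ltW x0) ?expR_ge0// ler_expR lerN2 ltW.
  apply: ge0_subset_integral => //.
  - by rewrite log_survival_itv.
  - by apply/measurable_EFinP; exact: measurable_phi_weight.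
  - by move=> t _; rewrite lee_fin phi_weight_ge0.
rewrite -EFinM lee_fin; apply: lt_le_trans.
by rewrite mulr_gt0 ?subr_gt0// mulr_gt0// expR_gt0.
Qed.

Lemma phi_densityE x : phi_density X x = erlang 1 (tau x) / c.
Proof. by rewrite /phi_density Rintegral_phi_weight phi_weightE. Qed.

Let mdens : measurable_fun [set: measurableTypeR R] (phi_density X).
Proof. by apply: measurable_funM => //; exact: measurable_phi_weight. Qed.

Let dens_ge0 (x : measurableTypeR R) : 0 <= phi_density X x.
Proof. by rewrite phi_densityE divr_ge0 ?(ltW rho_gap_gt0)// erlang_ge0// log_survival_ge0. Qed.

Let dens1 : (\int[mu]_x (phi_density X x)%:E = 1%:E)%E.
Proof.
rewrite (_ : (\int[_]_(_ in _) _)%E = \int[mu]_x ((phi_weight X x)%:E * c^-1%:E))%E; last first.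
  by apply: eq_integral => x _; rewrite /phi_density Rintegral_phi_weight EFinM.
rewrite ge0_integralZr//.
- by rewrite integral_phi_weight -EFinM divff// gt_eqF// rho_gap_gt0.
- by apply/measurable_EFinP; exact: measurable_phi_weight.
- by move=> x _; rewrite lee_fin phi_weight_ge0.
- by rewrite lee_fin invr_ge0 ltW// rho_gap_gt0.
Qed.

Let tauR : measurableTypeR R -> measurableTypeR R := tau.

HB.instance Definition _ :=
  @isMeasurableFun.Build _ _ _ _ tauR mtau.

Lemma is_phi_exists : exists T : law R, is_phi X T.
Proof.
pose V : law R := @density_law _ (measurableTypeR R) R mu (phi_density X) mdens dens_ge0 dens1.
by exists (distribution V tauR); exists V.
Qed.

Section moments.
Variable T : law R.
Hypothesis XT : is_phi X T.

Lemma ge0_integral_phi (f : R -> \bar R) : measurable_fun [set: R] f ->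
  (forall x, 0 <= f x)%E ->
  (\int[T]_t f t = \int[mu]_x (f (tau x) * (phi_density X x)%:E))%E.
Proof.
have [V [VE TE]] := XT => mf f0.
rewrite (eq_measure_integral (distribution V tauR)); last by move=> A mA _; exact: TE.
rewrite ge0_integral_distribution//.
apply: (@ge0_integral_density _ _ _ mu V (phi_density X)) => //.
  exact: (measurableT_comp mf mtau).
by move=> x; exact: f0.
Qed.

Let erlangXdens n x : tau x ^+ n * phi_density X x =
  erlang n.+1 (tau x) * ((n.+1)`!%:R / c).
Proof.
rewrite phi_densityE /erlang expr1 factS fact0 divr1 exprSr.
have n0 : (n.+1)`!%:R != 0 :> R by rewrite pnatr_eq0 -lt0n fact_gt0.
have c0 : c != 0 by rewrite gt_eqF// rho_gap_gt0.
by field; rewrite c0 n0.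
Qed.

Let c0 : c != 0. Proof. by rewrite gt_eqF// rho_gap_gt0. Qed.

Let integral_erlangXdens n : (\int[mu]_x (tau x ^+ n * phi_density X x)%:E =
  ((rho H n.+1 - rho H n) * ((n.+1)`!%:R / c))%:E)%E.
Proof.
under eq_integral do rewrite erlangXdens EFinM.
rewrite ge0_integralZr//.
- by rewrite integral_log_survival -EFinM.
- apply/measurable_EFinP.
  have me : measurable_fun [set: R] (@erlang R n.+1) by exact: measurable_erlang.
  exact: measurableT_comp me measurable_log_survival.
- by move=> x _; rewrite lee_fin erlang_ge0// log_survival_ge0.
- by rewrite lee_fin divr_ge0// ltW// rho_gap_gt0.
Qed.

Let abs_phi_moment n : (\int[T]_t `|(t ^+ n)%:E| =
  ((rho H n.+1 - rho H n) * ((n.+1)`!%:R / c))%:E)%E.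
Proof.
rewrite (ge0_integral_phi (f := fun t => `|(t ^+ n)%:E|%E)).
- rewrite -integral_erlangXdens; apply: eq_integral => x _.
  by rewrite gee0_abs// lee_fin exprn_ge0// log_survival_ge0.
- apply: measurableT_comp => //; apply/measurable_EFinP; exact: measurable_funX.
- by [].
Qed.

Lemma phi_moment n : (\int[T]_t (t ^+ n)%:E =
  ((rho H n.+1 - rho H n) * ((n.+1)`!%:R / c))%:E)%E.
Proof.
have mX : measurable_fun [set: R] (fun t : R => (t ^+ n)%:E).
  by apply/measurable_EFinP; exact: measurable_funX.
rewrite integralE (ge0_integral_phi (f := (fun t => (t ^+ n)%:E)^\+)%E)//; last first.
  exact: measurable_funepos.
rewrite (ge0_integral_phi (f := (fun t => (t ^+ n)%:E)^\-)%E)//; last first.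
  exact: measurable_funeneg.
rewrite -integral_erlangXdens [X in (_ - X)%E]integral0_eq ?sube0; last first.
  move=> x _; rewrite funenegE max_r ?mul0e// leeNl oppe0 lee_fin.
  by rewrite exprn_ge0// log_survival_ge0.
apply: eq_integral => x _; rewrite funeposE max_l ?EFinM// lee_fin.
by rewrite exprn_ge0// log_survival_ge0.
Qed.

(** The density of [V] vanishes where [L(F x) = 0], so [T] has no mass at 0. *)
Lemma phi_calT : calT T.
Proof.
split; last first.
  move=> n; apply/integrableP; split.
    by apply/measurable_EFinP; exact: measurable_funX.
  by rewrite abs_phi_moment ltry.
have -> : T `]0, +oo[%classic = (\int[T]_t (\1_(`]0%R, +oo[%classic : set R) t)%:E)%E.
  by rewrite integral_indic// setIT.
rewrite (ge0_integral_phi (f := fun t => (\1_(`]0%R, +oo[%classic : set R) t)%:E)).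
- rewrite -dens1; apply: eq_integral => x _.
  rewrite indicE mem_setE in_itv/= andbT.
  have [t0|t0] := ltP 0 (tau x); first by rewrite mul1e.
  have tx : tau x = 0 by apply/eqP; rewrite eq_le t0 log_survival_ge0.
  by rewrite mul0e phi_densityE tx /erlang expr1 !mul0r.
- by apply/measurable_EFinP; exact: measurable_indic.
- by move=> t; rewrite lee_fin.
Qed.

Lemma phi_records_moments n :
  (rho H n.+1 - rho H n) / (rho H 1 - rho H 0) = moment T n / (n.+1)`!%:R.
Proof.
rewrite /moment phi_moment/=.
have n0 : (n.+1)`!%:R != 0 :> R by rewrite pnatr_eq0 -lt0n fact_gt0.
by field; rewrite c0 n0.
Qed.

(** The factor [e^t / t] cancels the weight [erlang 1 t] in the law of [T]. *)
Lemma phi_increments z y : 0 < z -> z <= y ->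
  (\int[T]_(t in [set t | (z <= t < y)%R]) (inv_erlang1 t)%:E =
   ((H y - H z) / c)%:E)%E.
Proof.
move=> z0 zy.
have mD : measurable [set t : measurableTypeR R | z <= t < y].
  rewrite (_ : [set t | _] = `[z, y[%classic); first exact: measurable_itv.
  by apply/seteqP; split=> t /=; rewrite in_itv.
rewrite integral_mkcond ge0_integral_phi//; last 2 first.
- apply/measurable_restrict => //; rewrite setTI; apply: measurable_funTS.
  by apply/measurable_EFinP; exact: measurable_inv_erlang1.
- by apply: erestrict_ge0 => t _; rewrite lee_fin inv_erlang1_ge0.
rewrite EFinM -(log_survival_increments z0 zy) -ge0_integralZr//; last 2 first.
- by rewrite log_survival_itv.
- by rewrite lee_fin invr_ge0 ltW// rho_gap_gt0.
rewrite [RHS]integral_mkcond; apply: eq_integral => x _.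
rewrite !patchE.
have -> : (tau x \in [set t | z <= t < y]) = (x \in [set x | z <= tau x < y]).
  by apply/idP/idP; rewrite !inE.
case: ifPn => [|_]; last by rewrite mul0e.
rewrite inE/= => /andP[zt _]; have t0 : 0 < tau x by rewrite (lt_le_trans z0).
rewrite mul1e -EFinM phi_densityE mulrA inv_erlang1_erlang//.
by rewrite expr0 factS fact0 divr1 mul1r.
Qed.

End moments.

End phi.

(** * Integration by parts against a law *)

Lemma itv_co_set (R : realType) (z y : R) : [set t | z <= t < y] = `[z, y[%classic.
Proof. by apply/seteqP; split=> t /=; rewrite in_itv. Qed.

Section by_parts.
Context (R : realType) (T : law R).
Local Notation mu := (@lebesgue_measure R).
Local Notation F := (distr_fun T).
Local Notation FL := (distr_fun_left T).

Lemma law_itv_co z y : z <= y -> T `[z, y[%classic = (FL y - FL z)%:E.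
Proof.
move=> zy; rewrite EFinB -!distr_fun_leftE.
rewrite (_ : `[z, y[%classic = `]-oo, y[ `\` `]-oo, z[).
  rewrite measureD//; last by rewrite -ge0_fin_numE// fin_num_measure.
  by rewrite setIidr//; exact: subset_itvl.
apply/seteqP; split=> t /=; rewrite !in_itv/=.
  by move=> /andP[zt ->]; split=> //; rewrite ltNge zt.
by move=> [-> /negP]; rewrite -leNgt => ->.
Qed.

Lemma law_itv_cc z y : z <= y -> T `[z, y]%classic = (F y - FL z)%:E.
Proof.
move=> zy; rewrite EFinB -distr_funE -distr_fun_leftE.
rewrite (_ : `[z, y]%classic = `]-oo, y] `\` `]-oo, z[).
  rewrite measureD//; last by rewrite -ge0_fin_numE// fin_num_measure.
  by rewrite setIidr//; exact: subset_itvl.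
apply/seteqP; split=> t /=; rewrite !in_itv/=.
  by move=> /andP[zt ->]; split=> //; rewrite ltNge zt.
by move=> [-> /negP]; rewrite -leNgt => ->.
Qed.

Variables (psi Psi : R -> R) (z y : R).
Hypotheses (zy : z <= y)
  (dPsi : forall x, z <= x <= y -> is_derive x 1 Psi (psi x))
  (cpsi : forall x, z <= x <= y -> {for x, continuous psi})
  (psi0 : forall x, z <= x <= y -> 0 <= psi x).

Let mpsi : measurable_fun (`[z, y]%classic : set R) psi.
Proof.
apply: subspace_continuous_measurable_fun => //.
by apply: continuous_in_subspaceT => x; rewrite inE/= in_itv/=; exact: cpsi.
Qed.

Let cPsi : {within `[z, y], continuous Psi}.
Proof.
apply: continuous_in_subspaceT => x; rewrite inE/= in_itv/= => zxy.
apply: differentiable_continuous; apply/derivable1_diffP.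
have H := dPsi zxy; exact: ex_derive.
Qed.

Let mPsi : measurable_fun (`[z, y]%classic : set R) Psi.
Proof. exact: subspace_continuous_measurable_fun. Qed.

Let sub_co : (`[z, y[%classic : set R) `<=` `[z, y].
Proof. by move=> t; rewrite /= !in_itv/= => /andP[-> /ltW]. Qed.

Let q : R -> R := psi \_ `[z, y[.

Let mq : measurable_fun [set: R] q.
Proof.
apply/measurable_restrict => //; rewrite setTI.
exact: measurable_funS mpsi.
Qed.

Let q0 x : 0 <= q x.
Proof. by apply: restrict_ge0 => {}x /sub_co; rewrite /= in_itv/=; exact: psi0. Qed.

Let integral_psi t : z <= t <= y ->
  (\int[mu]_(x in `[t, y[) (psi x)%:E = (Psi y - Psi t)%:E)%E.
Proof.
move=> /andP[zt ty].
rewrite integral_itv_bndo_bndc; last first.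
  apply/measurable_EFinP; apply: measurable_funS mpsi => //.
  by move=> x; rewrite /= !in_itv/= => /andP[tx /ltW ->]; rewrite (le_trans zt).
apply: integral_is_derive => // x /andP[tx xy].
- by apply: dPsi; rewrite (le_trans zt).
- by apply: cpsi; rewrite (le_trans zt).
Qed.

(** Both sides integrate [psi s] over the region [z <= t <= s < y]. *)
Lemma integral_by_parts_tonelli :
  (\int[T]_(t in `[z, y[) (Psi y - Psi t)%:E =
   \int[mu]_(s in `[z, y[) (psi s * (F s - FL z))%:E)%E.
Proof.
pose E := [set x : measurableTypeR R * measurableTypeR R | z <= x.1 <= x.2].
have mE : measurable E.
  rewrite (_ : E = ~` [set x : measurableTypeR R * measurableTypeR R | x.1 < z] `&`
     ~` [set x : measurableTypeR R * measurableTypeR R | x.2 < x.1]); last first.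
    apply/seteqP; split=> x; rewrite /E/=.
      by move=> /andP[zx x12]; split; apply/negP; rewrite -leNgt.
    by move=> [/negP + /negP]; rewrite -!leNgt => -> ->.
  by apply: measurableI; apply: measurableC; exact: measurable_lt_set.
have := @tonelli_section _ (measurableTypeR R) R T (fun=> 1) _ _ E q mE mq q0.
move=> /(_ (measurable_cst _) (fun=> ler01)) TE.
transitivity (\int[T]_t (1%:E * \int[mu]_(x in [set x | E (t, x)]) (q x)%:E))%E.
  rewrite integral_mkcond; apply: eq_integral => t _.
  rewrite patchE mem_setE in_itv/= mul1e.
  case: ifPn => [/andP[zt ty]|zty].
    rewrite -integral_psi ?zt ?(ltW ty)//.
    rewrite [LHS]integral_mkcond [RHS]integral_mkcond; apply: eq_integral => x _.
    have xE : (x \in [set x | E (t, x)]) = (t <= x).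
      by apply/idP/idP; rewrite inE /E/= zt.
    rewrite /q !patchE xE !mem_setE !in_itv/=.
    have [tx|tx] := leP t x => //=; rewrite (le_trans zt tx)/=.
    by case: ifP.
  rewrite integral0_eq// => x; rewrite /E/= => /andP[zt tx].
  rewrite /q patchE mem_setE in_itv/= (le_trans zt tx)/=.
  case: ifPn => // xy; move: zty; rewrite zt/= -leNgt => yt.
  by move: (le_lt_trans tx xy); rewrite ltNge yt.
rewrite -TE [RHS]integral_mkcond; apply: eq_integral => s _.
rewrite patchE /q patchE mem_setE in_itv/=; case: ifPn => [/andP[zs sy]|_]; last by rewrite mul0e.
rewrite integral_cst//= ?mul1e; last first.
  rewrite (_ : [set _ | _] = `[z, s]%classic); first exact: measurable_itv.
  by apply/seteqP; split=> t; rewrite /= in_itv.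
rewrite EFinM -law_itv_cc//; congr (_ * T _)%E.
Qed.

Let ipsi : mu.-integrable `[z, y[ (EFin \o psi).
Proof.
apply/integrableP; split.
  apply/measurable_EFinP; exact: measurable_funS mpsi.
rewrite (_ : (\int[_]_(_ in _) _)%E = \int[mu]_(x in `[z, y[) (psi x)%:E)%E.
  by rewrite integral_psi ?lexx// ltry.
by apply: eq_integral => x; rewrite inE => /sub_co/=; rewrite in_itv/= => /psi0 ?; rewrite ger0_norm.
Qed.

Let mF : measurable_fun [set: R] F. Proof. exact: measurable_distr_fun. Qed.

Let ipsiF : mu.-integrable `[z, y[ (EFin \o (fun s => psi s * F s)).
Proof.
apply: le_integrable ipsi => //.
  apply/measurable_EFinP; apply: measurable_funM.
    exact: measurable_funS mpsi.
  exact: measurable_funTS.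
move=> s /sub_co/=; rewrite in_itv/= => /psi0 ps0.
rewrite lee_fin normrM ger0_norm// (ger0_norm (distr_fun_ge0 T s)).
by rewrite ler_piMr// distr_fun_le1.
Qed.

(** Only nonnegative [psi] is treated, so that Tonelli suffices. The product
    involves the left limits of [F], since the point [y] is excluded and [z]
    is included. *)
Lemma integral_by_parts_law :
  (\int[T]_(t in `[z, y[) (Psi t)%:E =
   (Psi y * FL y - Psi z * FL z - \int[mu]_(s in `[z, y]) (psi s * F s))%:E)%E.
Proof.
have iFL : mu.-integrable `[z, y[ (EFin \o (fun s => psi s * FL z)).
  by apply: eq_integrable (integrableZr _ (FL z) ipsi) => // s _; rewrite /= EFinM.
pose I := \int[mu]_(s in `[z, y]) (psi s * F s).
have IE : (\int[mu]_(s in `[z, y[) (psi s * F s)%:E = I%:E)%E.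
  rewrite /I /Rintegral -integral_itv_bndo_bndc; last first.
    by apply/measurable_EFinP; case/integrableP : ipsiF => /measurable_EFinP.
  by rewrite fineK//; exact: integrable_fin_num ipsiF.
have rhsE : (\int[mu]_(s in `[z, y[) (psi s * (F s - FL z))%:E =
    (I - (Psi y - Psi z) * FL z)%:E)%E.
  under eq_integral do rewrite mulrBr EFinB.
  rewrite (integralB_EFin _ ipsiF iFL)// IE EFinB; congr (_ - _)%E.
  under eq_integral do rewrite EFinM.
  by rewrite (integralZr _ ipsi)// integral_psi ?lexx ?zy// -EFinM.
have mPsico : measurable_fun (`[z, y[%classic : set R) Psi.
  exact: measurable_funS mPsi.
have Psi_le t : z <= t < y -> Psi t <= Psi y.
  move=> /andP[zt ty]; rewrite -subr_ge0 -lee_fin -integral_psi; last first.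
    by rewrite zt ltW.
  apply: integral_ge0 => x; rewrite /= in_itv/= => /andP[tx xy].
  by rewrite lee_fin psi0// (le_trans zt tx) ltW.
have iD : T.-integrable `[z, y[ (EFin \o (fun t => Psi y - Psi t)).
  apply/integrableP; split.
    by apply/measurable_EFinP; exact: measurable_funB.
  rewrite (_ : (\int[_]_(_ in _) _)%E = \int[T]_(t in `[z, y[) (Psi y - Psi t)%:E)%E.
    by rewrite integral_by_parts_tonelli rhsE ltry.
  apply: eq_integral => t; rewrite inE/= in_itv/= => zty.
  by rewrite ger0_norm// subr_ge0 Psi_le.
have ic : T.-integrable `[z, y[ (EFin \o (cst (Psi y))).
  by apply: finite_measure_integrable_cst.
have -> : (\int[T]_(t in `[z, y[) (Psi t)%:E =
    \int[T]_(t in `[z, y[) ((Psi y)%:E - (Psi y - Psi t)%:E))%E.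
  by apply: eq_integral => t _; rewrite -EFinB subKr.
rewrite (integralB_EFin _ ic iD)// integral_by_parts_tonelli rhsE.
have -> : (\int[T]_(t in `[z, y[) (cst (Psi y) t)%:E = (Psi y * (FL y - FL z))%:E)%E.
  transitivity (\int[T]_(t in `[z, y[) (cst (Psi y)%:E t))%E => //.
  by rewrite integral_cst//= EFinM -law_itv_co.
by rewrite -EFinB -/I; congr EFin; ring.
Qed.

End by_parts.

(** * The inverse map *)

Section phi_inv.
Context (R : realType) (T : law R).
Local Notation mu := (@lebesgue_measure R).
Local Notation F := (distr_fun T).
Local Notation FL := (distr_fun_left T).

Let dw (x : R) : R := (x - 1) / x ^+ 2 * expR x.

Let is_derive_w (x : R) : 0 < x -> is_derive x 1 (fun t : R => expR t / t) (dw x).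
Proof.
move=> x0; have xn0 : x != 0 by rewrite gt_eqF.
have dV : is_derive x 1 (fun t : R => t^-1) (- x ^- 2).
  apply: DeriveDef; first exact: (@derivableV _ _ id).
  by rewrite (@deriveV _ _ id)// derive_id /GRing.scale/= mulr1.
rewrite (_ : (fun t => _) = expR * (fun t : R => t^-1)); last exact/funext.
apply: is_derive_eq; rewrite /GRing.scale/= /dw; field.
exact: xn0.
Qed.

Let c_dw (x : R) : 0 < x -> {for x, continuous dw}.
Proof.
move=> x0; apply: cvgM; last exact: continuous_expR.
apply: cvgM; first by apply: cvgB; [exact: cvg_id|exact: cvg_cst].
apply: cvgV; first by rewrite expf_neq0// gt_eqF.
exact: exprn_continuous.
Qed.

Variable c : R.
Local Notation P := (phi_inv_fun T c).

Let P1 : P 1 = expR 1 * FL 1 - c.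
Proof.
rewrite /phi_inv_fun divr1 /oriented_integral lexx set_itv1.
by rewrite /Rintegral integral_set1 subr0.
Qed.

Let above1 y : 1 <= y ->
  (\int[T]_(t in `[1%R, y[) (inv_erlang1 t)%:E = (P y - P 1)%:E)%E.
Proof.
move=> y1; transitivity (\int[T]_(t in `[1%R, y[) (expR t / t)%:E)%E.
  apply: eq_integral => t; rewrite inE/= in_itv/= => /andP[t1 _].
  by rewrite inv_erlang1E// (lt_le_trans _ t1).
have dF x : 1 <= x <= y -> is_derive x 1 (fun t : R => expR t / t) (dw x).
  by move=> /andP[x1 _]; apply: is_derive_w; rewrite (lt_le_trans _ x1).
have cF x : 1 <= x <= y -> {for x, continuous dw}.
  by move=> /andP[x1 _]; apply: c_dw; rewrite (lt_le_trans _ x1).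
have F0 x : 1 <= x <= y -> 0 <= dw x.
  by move=> /andP[x1 _]; rewrite mulr_ge0 ?expR_ge0// divr_ge0 ?subr_ge0// sqr_ge0.
rewrite (integral_by_parts_law T y1 dF cF F0); congr EFin.
by rewrite P1 /phi_inv_fun /oriented_integral y1 divr1 -/dw; ring.
Qed.

Let below1 y : 0 < y -> y <= 1 ->
  (\int[T]_(t in `[y, 1%R[) (inv_erlang1 t)%:E = (P 1 - P y)%:E)%E.
Proof.
move=> y0 y1.
have dF x : y <= x <= 1 -> is_derive x 1 (- (fun t : R => expR t / t)) (- dw x).
  move=> /andP[yx _]; have H := is_derive_w (lt_le_trans y0 yx); exact: is_deriveN.
have cF x : y <= x <= 1 -> {for x, continuous (- dw)}.
  by move=> /andP[yx _]; apply: cvgN; apply: c_dw; rewrite (lt_le_trans y0).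
have F0 x : y <= x <= 1 -> 0 <= - dw x.
  move=> /andP[yx x1]; rewrite oppr_ge0 /dw -mulrA mulr_le0_ge0 ?subr_le0//.
  by rewrite mulr_ge0 ?expR_ge0// invr_ge0 sqr_ge0.
have := integral_by_parts_law T y1 dF cF F0 => IE.
have wE : (\int[T]_(t in `[y, 1%R[) ((- (fun t : R => expR t / t)) t)%:E =
    - \int[T]_(t in `[y, 1%R[) (inv_erlang1 t)%:E)%E.
  rewrite -integral_ge0N; last by move=> t _; rewrite lee_fin inv_erlang1_ge0.
  apply: eq_integral => t; rewrite inE/= in_itv/= => /andP[yt _].
  by rewrite inv_erlang1E// (lt_le_trans _ yt).
have RN : \int[mu]_(s in `[y, 1]) ((- dw) s * F s) = - \int[mu]_(s in `[y, 1]) (dw s * F s).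
  rewrite /Rintegral -[LHS]opprK -fineN -integral_ge0N.
    congr (- fine _); apply: eq_integral => s _.
    by rewrite -EFinN -mulNr opprK.
  move=> s; rewrite /= in_itv/= => ys1; rewrite lee_fin mulr_ge0 ?F0//.
  exact: distr_fun_ge0.
move: IE; rewrite wE RN => /eqP; rewrite eqe_oppLR => /eqP ->.
rewrite -EFinN; congr EFin; rewrite P1 /phi_inv_fun /oriented_integral.
have [y1'|y1'] := leP 1 y.
  have -> : y = 1 by apply/eqP; rewrite eq_le y1 y1'.
  by rewrite set_itv1 /Rintegral !integral_set1/= divr1; ring.
by rewrite !fctE/= divr1; set I := \int[_]_(_ in _) _; ring.
Qed.

(** The derivative [(x - 1) e^x / x^2] of [e^x / x] changes sign at 1, which
    is why the interval is cut there and the integral in the definition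
    starts from 1. *)
Lemma phi_inv_increments z y : 0 < z -> z <= y ->
  (\int[T]_(t in [set t | (z <= t < y)%R]) (inv_erlang1 t)%:E = (P y - P z)%:E)%E.
Proof.
move=> z0 zy; rewrite itv_co_set.
have mw D : measurable_fun D (fun t : measurableTypeR R => (inv_erlang1 t)%:E).
  by apply: measurable_funTS; apply/measurable_EFinP; exact: measurable_inv_erlang1.
have split a b e : a <= b -> b <= e ->
    (\int[T]_(t in `[a, e[) (inv_erlang1 t)%:E =
     \int[T]_(t in `[a, b[) (inv_erlang1 t)%:E + \int[T]_(t in `[b, e[) (inv_erlang1 t)%:E)%E.
  move=> ab be; rewrite -ge0_integral_setU//.
  - congr (integral _ _ _); apply/seteqP; split=> t /=; rewrite !in_itv/=.
      by move=> /andP[-> ->]; rewrite andbT; case: (ltP t b); [left|right].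
    by case=> /andP[tl tr]; [rewrite tl (lt_le_trans tr)|rewrite tr (le_trans ab)].
  - by move=> t _; rewrite lee_fin inv_erlang1_ge0.
  - apply/disj_setPS => t [] /=; rewrite !in_itv/= => /andP[_ tb] /andP[bt _].
    by move: (lt_le_trans tb bt); rewrite ltxx.
have [z1|z1] := leP 1 z.
  have H1 := above1 (le_trans z1 zy); have H2 := above1 z1.
  move: (split _ _ _ z1 zy); rewrite H1 H2; case: (\int[T]_(t in _) _)%E => //= r [E].
  by congr EFin; rewrite -(subrK (P 1) (P y)) E; ring.
have [y1|y1] := leP 1 y.
  rewrite (split _ _ _ (ltW z1) y1) (below1 z0 (ltW z1)) (above1 y1).
  by rewrite -EFinD; congr EFin; ring.
have y0 : 0 < y by exact: lt_le_trans zy.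
have H1 := below1 z0 (ltW z1); have H2 := below1 y0 (ltW y1).
move: (split _ _ _ zy (ltW y1)); rewrite H1 H2; case: (\int[T]_(t in _) _)%E => //= r [E].
have -> : r = P 1 - P z - (P 1 - P y) by rewrite E addrK.
by congr EFin; ring.
Qed.

End phi_inv.

Section distr_fun_left.
Context (R : realType) (T : law R).
Local Notation FL := (distr_fun_left T).

Lemma distr_fun_left_nd x y : x <= y -> FL x <= FL y.
Proof.
by move=> xy; rewrite -subr_ge0 -lee_fin -law_itv_co.
Qed.

Lemma cvg_distr_fun_left (y : R) : FL x @[x --> y^'-] --> FL y.
Proof.
pose A n := (`]-oo, y - n.+1%:R^-1[%classic : set (measurableTypeR R)).
have ndA : nondecreasing_seq A.
  move=> n m nm; apply/subsetPset => t; rewrite /A/= !in_itv/= => /lt_le_trans; apply.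
  by rewrite lerD2l lerN2 lef_pV2 ?posrE// ler_nat.
have UA : \bigcup_n A n = `]-oo, y[%classic.
  apply/seteqP; split=> t /=.
    move=> [n _]; rewrite /A/= !in_itv/= => /lt_trans; apply.
    by rewrite gtrBl invr_gt0.
  rewrite in_itv/= => ty.
  have yt0 : 0 < y - t by rewrite subr_gt0.
  have [n nE] := ltr_add_invr ty.
  exists n => //; rewrite /A/= in_itv/= ltrBrDr.
  exact: nE.
have : T (A n) @[n --> \oo] --> T (\bigcup_n A n).
  apply: nondecreasing_cvg_mu => //; last by rewrite UA; exact: measurable_itv.
  by move=> n; exact: measurable_itv.
rewrite UA distr_fun_leftE => /fine_cvgP[_ FA].
apply/cvgrPdist_le => e e0.
move/cvgrPdist_le : FA => /(_ e e0)[N _ /(_ N (leqnn N))] /=.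
rewrite -/(distr_fun_left T (y - N.+1%:R^-1)) => FN.
near=> x.
have xy : x < y by near: x; exact: nbhs_left_lt.
have Nx : y - N.+1%:R^-1 <= x by near: x; apply: nbhs_left_ge; rewrite gtrBl invr_gt0.
apply: le_trans FN; rewrite !ger0_norm ?subr_ge0 ?distr_fun_left_nd ?(ltW xy)//.
  by rewrite lerD2l lerN2 distr_fun_left_nd.
by rewrite gerBl invr_ge0.
Unshelve. all: by end_near. Qed.

End distr_fun_left.

Section phi_inv_Hstar.
Context (R : realType) (T : law R).
Hypothesis hT : calT T.
Variable c : R.
Local Notation mu := (@lebesgue_measure R).
Local Notation P := (phi_inv_fun T c).

Let mw : measurable_fun [set: measurableTypeR R] (@inv_erlang1 R).
Proof. exact: measurable_inv_erlang1. Qed.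
Let mid : measurable_fun [set: measurableTypeR R] (fun t : measurableTypeR R => t : R).
Proof. exact: measurable_id. Qed.
Let w0 (t : measurableTypeR R) : 0 <= inv_erlang1 t.
Proof. exact: inv_erlang1_ge0. Qed.

Let Pinc := @phi_inv_increments R T c.

Lemma phi_inv_nd x y : 0 < x -> x <= y -> P x <= P y.
Proof. exact: (increments_nd w0 Pinc). Qed.

Let CE n : (\int[T]_(s in [set s | (0 < s)%R]) (inv_erlang1 s * erlang n.+1 s)%:E =
  \int[T]_(s in `]0%R, +oo[) (s ^+ n / (n.+1)`!%:R)%:E)%E.
Proof.
rewrite (_ : [set s | 0 < s] = `]0, +oo[%classic); last first.
  by apply/seteqP; split=> t /=; rewrite in_itv/= andbT.
apply: eq_integral => s; rewrite inE/= in_itv/= andbT => s0.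
by rewrite inv_erlang1_erlang.
Qed.

(** The integral of [erlang (n+1)] against the increments is the moment of
    order [n] of [T], divided by [(n+1)!]. *)
Lemma phi_inv_erlang_lty n :
  (\int[mu]_(y in `]0%R, +oo[) (erlang n y * `|P y|)%:E < +oo)%E.
Proof.
apply: (increments_integrable mw w0 mid Pinc) => {}n.
rewrite CE; have [_ /(_ n) iX] := hT.
have /integrableP[_] : T.-integrable `]0, +oo[ (fun x : R => (x ^+ n)%:E).
  exact: integrableS iX.
apply: le_lt_trans; apply: ge0_le_integral => //.
- by move=> s; rewrite /= in_itv/= andbT => s0; rewrite lee_fin divr_ge0// exprn_ge0// ltW.
- apply/measurable_EFinP; apply: measurable_funM => //; apply: measurable_funTS; exact: measurable_funX.
- apply: measurableT_comp => //; apply/measurable_EFinP; apply: measurable_funTS; exact: measurable_funX.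
- move=> s; rewrite /= in_itv/= andbT => s0.
  rewrite lee_fin (ger0_norm (exprn_ge0 n (ltW s0))) ler_pdivrMr ?ltr0n ?fact_gt0//.
  by apply: ler_peMr; [rewrite exprn_ge0// ltW|rewrite ler1n fact_gt0].
Qed.

(** The integral of [erlang 1 t * e^t / t = 1] against [T]. *)
Lemma phi_inv_gap : rho P 1 - rho P 0 = 1.
Proof.
have [T0 _] := hT; apply: EFin_inj.
rewrite -(increments_moments mw w0 mid Pinc phi_inv_erlang_lty 0) CE.
rewrite (eq_integral (cst 1%E)); first by rewrite integral_cst//= mul1e; exact: T0.
by move=> s _; rewrite expr0 factS fact0 divr1.
Qed.

(** An increment over [x, y) is at most a constant times the mass of [x, y),
    which tends to 0 as [x] increases to [y]. *)
Lemma phi_inv_left_cvg y : 0 < y -> P x @[x --> y^'-] --> P y.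
Proof.
move=> y0; have y20 : 0 < y / 2 by rewrite divr_gt0.
have y2y : y / 2 < y by rewrite ltr_pdivrMr// ltr_pMr// ltr1n.
pose M := expR y / (y / 2).
have M0 : 0 < M by rewrite divr_gt0// expR_gt0.
have Pdiff x : y / 2 <= x -> x <= y ->
    P y - P x <= M * (distr_fun_left T y - distr_fun_left T x).
  move=> yx xy; have x0 : 0 < x by exact: lt_le_trans yx.
  rewrite -lee_fin -(Pinc x0 xy) itv_co_set EFinM -law_itv_co//.
  rewrite -integral_cst//; apply: ge0_le_integral => //.
  - by move=> t _; rewrite lee_fin inv_erlang1_ge0.
  - by apply: measurable_funTS; apply/measurable_EFinP; exact: measurable_inv_erlang1.
  - move=> t; rewrite /= in_itv/= => /andP[xt ty].
    have t0 : 0 < t by exact: lt_le_trans xt.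
    rewrite lee_fin inv_erlang1E// /M ler_pM ?expR_ge0 ?invr_ge0 ?(ltW t0)//.
      by rewrite ler_expR ltW.
    by rewrite lef_pV2 ?posrE// (le_trans yx).
apply/cvgrPdist_le => e e0.
have eM : 0 < e / M by rewrite divr_gt0.
near=> x.
have xy : x < y by near: x; exact: nbhs_left_lt.
have yx : y / 2 <= x by near: x; exact: nbhs_left_ge.
rewrite ger0_norm; last by rewrite subr_ge0 phi_inv_nd ?(ltW xy)// (lt_le_trans y20).
apply: le_trans (Pdiff _ yx (ltW xy)) _.
rewrite mulrC -ler_pdivlMr//.
have : `|distr_fun_left T y - distr_fun_left T x| <= e / M.
  near: x; have /cvgrPdist_le := @cvg_distr_fun_left _ T y; exact.
by apply: le_trans; exact: ler_norm.
Unshelve. all: by end_near. Qed.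

(** A constant function would have a constant sequence [rho], against the
    gap of 1. *)
Lemma phi_inv_Hstar : Hstar_fun P.
Proof.
split.
- apply: contrapT => nP.
  have Pc y : 0 < y -> P y = P 1.
    move=> y0; apply/eqP; apply: contrapT => /negP Py; apply: nP.
    by exists y, 1; split.
  have rhoc n : rho P n = P 1.
    rewrite /rho (_ : (\int[_]_(_ in _) _)%E = (\int[mu]_(y in `]0%R, +oo[) ((P 1)%:E * (erlang n y)%:E))%E).
      by rewrite (integralZl _ (integrable_erlang R n))// integral_erlang mule1.
    apply: eq_integral => y; rewrite inE/= in_itv/= andbT => y0.
    by rewrite Pc// -EFinM mulrC.
  by have := phi_inv_gap; rewrite !rhoc subrr => /eqP; rewrite eq_sym oner_eq0.
- exact: phi_inv_nd.
- exact: phi_inv_left_cvg.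
- move=> m; rewrite (_ : (\int[_]_(_ in _) _)%E =
      ((m`!%:R)%:E * \int[mu]_(y in `]0%R, +oo[) (erlang m y * `|P y|)%:E)%E).
    by rewrite lte_mul_pinfty// ?lee_fin// phi_inv_erlang_lty.
  rewrite -ge0_integralZl//.
  + apply: eq_integral => y _; rewrite -EFinM; congr EFin; rewrite /erlang.
    by field; rewrite pnatr_eq0 -lt0n fact_gt0.
  + apply/measurable_EFinP; apply: measurable_funM.
      by apply: measurable_funTS; exact: measurable_erlang.
    by apply: measurableT_comp => //; exact: (measurable_increments w0 Pinc).
  + move=> y; rewrite /= in_itv/= andbT => y0.
    by rewrite lee_fin mulr_ge0// erlang_ge0// ltW.
Qed.

End phi_inv_Hstar.

(** * Existence of the image of the inverse map *)

Lemma uniform_itvcy1 (R : realType) : uniform_prob (@ltr01 R) `[1, +oo[%classic = 0%E.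
Proof.
rewrite /= /uniform_prob integral_uniform_pdf.
rewrite (_ : _ `&` _ = [set 1]) ?integral_set1//.
apply/seteqP; split=> y /=; rewrite !in_itv/= ?andbT.
  by move=> [y1 /andP[_ y1']]; apply/eqP; rewrite eq_le y1 y1'.
by move=> ->; rewrite lexx ler01.
Qed.

Section law_of_quantile.
Context (R : realType) (H : R -> R).
Hypothesis Hnd : forall x y, 0 < x -> x <= y -> H x <= H y.
Hypothesis Hlc : forall y, 0 < y -> H x @[x --> y^'-] --> H y.
Local Notation unif := (uniform_prob (@ltr01 R)).

Let h : measurableTypeR R -> measurableTypeR R := (H \o @L R) \_ `]0, 1[.

Let L_nd (u v : R) : u <= v -> v < 1 -> L u <= L v.
Proof. by move=> uv v1; rewrite -Linv_le !LK// (le_lt_trans uv). Qed.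

Let mh : measurable_fun [set: measurableTypeR R] h.
Proof.
have mh' : measurable_fun [set: R] ((H \o @L R) \_ `]0, 1[).
  apply/measurable_restrict => //; rewrite setTI.
  apply: measurable_of_itv_homo => u v; rewrite !in_itv/= => u01 /andP[v0 v1] uv.
  by apply: Hnd; [exact: L_gt0|exact: L_nd].
exact: mh'.
Qed.

HB.instance Definition _ := @isMeasurableFun.Build _ _ _ _ h mh.

Let X : law R := distribution unif h.

Let hE u : 0 < u < 1 -> h u = H (L u).
Proof. by move=> u01; rewrite /h patchE mem_setE in_itv/= u01. Qed.

Let distr_X_ge y x : 0 < y -> H y <= x -> Linv y <= distr_fun X x.
Proof.
move=> y0 Hyx; have /andP[u0 u1] := Linv_itv y0.
rewrite -lee_fin -distr_funE -uniform_itvNyc ?(ltW u0) ?(ltW u1)//.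
apply: (@le_trans _ _ (unif `]0, Linv y]%classic)).
  rewrite (_ : `]-oo, Linv y]%classic = `]0, Linv y] `|` `]-oo, 0]); last first.
    apply/seteqP; split=> u; rewrite /= !in_itv/=.
      by move=> ->; rewrite andbT; case: (ltP 0 u); [left|right].
    by case=> [/andP[]//|/le_trans]; apply; exact: ltW.
  rewrite measureU0//; apply: uniform_itvNyc; rewrite lexx ler01//.
apply: le_measure; rewrite ?inE//=.
  by have := mh measurableT (measurable_itv `]-oo, x]); rewrite setTI.
move=> u; rewrite /= !in_itv/= => /andP[u0' uy].
have u1' : u < 1 by exact: le_lt_trans u1.
rewrite hE ?u0' ?u1'//; apply: le_trans Hyx; apply: Hnd; first by rewrite L_gt0// u0'.
by rewrite -Linv_le LK.
Qed.

Let distr_X_lt y x : 0 < y -> x < H y -> distr_fun X x < Linv y.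
Proof.
move=> y0 xHy.
have [y' [y'0 y'y xHy']] : exists y', [/\ 0 < y', y' < y & x < H y'].
  have : \forall t \near y^'-, x < H t by exact: (cvgr_gt _ (Hlc y0)).
  move=> near_x.
  have : \forall t \near y^'-, [/\ 0 < t, t < y & x < H t].
    near=> t; split; near: t => //.
      exact: nbhs_left_gt.
    exact: nbhs_left_lt.
  by move=> /filter_ex[t ?]; exists t.
have /andP[u0 u1] := Linv_itv y'0.
apply: (@le_lt_trans _ _ (Linv y')); last by rewrite Linv_lt.
rewrite -lee_fin -distr_funE -uniform_itvNyc ?(ltW u0) ?(ltW u1)//.
have <- : unif (`]-oo, Linv y'] `|` `[1, +oo[) = unif `]-oo, Linv y']%classic.
  by rewrite measureU0//; exact: uniform_itvcy1.
rewrite -[leLHS]/(unif (h @^-1` `]-oo, x])).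
apply: le_measure; rewrite ?inE//=.
- by have := mh measurableT (measurable_itv `]-oo, x]); rewrite setTI.
- exact: measurableU.
move=> u; rewrite /= !in_itv/= andbT => hux.
have [u1'|u1'] := leP 1 u; [by right|left].
rewrite leNgt; apply/negP => y'u.
have u01 : 0 < u < 1 by rewrite (lt_trans u0).
move: hux; rewrite hE// leNgt => /negP; apply; apply: lt_le_trans xHy' _.
by apply: Hnd => //; rewrite -Linv_le LK// ltW.
Unshelve. all: by end_near. Qed.

(** The law of [H o L] under the uniform law; left continuity makes [H o L]
    coincide with the inverse of the distribution function. *)
Lemma law_of_quantile :
  exists X : law R, forall y, 0 < y -> inv_distr_fun X (Linv y) = H y.
Proof.
exists X => y y0; apply/eqP; rewrite eq_le inv_distr_fun_le ?Linv_itv//.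
rewrite distr_X_ge//= leNgt; apply/negP => GH.
have := distr_X_lt y0 GH; rewrite ltNge => /negP; apply.
by rewrite -inv_distr_fun_le// Linv_itv.
Qed.

End law_of_quantile.

Lemma phi_inv_fun_shift (R : realType) (T : law R) c y :
  phi_inv_fun T c y = phi_inv_fun T 0 y - c.
Proof. by rewrite /phi_inv_fun subr0. Qed.

Section is_phi_inv_exists.
Context (R : realType) (T : law R).
Hypothesis hT : calT T.
Local Notation mu := (@lebesgue_measure R).

(** The constant is [rho H 0] for the function [H] obtained with constant 0. *)
Lemma is_phi_inv_exists : exists X : law R, is_phi_inv T X.
Proof.
pose c := rho (phi_inv_fun T 0) 0.
have Hc := phi_inv_Hstar hT c; have [_ ndP lcP _] := Hc.
have [X XE] := law_of_quantile ndP lcP.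
exists X, c; split; last exact: XE.
rewrite integral_expR_Hstar// (rho_shift (H := phi_inv_fun T 0) (k := - c)).
- by rewrite subrr.
- exact: phi_inv_Hstar.
- by move=> y _; exact: phi_inv_fun_shift.
Qed.

End is_phi_inv_exists.

(** * A law is determined by its increments *)

Lemma law_unique_ge (R : realType) (X Y : law R) :
  (forall x, X `[x, +oo[%classic = Y `[x, +oo[%classic) -> law_eq X Y.
Proof.
move=> XY A mA.
apply: (@measure_unique _ R (measurableTypeR R) (@RGenCInfty.G R)
  (fun n => `[- n%:R, +oo[%classic)) => //.
- exact: RGenCInfty.measurableE.
- move=> _ _ [x ->] [y ->]; exists (Num.max x y).
  by apply/seteqP; split=> t; rewrite /= !in_itv/= !andbT ge_max; [move=> [-> ->]|move/andP].
- by move=> n; exists (- n%:R).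
- apply/seteqP; split=> // t _.
  exists (Num.Def.archi_bound `|t|) => //; rewrite /= in_itv/= andbT lerNl.
  by rewrite (le_trans (ler_norm _))// normrN ltW// archi_boundP.
- by move=> _ [x ->]; exact: XY.
- by move=> k; rewrite -ge0_fin_numE// fin_num_measure.
Qed.

Section increments_determine_law.
Context (R : realType) (T : law R) (H : R -> R).
Hypothesis HE : forall z y : R, 0 < z -> z <= y ->
  (\int[T]_(t in [set t | (z <= t < y)%R]) (inv_erlang1 t)%:E = (H y - H z)%:E)%E.
Local Notation mu := (@lebesgue_measure R).

Section window.
Variables (psi Psi : R -> R) (z y : R).
Hypotheses (z0 : 0 < z)
  (dPsi : forall x, z <= x <= y -> is_derive x 1 Psi (psi x))
  (cpsi : forall x, z <= x <= y -> {for x, continuous psi})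
  (psi0 : forall x, z <= x <= y -> 0 <= psi x).

Let q : R -> R := psi \_ `[z, y[.

Let sub_co : (`[z, y[%classic : set R) `<=` `[z, y].
Proof. by move=> t; rewrite /= !in_itv/= => /andP[-> /ltW]. Qed.

Let mq : measurable_fun [set: R] q.
Proof.
apply/measurable_restrict => //; rewrite setTI.
apply: measurable_funS sub_co _ => //.
apply: subspace_continuous_measurable_fun => //.
by apply: continuous_in_subspaceT => x; rewrite inE/= in_itv/=; exact: cpsi.
Qed.

Let q0 x : 0 <= q x.
Proof. by apply: restrict_ge0 => {}x /sub_co; rewrite /= in_itv/=; exact: psi0. Qed.

(** Both sides integrate [psi s * e^t / t] over the region [z <= s <= t <
    y]. *)
Lemma weighted_increment_by_parts :
  (\int[T]_(t in `[z, y[) (inv_erlang1 t * (Psi t - Psi z))%:E =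
   \int[mu]_(s in `[z, y[) (psi s * (H y - H s))%:E)%E.
Proof.
pose E := [set x : measurableTypeR R * measurableTypeR R | z <= x.2 /\ x.2 <= x.1 < y].
have mE : measurable E.
  rewrite (_ : E = ~` [set x : measurableTypeR R * measurableTypeR R | x.2 < z] `&`
     (~` [set x : measurableTypeR R * measurableTypeR R | x.1 < x.2] `&`
     [set x : measurableTypeR R * measurableTypeR R | x.1 < y])); last first.
    apply/seteqP; split=> x; rewrite /E/=.
      by move=> [zx /andP[x21 ->]]; split; [|split]; rewrite //; apply/negP; rewrite -leNgt.
    by move=> [/negP + [/negP + ->]]; rewrite -!leNgt => -> ->.
  apply: measurableI; first by apply: measurableC; exact: measurable_lt_set.
  apply: measurableI; last exact: measurable_lt_set.
  by apply: measurableC; exact: measurable_lt_set.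
have mw : measurable_fun [set: measurableTypeR R] (@inv_erlang1 R).
  exact: measurable_inv_erlang1.
have := @tonelli_section _ (measurableTypeR R) R T (@inv_erlang1 R) mw (@inv_erlang1_ge0 R) E q mE mq q0.
move=> TE.
transitivity (\int[T]_t ((inv_erlang1 t)%:E * \int[mu]_(x in [set x | E (t, x)]) (q x)%:E))%E.
  rewrite integral_mkcond; apply: eq_integral => t _.
  rewrite patchE mem_setE in_itv/=.
  case: ifPn => [/andP[zt ty]|zty]; last first.
    rewrite (_ : [set x | E (t, x)] = set0) ?integral_set0 ?mule0//.
    apply/seteqP; split=> // x [/= zx /andP[xt ty]].
    by move: zty; rewrite (le_trans zx xt) ty.
  rewrite EFinM; congr (_ * _)%E.
  have dPsit x : z <= x <= t -> is_derive x 1 Psi (psi x).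
    by move=> /andP[zx xt]; apply: dPsi; rewrite zx (le_trans xt)// ltW.
  have cpsit x : z <= x <= t -> {for x, continuous psi}.
    by move=> /andP[zx xt]; apply: cpsi; rewrite zx (le_trans xt)// ltW.
  rewrite -(integral_is_derive zt dPsit cpsit).
  rewrite (_ : [set x | E (t, x)] = `[z, t]%classic); last first.
    by apply/seteqP; split=> x; rewrite /E/= in_itv/= ty andbT; [move=> [-> ->]|move/andP].
  apply: eq_integral => x; rewrite inE/= in_itv/= => /andP[zx xt].
  by rewrite /q patchE mem_setE in_itv/= zx (le_lt_trans xt).
rewrite -TE [RHS]integral_mkcond; apply: eq_integral => s _.
rewrite patchE /q patchE mem_setE in_itv/=; case: ifPn => [/andP[zs sy]|_]; last by rewrite mul0e.
rewrite EFinM -HE ?(lt_le_trans z0 zs) ?(ltW sy)//; congr (_ * integral _ _ _)%E.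
by apply/seteqP; split=> t; rewrite /E/=; [move=> []|].
Qed.

End window.

Let mw (D : set R) : measurable_fun D (@inv_erlang1 R).
Proof. by apply: measurable_funTS; exact: measurable_inv_erlang1. Qed.

Let I z y := (\int[mu]_(s in `[z, y[) (H y - H s)%:E)%E.
Let IE z y : 0 < z -> z <= y ->
  (\int[T]_(t in `[z, y[) (inv_erlang1 t * (t - z))%:E = I z y)%E.
Proof.
move=> z0 zy.
have dF x : z <= x <= y -> is_derive x 1 (@id R) (1 : R) by move=> _; exact: is_derive_id.
have cF x : z <= x <= y -> {for x, continuous (fun=> 1 : R)} by move=> _; exact: cst_continuous.
have F0 x : z <= x <= y -> 0 <= (1 : R) by [].
rewrite (weighted_increment_by_parts (psi := fun=> 1) z0 dF cF F0).
by apply: eq_integral => s _; rewrite mul1r.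
Qed.

Let psi (x : R) : R := (1 - x) * expR (- x) + 1.
Let Psi (x : R) : R := x * expR (- x) + x.

Let dPsi (x : R) : is_derive x 1 Psi (psi x).
Proof.
have H1 := is_derive_erlang 1 x.
rewrite (_ : Psi = erlang 1 + id); last first.
  by apply/funext => t; rewrite /= fctE /Psi /erlang expr1 factS fact0 divr1.
by apply: is_derive_eq; rewrite /psi /erlang expr0 expr1 factS fact0 !divr1; ring.
Qed.

Let cpsi (x : R) : {for x, continuous psi}.
Proof.
apply: cvgD; last exact: cvg_cst.
apply: cvgM; first by apply: cvgB; [exact: cvg_cst|exact: cvg_id].
by apply: (continuous_comp (f := -%R)); [exact: opp_continuous|exact: continuous_expR].
Qed.

Let psi0 x : 0 <= psi x.
Proof.
rewrite /psi; have -> : (1 - x) * expR (- x) + 1 = (expR x + (1 - x)) * expR (- x).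
  by rewrite [RHS]mulrDl expRxMexpNx_1 addrC.
by rewrite mulr_ge0 ?expR_ge0//; have := expR_ge1Dx x; lra.
Qed.

Let Psi_le x y : x <= y -> Psi x <= Psi y.
Proof.
move=> xy; rewrite -subr_ge0 -lee_fin.
rewrite -(integral_is_derive xy (fun t _ => dPsi t) (fun t _ => @cpsi t)).
by apply: integral_ge0 => t _; rewrite lee_fin psi0.
Qed.

Let J z y := (\int[mu]_(s in `[z, y[) (psi s * (H y - H s))%:E)%E.

Let JE z y : 0 < z -> z <= y ->
  (\int[T]_(t in `[z, y[) (inv_erlang1 t * (Psi t - Psi z))%:E = J z y)%E.
Proof.
move=> z0 zy.
exact: (weighted_increment_by_parts z0 (fun t _ => dPsi t) (fun t _ => @cpsi t) (fun t _ => psi0 t)).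
Qed.

Let I_lty z y : 0 < z -> z <= y -> (I z y < +oo)%E.
Proof.
move=> z0 zy; rewrite -IE//.
apply: (@le_lt_trans _ _ (\int[T]_(t in `[z, y[) (y%:E * (inv_erlang1 t)%:E))%E).
  apply: ge0_le_integral => //.
  - move=> t; rewrite /= in_itv/= => /andP[zt _].
    by rewrite lee_fin mulr_ge0 ?inv_erlang1_ge0 ?subr_ge0.
  - apply/measurable_EFinP; apply: measurable_funM; first exact: mw.
    exact: measurable_funB.
  - by apply: measurable_funeM; apply/measurable_EFinP; exact: mw.
  - move=> t; rewrite /= in_itv/= => /andP[zt ty].
    rewrite -EFinM lee_fin mulrC ler_wpM2r ?inv_erlang1_ge0//; lra.
rewrite ge0_integralZl//.
- by rewrite -itv_co_set HE// -EFinM ltry.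
- by apply/measurable_EFinP; exact: mw.
- by move=> t _; rewrite lee_fin inv_erlang1_ge0.
- by rewrite lee_fin (le_trans (ltW z0)).
Qed.

Let law_itv_co_increments_I z y : 0 < z -> z <= y ->
  (T `[z, y[%classic + I z y = J z y + (z * expR (- z) * (H y - H z))%:E)%E.
Proof.
move=> z0 zy; have z00 : 0 <= z * expR (- z) by rewrite mulr_ge0 ?expR_ge0// ltW.
have t0 t : (`[z, y[%classic : set R) t -> 0 < t.
  by rewrite /= in_itv/= => /andP[zt _]; exact: lt_le_trans zt.
have tz t : (`[z, y[%classic : set R) t -> 0 <= t - z.
  by rewrite /= in_itv/= subr_ge0 => /andP[].
have mid : measurable_fun (`[z, y[%classic : set R) (fun t : R => t) by exact: measurable_id.
have mt : measurable_fun (`[z, y[%classic : set R) (fun t => (inv_erlang1 t * (t - z))%:E).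
  by apply/measurable_EFinP; apply: measurable_funM => //; exact: measurable_funB.
have mPsi : measurable_fun (`[z, y[%classic : set R) Psi.
  apply: measurable_funD => //; apply: measurable_funM => //.
  by apply: measurableT_comp => //; exact: measurableT_comp.
have te_le t : (`[z, y[%classic : set R) t -> 0 <= Psi t - Psi z.
  by rewrite /= in_itv/= subr_ge0 => /andP[zt _]; exact: Psi_le.
rewrite -IE// -JE// EFinM -HE// itv_co_set -ge0_integralZl//; last 2 first.
- by apply/measurable_EFinP; exact: mw.
- by move=> t _; rewrite lee_fin inv_erlang1_ge0.
have -> : T `[z, y[%classic = (\int[T]_(t in `[z, y[) (cst 1%E t))%E.
  by rewrite integral_cst//= mul1e.
rewrite -!ge0_integralD//.
- apply: eq_integral => t; rewrite inE => /t0 t0'; rewrite -EFinM -!EFinD; congr EFin; rewrite /Psi.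
  have := inv_erlang1_erlang 0 t0'; rewrite /erlang !expr1 expr0 factS fact0 !divr1.
  move=> w1; rewrite -{1}w1; ring.
- by move=> t ht; rewrite lee_fin mulr_ge0 ?inv_erlang1_ge0// te_le.
- apply/measurable_EFinP; apply: measurable_funM; first exact: mw.
  exact: (@measurable_funB _ _ R _ Psi (cst (Psi z))).
- by move=> t _; rewrite mule_ge0 ?lee_fin ?inv_erlang1_ge0.
- by apply: measurable_funeM; apply/measurable_EFinP; exact: mw.
- by move=> t ht; rewrite lee_fin mulr_ge0 ?inv_erlang1_ge0// tz.
Qed.

(** The mass of [z, y) is the integral of [t e^(-t)] against [e^t / t dT],
    that is against [dH], so integration by parts expresses it through [H].
    The derivative of [t e^(-t)] changes sign; adding [t] makes it
    nonnegative, and the integral for [t] is then subtracted. *)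
Lemma law_itv_co_increments z y : 0 < z -> z <= y ->
  (T `[z, y[%classic =
   \int[mu]_(s in `[z, y[) (((1 - s) * expR (- s) + 1) * (H y - H s))%:E +
   (z * expR (- z) * (H y - H z))%:E -
   \int[mu]_(s in `[z, y[) (H y - H s)%:E)%E.
Proof.
move=> z0 zy; have E := law_itv_co_increments_I z0 zy.
have Ifin : I z y \is a fin_num.
  rewrite ge0_fin_numE ?I_lty// -IE//; apply: integral_ge0 => t.
  rewrite /= in_itv/= => /andP[zt _].
  by rewrite lee_fin mulr_ge0 ?inv_erlang1_ge0 ?subr_ge0.
by rewrite -[LHS](addeK _ Ifin) E.
Qed.

End increments_determine_law.

(** The masses of the intervals [z, y) with [z > 0] are functions of [H]
    alone, and they determine those of the rays. *)
Lemma law_eq_of_increments (R : realType) (T T' : law R) (H : R -> R) :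
  T `]0, +oo[%classic = 1%E -> T' `]0, +oo[%classic = 1%E ->
  (forall z y : R, 0 < z -> z <= y ->
    (\int[T]_(t in [set t | (z <= t < y)%R]) (inv_erlang1 t)%:E = (H y - H z)%:E)%E) ->
  (forall z y : R, 0 < z -> z <= y ->
    (\int[T']_(t in [set t | (z <= t < y)%R]) (inv_erlang1 t)%:E = (H y - H z)%:E)%E) ->
  law_eq T T'.
Proof.
move=> T1 T'1 TH T'H; apply: law_unique_ge => x.
have [x0|x0] := leP x 0.
  have one (S : law R) : S `]0, +oo[%classic = 1%E -> S `[x, +oo[%classic = 1%E.
    move=> S1; apply/eqP; rewrite eq_le probability_le1//= -S1.
    apply: le_measure; rewrite ?inE//= => t; rewrite /= !in_itv/= !andbT => t0.
    exact: le_trans x0 (ltW t0).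
  by rewrite !one.
pose A n := (`[x, x + n%:R[%classic : set (measurableTypeR R)).
have ndA : nondecreasing_seq A.
  move=> n m nm; apply/subsetPset => t; rewrite /A/= !in_itv/= => /andP[-> /lt_le_trans]; apply.
  by rewrite lerD2l ler_nat.
have UA : \bigcup_n A n = `[x, +oo[%classic.
  apply/seteqP; split=> t /=; first by move=> [n _]; rewrite /A/= !in_itv/= => /andP[->].
  rewrite in_itv/= andbT => xt; exists (Num.Def.archi_bound (t - x)) => //.
  by rewrite /A/= in_itv/= xt/= -ltrBlDl archi_boundP// subr_ge0.
have cvgA (S : law R) : S (A n) @[n --> \oo] --> S `[x, +oo[%classic.
  rewrite -UA; apply: nondecreasing_cvg_mu => //; last by rewrite UA; exact: measurable_itv.
  by move=> n; exact: measurable_itv.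
have TA n : T (A n) = T' (A n).
  have xn : x <= x + n%:R by rewrite lerDl.
  by rewrite /A (law_itv_co_increments TH)// (law_itv_co_increments T'H).
apply: cvg_unique (cvgA T) _ => //.
rewrite (_ : (fun n => T (A n)) = (fun n => T' (A n))); first exact: cvgA.
exact/funext.
Qed.

(** * The two correspondences *)

Section part_i.
Context (R : realType) (d : measure_display)
    (Omega : measurableType d) (P : probability Omega R)
    (V : nat -> {RV P >-> R}) (iidV : iid_uniform01 V).
Variables (X : law R) (H : R -> R).
Hypotheses (HH : Hstar_fun H)
  (XH : forall u, 0 < u < 1 -> inv_distr_fun X u = H (L u)).

Lemma has_expected_records_Hstar : has_expected_records V X.
Proof.
move=> n; apply: (record_of_integrable iidV XH).
exact: Hstar_erlang.
Qed.

Lemma expected_recordE n : expected_record V X n = rho H n.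
Proof.
by rewrite /expected_record unlock (integral_record_of iidV XH).
Qed.

Lemma phi_records T : is_phi X T -> records_moments (expected_record V X) T.
Proof.
by move=> XT n; rewrite !expected_recordE; exact: (phi_records_moments XH HH XT).
Qed.

End part_i.

(** The law [X] has some image under [phi]; its increments are those of [T],
    hence it is [T]. *)
Lemma is_phi_inv_phi (R : realType) (T X : law R) c : calT T ->
  (forall u, 0 < u < 1 -> inv_distr_fun X u = phi_inv_fun T c (L u)) -> is_phi X T.
Proof.
move=> hT XH; have HH := phi_inv_Hstar hT c.
have [T' XT'] := is_phi_exists XH HH.
have [T'0 _] := phi_calT XH HH XT'; have [T0 _] := hT.
have TT' : law_eq T T'.
  apply: (law_eq_of_increments T0 T'0 (@phi_inv_increments _ T c)) => z y z0 zy.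
  by rewrite (phi_increments XH HH XT')// phi_inv_gap// divr1.
have [W [WE T'E]] := XT'; exists W; split => // A mA.
by rewrite TT'// T'E.
Qed.

(** Both functions have the increments of [e^t / t dT], so they differ by a
    constant, which vanishes as both have [rho 0 = 0]. *)
Lemma is_phi_H0_unique (R : realType) (T X Y : law R) :
  H0 X -> H0 Y -> is_phi X T -> is_phi Y T -> law_eq X Y.
Proof.
move=> [H hH XH] [K hK YK] XT YT.
have [HH _ _] := hH; have [HK _ _] := hK.
have [H_0 H_1] := rho_H0_fun hH; have [K_0 K_1] := rho_H0_fun hK.
have incr z y : 0 < z -> z <= y -> H y - H z = K y - K z.
  move=> z0 zy; apply: EFin_inj.
  have := phi_increments XH HH XT z0 zy; rewrite H_0 H_1 subr0 divr1 => <-.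
  by rewrite (phi_increments YK HK YT)// K_0 K_1 subr0 divr1.
have HE y : 0 < y -> H y = K y + (H 1 - K 1).
  move=> y0; have [y1|/ltW y1] := leP 1 y.
    by have := incr _ _ ltr01 y1; lra.
  by have := incr _ _ y0 y1; lra.
have := rho_shift 0 HK HE; rewrite H_0 K_0 add0r => k0.
apply: law_eq_inv_distr_fun => u u01.
by rewrite XH// YK// HE ?L_gt0// -k0 addr0.
Qed.

Theorem theorem2p2 (R : realType) (d : measure_display)
    (Omega : measurableType d) (P : probability Omega R)
    (V : nat -> {RV P >-> R}) (iidV : iid_uniform01 V) :
  (forall X : law R, Hstar X ->
     (exists T : law R, is_phi X T) /\
     (forall T : law R, is_phi X T ->
        [/\ calT T,
            has_expected_records V X
          & records_moments (expected_record V X) T])) /\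
  (forall T : law R, calT T ->
     (exists X0 : law R, is_phi_inv T X0) /\
     (forall X0 : law R, is_phi_inv T X0 ->
        [/\ H0 X0,
            is_phi X0 T /\
              (forall X : law R, H0 X -> is_phi X T -> law_eq X X0),
            has_expected_records V X0,
            records_moments (expected_record V X0) T
          & expected_record V X0 0%N = 0 /\ expected_record V X0 1%N = 1])).
Proof.
split=> [X [H HH XH]|T hT].
  split; first exact: (is_phi_exists XH HH).
  move=> T XT; split; first exact: (phi_calT XH HH XT).
    exact: (has_expected_records_Hstar iidV HH XH).
  exact: (phi_records iidV HH XH).
split; first exact: is_phi_inv_exists.
move=> X [c [Pc XP]].
have XH u : 0 < u < 1 -> inv_distr_fun X u = phi_inv_fun T c (L u).
  by move=> u01; rewrite -XP ?L_gt0//; case/andP: u01 => _ u1; rewrite -{1}[u]LK.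
have HH := phi_inv_Hstar hT c.
have r0 : rho (phi_inv_fun T c) 0 = 0.
  rewrite /rho (_ : (\int[_]_(_ in _) _)%E = 0%E)// -Pc.
  by apply: eq_integral => y _; rewrite erlang_0E.
have r1 : rho (phi_inv_fun T c) 1 = 1.
  by have := phi_inv_gap hT c; rewrite r0 subr0.
have X0 : H0 X by exists (phi_inv_fun T c) => //; exact: H0_fun_rho.
have XT := is_phi_inv_phi hT XH.
split => //.
- by split => // Y Y0 YT; exact: (is_phi_H0_unique Y0 X0 YT XT).
- exact: (has_expected_records_Hstar iidV HH XH).
- exact: (phi_records iidV HH XH).
- by rewrite !(expected_recordE iidV XH) r0 r1.
Qed.
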